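(* Assume $\alpha>3$ and let $(\ell_N)_{N\ge1}$ be a sequence of positive integers with $\ell_N\to\infty$ and $\ell_N/N\to0$. Then for every nonempty proper subset $A\subsetneq\mathbb T_L$, $$\lim_{N\to\infty}N^{1+\alpha}\,\mathrm{Cap}_N\big(\mathscr E_N(A),\mathscr E_N(A^c)\big)=\frac{1}{\Gamma(\alpha)\,I_\alpha}\sum_{x\in A,\,y\notin A}\mathrm{Cap}(x,y)=\frac{1}{\Gamma(\alpha)\,I_\alpha}\,\frac{|A|\,(L-|A|)}{L}.$$
   Context: Fix an integer $L\ge2$ and let $\mathbb T_L=\mathbb Z/L\mathbb Z$. Fix $\alpha>0$; set $a(0)=1$, $a(n)=n^\alpha$ for $n\ge1$, $g(0)=0$ and $g(n)=a(n)/a(n-1)$ for $n\ge1$. For $N\ge1$ let $E_N=\{\eta\in\{0,1,2,\dots\}^{\mathbb T_L}:\sum_x\eta_x=N\}$. For $\eta$ with $\eta_x>0$, $\sigma^{x,y}\eta$ denotes the configuration obtained from $\eta$ by moving one particle from $x$ to $y$. The totally asymmetric zero range process on $E_N$ is the continuous-time Markov chain with generator $(\mathcal LF)(\eta)=\sum_{x\in\mathbb T_L}g(\eta_x)[F(\sigma^{x,x+1}\eta)-F(\eta)]$. Its invariant probability measure is $\mu_N(\eta)=W_N^{-1}\prod_{x}a(\eta_x)^{-1}$ with $W_N=\sum_{\zeta\in E_N}\prod_x a(\zeta_x)^{-1}$. Write $\langle\cdot,\cdot\rangle_{\mu_N}$ for the inner product of $L^2(\mu_N)$ and $D_N(F)=\frac12\sum_{x\in\mathbb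 T_L}\sum_{\eta\in E_N}\mu_N(\eta)g(\eta_x)[F(\sigma^{x,x+1}\eta)-F(\eta)]^2$ for the Dirichlet form. For disjoint nonempty $\mathscr A,\mathscr B\subset E_N$, let $V_{\mathscr A,\mathscr B}$ be the function on $E_N$ equal to $1$ on $\mathscr A$, $0$ on $\mathscr B$, and $V(\eta)=\mathbf P_\eta[H_{\mathscr A}<H_{\mathscr B}]$ otherwise (the unique function with these boundary values satisfying $\mathcal LV=0$ off $\mathscr A\cup\mathscr B$), where $H$ denotes hitting times of the process; the capacity is $\mathrm{Cap}_N(\mathscr A,\mathscr B)=D_N(V_{\mathscr A,\mathscr B})$. Constants: $\Gamma(\alpha):=\sum_{j\ge0}1/a(j)$ (this is not Euler's Gamma function) and $I_\alpha:=\int_0^1u^\alpha(1-u)^\alpha\,du$. $\mathrm{Cap}(x,y)$, $x\neq y$, denotes the capacity between $x$ and $y$ of the rate-one totally asymmetric random walk on $\mathbb T_L$ jumping $z\to z+1$, with respect to the uniform measure; it equals $1/L$. Given $(\ell_N)$, set $\mathscr E^x_N=\{\eta\in E_N:\eta_x\ge N-\ell_N\}$ for $x\in\mathbb T_L$ and $\mathscr E_N(A)=\bigcup_{x\in A}\mathscr E^x_N$ for $A\subset\mathbb T_L$ (these sets are pairwise disjoint for $N$ large). *)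

(* Defs.v *)
From Stdlib Require Import Reals ClassicalEpsilon.
From HB Require Import structures.
From mathcomp Require Import all_boot.
Set Implicit Arguments. Unset Strict Implicit. Unset Printing Implicit Defensive.

Local Open Scope R_scope.

Definition rpow (u al : R) : R := if Rle_dec u 0 then 0 else Rpower u al.

Definition aR (al : R) (n : nat) : R := if n is 0 then 1 else Rpower (INR n) al.
Definition gR (al : R) (n : nat) : R :=
  if n is 0 then 0 else aR al n / aR al n.-1.

Definition conf (L : nat) := {ffun 'I_L -> nat}.

Definition inE (L N : nat) (eta : conf L) : bool := (\sum_(x < L) eta x == N)%N.

Definition embed (L N : nat) (t : {ffun 'I_L -> 'I_N.+1}) : conf L :=
  [ffun x => nat_of_ord (t x)].

(* sum of f over E_N (each configuration of E_N counted exactly once) *)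
Definition sumE (L N : nat) (f : conf L -> R) : R :=
  \big[Rplus/0]_(t : {ffun 'I_L -> 'I_N.+1} | (\sum_(x < L) (t x : nat) == N)%N)
     f (embed t).

Definition sigma (L : nat) (x y : 'I_L) (eta : conf L) : conf L :=
  [ffun z => (eta z - (z == x) + (z == y))%N].

Definition succ (L : nat) (x : 'I_L) : 'I_L := ordS x.

Definition weight (al : R) (L : nat) (eta : conf L) : R :=
  \big[Rmult/1]_(x < L) / aR al (eta x).

Definition WN (al : R) (L N : nat) : R := sumE N (weight al (L:=L)).

Definition muN (al : R) (L N : nat) (eta : conf L) : R :=
  / WN al L N * weight al eta.

Definition gen (al : R) (L : nat) (F : conf L -> R) (eta : conf L) : R :=
  \big[Rplus/0]_(x < L) (gR al (eta x) * (F (sigma x (succ x) eta) - F eta)).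

Definition dirichlet (al : R) (L N : nat) (F : conf L -> R) : R :=
  / 2 * \big[Rplus/0]_(x < L)
          sumE N (fun eta => muN al N eta * gR al (eta x)
                              * (F (sigma x (succ x) eta) - F eta) ^ 2).

Definition is_potential (al : R) (L N : nat) (A B : pred (conf L))
    (V : conf L -> R) : Prop :=
  (forall eta, inE N eta -> A eta -> V eta = 1) /\
  (forall eta, inE N eta -> B eta -> V eta = 0) /\
  (forall eta, inE N eta -> ~~ A eta -> ~~ B eta -> gen al V eta = 0).

Definition potential (al : R) (L N : nat) (A B : pred (conf L)) : conf L -> R :=
  epsilon (inhabits (fun _ => 0)) (is_potential al N A B).

Definition capN (al : R) (L N : nat) (A B : pred (conf L)) : R :=
  dirichlet al N (potential al N A B).

Definition EN (L N l : nat) (A : {set 'I_L}) : pred (conf L) :=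
  fun eta => [exists x in A, (N - l <= eta x)%N].

(* Main.v *)
(* Let L* be the adjoint generator, under which particles jump to the left, and V the
   equilibrium potential. If F is within eps of 1 on the wells of A and of 0 on the wells
   of the complement, then <F, -L V> = (1 + O(eps)) Cap, and <F, -L V> = <-L* F, V>. So if
   the L^1(mu) norm of L* F off the wells is o(N^(-1-alpha)), V can be replaced by the
   indicator G of the wells of A, and Cap is asymptotic to the explicit <F, -L G>.

   Such an F is obtained as follows. Let p and r be the two largest sites and M the number
   of particles in the cyclic interval [r, p), i.e. those that reach r before p under L*.
   Then F is 1_A(p) + (1_A(r) - 1_A(p)) Phi(M), where Phi has increments proportional to
   a(i) a(N - 1 - i). With this M, L* F has only the two terms of the jumps out of p and r,
   which cancel to second order; where the second and the third site tie, F may jump but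
   the measure is small, which is where alpha > 3 is used. In <F, -L G> a single site y of
   A is filled up to the border of its well and the other L - 1 sites condense on some r:
   each r outside A contributes N^(-1-alpha) / (L Gamma I). *)

Require Import Defs.
From Stdlib Require Import Reals Lra Lia ClassicalEpsilon.
From HB Require Import structures.
From Coquelicot Require Import Coquelicot.
From mathcomp Require Import all_boot zify.
Set Implicit Arguments. Unset Strict Implicit. Unset Printing Implicit Defensive.
Local Open Scope R_scope.
Local Arguments INR : simpl never.

(** The dynamics is not reversible, so the capacity is not a minimum of the Dirichlet form and no
    variational principle is used. The potential enters only through its boundary values, its
    harmonicity and [0 <= V <= 1]; this is why an L^1 bound on the adjoint generator suffices. The
    profile [Phi] solves the problem of two sites sharing [N] particles: a background split as [i],
    [N-1-i] has conductance [1 / (a(i) a(N-1-i))], and the total resistance is asymptotic to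
    [N^(2 al + 1) I_al]. Since [N^al W_N] tends to [L Gamma^(L-1)] and the sites other than [y] and
    [r] contribute [Gamma^(L-2)], one pair gives [1 / (L Gamma I_al)]. Errors are measured with a
    second exponent [ga]: lowering one-site weights from [n^(-al)] to [n^(-ga)] absorbs powers of
    occupation numbers, while [1 < ga] keeps the sums finite. That [l_N] grows makes tails of the
    [ga]-series vanish; that [l_N / N] vanishes makes [F] nearly constant on each well. All
    estimates are explicit at fixed [N], and limits are taken only at the end. *)

Lemma RplusA : associative Rplus. Proof. by move=> x y z; rewrite Rplus_assoc. Qed.
Lemma RmultA : associative Rmult. Proof. by move=> x y z; rewrite Rmult_assoc. Qed.
HB.instance Definition _ :=
  Monoid.isComLaw.Build R 0 Rplus RplusA Rplus_comm Rplus_0_l.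
HB.instance Definition _ :=
  Monoid.isComLaw.Build R 1 Rmult RmultA Rmult_comm Rmult_1_l.
HB.instance Definition _ :=
  Monoid.isMulLaw.Build R 0 Rmult Rmult_0_l Rmult_0_r.
HB.instance Definition _ :=
  Monoid.isAddLaw.Build R Rmult Rplus Rmult_plus_distr_r Rmult_plus_distr_l.

Notation "\sum_ ( i <- r | P ) F" := (\big[Rplus/0]_(i <- r | P) F) : R_scope.
Notation "\sum_ ( i <- r ) F" := (\big[Rplus/0]_(i <- r) F) : R_scope.
Notation "\sum_ ( i | P ) F" := (\big[Rplus/0]_(i | P) F) : R_scope.
Notation "\sum_ ( i : t | P ) F" := (\big[Rplus/0]_(i : t | P) F) (only parsing) : R_scope.
Notation "\sum_ ( i < n | P ) F" := (\big[Rplus/0]_(i < n | P) F) : R_scope.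
Notation "\sum_ ( i < n ) F" := (\big[Rplus/0]_(i < n) F) : R_scope.
Notation "\sum_ ( i 'in' A ) F" := (\big[Rplus/0]_(i in A) F) : R_scope.
Notation "\prod_ ( i <- r | P ) F" := (\big[Rmult/1]_(i <- r | P) F) : R_scope.
Notation "\prod_ ( i | P ) F" := (\big[Rmult/1]_(i | P) F) : R_scope.
Notation "\prod_ ( i < n | P ) F" := (\big[Rmult/1]_(i < n | P) F) : R_scope.
Notation "\prod_ ( i < n ) F" := (\big[Rmult/1]_(i < n) F) : R_scope.

Notation isE := Defs.inE.

Definition indR (b : bool) : R := if b then 1 else 0.

Lemma indR_ge0 b : 0 <= indR b. Proof. by case: b => /=; lra. Qed.

(** * Finite sums and products of real numbers *)

Section BigR.
Variables (I : Type) (r : seq I) (P : pred I).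

Lemma sumR_ge0 (F : I -> R) : (forall i, P i -> 0 <= F i) -> 0 <= \sum_(i <- r | P i) F i.
Proof. move=> h; elim/big_ind: _ => //; [lra|move=> x y; lra]. Qed.

Lemma sumR_le (F G : I -> R) : (forall i, P i -> F i <= G i) ->
  \sum_(i <- r | P i) F i <= \sum_(i <- r | P i) G i.
Proof. move=> h; elim/big_ind2: _ => //; [lra|move=> *; lra]. Qed.

Lemma sumR_abs (F : I -> R) : Rabs (\sum_(i <- r | P i) F i) <= \sum_(i <- r | P i) Rabs (F i).
Proof.
elim/big_ind2: _ => //; [by rewrite Rabs_R0; lra| |by move=> *; lra].
by move=> x1 x2 y1 y2 h1 h2; apply: Rle_trans (Rabs_triang _ _) _; lra.
Qed.

Lemma sumR_mull (c : R) (F : I -> R) :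
  c * \sum_(i <- r | P i) F i = \sum_(i <- r | P i) (c * F i).
Proof. by rewrite big_distrr. Qed.

Lemma sumR_mulr (c : R) (F : I -> R) :
  (\sum_(i <- r | P i) F i) * c = \sum_(i <- r | P i) (F i * c).
Proof. by rewrite big_distrl. Qed.

Lemma sumR_add (F G : I -> R) :
  \sum_(i <- r | P i) (F i + G i) = \sum_(i <- r | P i) F i + \sum_(i <- r | P i) G i.
Proof. exact: big_split. Qed.

Lemma sumR_opp (F : I -> R) : \sum_(i <- r | P i) - F i = - \sum_(i <- r | P i) F i.
Proof. by elim/big_rec2: _ => [|i x y _ ->]; lra. Qed.

Lemma sumR_sub (F G : I -> R) :
  \sum_(i <- r | P i) (F i - G i) = \sum_(i <- r | P i) F i - \sum_(i <- r | P i) G i.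
Proof. by rewrite /Rminus sumR_add sumR_opp. Qed.

Lemma prodR_ge0 (F : I -> R) : (forall i, P i -> 0 <= F i) -> 0 <= \prod_(i <- r | P i) F i.
Proof. move=> h; elim/big_ind: _ => //; [lra|exact: Rmult_le_pos]. Qed.

Lemma prodR_gt0 (F : I -> R) : (forall i, P i -> 0 < F i) -> 0 < \prod_(i <- r | P i) F i.
Proof. move=> h; elim/big_ind: _ => //; [lra|exact: Rmult_lt_0_compat]. Qed.

Lemma prodR_le (F G : I -> R) : (forall i, P i -> 0 <= F i <= G i) ->
  \prod_(i <- r | P i) F i <= \prod_(i <- r | P i) G i.
Proof.
move=> h; suff: 0 <= \prod_(i <- r | P i) F i <= \prod_(i <- r | P i) G i by lra.
elim/big_ind2: _ => //; first lra.
by move=> x1 x2 y1 y2 h1 h2; split; [apply: Rmult_le_pos|apply: Rmult_le_compat]; lra.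
Qed.

Lemma sumR_mask (F : I -> R) : \sum_(i <- r | P i) F i = \sum_(i <- r) (indR (P i) * F i).
Proof. by rewrite big_mkcond; apply: eq_bigr => i _; case: (P i) => /=; lra. Qed.

End BigR.

Lemma sumR_le_mem (I : eqType) (r : seq I) (P : pred I) (F G : I -> R) :
  (forall i, i \in r -> P i -> F i <= G i) ->
  \sum_(i <- r | P i) F i <= \sum_(i <- r | P i) G i.
Proof.
move=> h; rewrite big_seq_cond [X in _ <= X]big_seq_cond.
by apply: sumR_le => i /andP[]; exact: h.
Qed.

Lemma sumR_ord_nat (n : nat) (F : nat -> R) :
  \sum_(i < n.+1) F i = sum_f_R0 F n.
Proof. by elim: n => [|n IH]; rewrite big_ord_recr /= ?big_ord0 ?IH //; lra. Qed.

Lemma sumR_le0 (I : eqType) (r : seq I) (P : pred I) (F : I -> R) :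
  (forall i, i \in r -> P i -> F i <= 0) -> \sum_(i <- r | P i) F i <= 0.
Proof.
move=> h; apply: Rle_trans (_ : \sum_(i <- r | P i) 0 <= 0); first exact: sumR_le_mem.
by rewrite big1 //; lra.
Qed.

Lemma sumR_mono (I : finType) (P Q : pred I) (F : I -> R) :
  (forall i, P i -> Q i) -> (forall i, Q i -> 0 <= F i) ->
  \sum_(i | P i) F i <= \sum_(i | Q i) F i.
Proof.
move=> PQ F0; rewrite sumR_mask [X in _ <= X]sumR_mask; apply: sumR_le => i _.
case Pi: (P i); first by rewrite PQ //; lra.
by case Qi: (Q i) => /=; [have := F0 _ Qi|]; lra.
Qed.

Lemma sumR_term (I : finType) (P : pred I) (F : I -> R) j :
  P j -> (forall i, P i -> 0 <= F i) -> F j <= \sum_(i | P i) F i.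
Proof.
move=> Pj F0; rewrite (bigD1 j) //=.
by have := @sumR_ge0 _ (index_enum I) (fun i => P i && (i != j)) F (fun i h => F0 i (proj1 (andP h))); lra.
Qed.

Lemma sumR_D1 (I : finType) j (P : pred I) (F : I -> R) : P j ->
  \sum_(i | P i) F i = F j + \sum_(i | P i && (i != j)) F i.
Proof. exact: bigD1. Qed.

Lemma prodR_D1 (I : finType) j (P : pred I) (F : I -> R) : P j ->
  \prod_(i | P i) F i = F j * \prod_(i | P i && (i != j)) F i.
Proof. exact: bigD1. Qed.

Lemma sumR_D1_seq (I : eqType) (r : seq I) j (F : I -> R) : j \in r -> uniq r ->
  \sum_(i <- r) F i = F j + \sum_(i <- r | i != j) F i.
Proof. exact: bigD1_seq. Qed.

Lemma sumR_const (I : finType) (P : pred I) (c : R) :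
  \sum_(i | P i) c = INR #|P| * c.
Proof.
rewrite big_const; elim: #|P| => [|n IH]; first by rewrite /INR /=; lra.
by rewrite iterS IH S_INR; lra.
Qed.

Lemma sumR_const_ord (n : nat) (c : R) : \sum_(i < n) c = INR n * c.
Proof. by rewrite sumR_const card_ord. Qed.

Lemma prodR_const (I : finType) (P : pred I) (c : R) :
  \prod_(i | P i) c = c ^ #|P|.
Proof. by rewrite big_const; elim: #|P| => [|n IH] //; rewrite iterS IH. Qed.

Lemma div_mono a b c : 0 <= c -> a <= b -> a / c <= b / c.
Proof.
move=> [c0|<-] ab; last by rewrite /Rdiv Rinv_0; lra.
by apply: Rmult_le_compat_r => //; apply: Rlt_le; exact: Rinv_0_lt_compat.
Qed.

(** * Configurations *)

(** A jump from [x] to [y] replaces [addp x xi] by [addp y xi]. Jumps on [E_(N+1)] are thus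
    parametrized by a background [xi] in [E_N] and a pair of sites. *)
Definition addp (L : nat) (x : 'I_L) (xi : conf L) : conf L :=
  [ffun z => (xi z + (z == x))%N].

(** A list, since [conf L] is not a finite type; sums over it can be reindexed by [addp]. *)
Definition enumE (L N : nat) : seq (conf L) :=
  [seq embed t | t : {ffun 'I_L -> 'I_N.+1} <- index_enum _ & (\sum_(x < L) (t x : nat) == N)%N].

Section Conf.
Variable L : nat.
Implicit Types (N : nat) (eta xi : conf L) (x y z : 'I_L).

Lemma embed_inj N : injective (@embed L N).
Proof.
by move=> s t /ffunP h; apply/ffunP => x; apply: val_inj; have := h x; rewrite !ffunE.
Qed.

Lemma mem_enumE N eta : (eta \in enumE L N) = isE N eta.
Proof.
apply/mapP/idP => [[t]|h].
  rewrite mem_filter => /andP[/eqP h _] ->; rewrite /Defs.inE -[X in _ == X]h.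
  by apply/eqP; apply: eq_bigr => x _; rewrite ffunE.
have hle x : (eta x < N.+1)%N.
  by rewrite ltnS -(eqP h) (bigD1 x) //= leq_addr.
exists [ffun x => Ordinal (hle x)]; last by apply/ffunP => x; rewrite !ffunE.
rewrite mem_filter mem_index_enum andbT -[X in _ == X](eqP h).
by apply/eqP; apply: eq_bigr => x _; rewrite ffunE.
Qed.

Lemma enumE_uniq N : uniq (enumE L N).
Proof. by rewrite map_inj_uniq ?filter_uniq ?index_enum_uniq //; exact: embed_inj. Qed.

Lemma sumE_enumE N f : sumE N f = \sum_(eta <- enumE L N) f eta.
Proof. by rewrite /sumE /enumE big_map big_filter. Qed.

Lemma isE_le N eta x : isE N eta -> (eta x <= N)%N.
Proof. by move=> /eqP <-; rewrite (bigD1 x) //= leq_addr. Qed.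

Lemma isE_addp N xi x : isE N.+1 (addp x xi) = isE N xi.
Proof.
rewrite /Defs.inE (eq_bigr (fun z => xi z + (z == x))%N) => [|z _]; last by rewrite ffunE.
have -> : (\sum_(z < L) (xi z + (z == x)) = (\sum_(z < L) xi z).+1)%N.
  rewrite big_split -addn1 /=; congr (_ + _)%N.
  by rewrite (bigD1 x) //= eqxx big1 ?addn0 // => z /negbTE ->.
by rewrite eqSS.
Qed.

Lemma addp_inj x : injective (addp x).
Proof. by move=> s t /ffunP h; apply/ffunP => z; have := h z; rewrite !ffunE => /addIn. Qed.

Lemma sigma_addp x y xi : Defs.sigma x y (addp x xi) = addp y xi.
Proof. by apply/ffunP => z; rewrite !ffunE addnK. Qed.

Lemma addp_sub x eta : (0 < eta x)%N -> eta = addp x [ffun z => (eta z - (z == x))%N].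
Proof. by move=> h; apply/ffunP => z; rewrite !ffunE; case: eqP => [->|_] /=; lia. Qed.

Lemma isE_sigma N x y eta : (0 < eta x)%N -> isE N eta -> isE N (Defs.sigma x y eta).
Proof.
case: N => [|N].
  by move=> h /(isE_le x); lia.
by move=> /addp_sub -> h; rewrite sigma_addp; move: h; rewrite !isE_addp.
Qed.

Lemma sum_addp N x (f : conf L -> R) :
  \sum_(eta <- enumE L N.+1 | (0 < eta x)%N) f eta = \sum_(xi <- enumE L N) f (addp x xi).
Proof.
rewrite -big_filter -(big_map (addp x) predT f); apply: perm_big; apply: uniq_perm.
- by rewrite filter_uniq // enumE_uniq.
- by rewrite map_inj_uniq ?enumE_uniq //; exact: addp_inj.
move=> eta; rewrite mem_filter mem_enumE; apply/andP/mapP => [[h1 h2]|[xi h ->]].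
  by rewrite (addp_sub h1) isE_addp -mem_enumE in h2; eexists; [exact: h2|exact: addp_sub].
by rewrite isE_addp -mem_enumE h ffunE eqxx addn1.
Qed.

End Conf.

(** * The adjoint dynamics and the Dirichlet form *)

Lemma aR_gt0 al n : 0 < aR al n.
Proof. by case: n => [|n] /=; [lra|exact: exp_pos]. Qed.

Lemma gR_ge0 al n : 0 <= gR al n.
Proof.
case: n => [|n]; first by rewrite /=; lra.
by apply: Rlt_le; apply: Rdiv_lt_0_compat; exact: aR_gt0.
Qed.

Lemma gR_gt0 al n : (0 < n)%N -> 0 < gR al n.
Proof. by case: n => // n _; apply: Rdiv_lt_0_compat; exact: aR_gt0. Qed.

Section Dynamics.
Variables (al : R) (L : nat).
Implicit Types (N : nat) (eta xi : conf L) (x y z : 'I_L).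

Lemma weight_gt0 eta : 0 < weight al eta.
Proof. by apply: prodR_gt0 => x _; apply: Rinv_0_lt_compat; exact: aR_gt0. Qed.

(** The stationary rate of a jump out of [x] over the background [xi] is [weight al xi], whatever
    [x] is. Invariance of the measure and the form of the adjoint both rest on this. *)
Lemma weight_addp x xi : weight al (addp x xi) * gR al (xi x).+1 = weight al xi.
Proof.
rewrite /weight (bigD1 x) //= [in RHS](bigD1 x) //= ffunE eqxx addn1.
have h1 := aR_gt0 al (xi x); have h2 := aR_gt0 al (xi x).+1.
rewrite (eq_bigr (fun z => / aR al (xi z))) => [|z /negbTE zx]; last first.
  by rewrite ffunE zx addn0.
by rewrite /=; rewrite /= in h2; field; split; apply: Rgt_not_eq.
Qed.

Lemma sum_rate N x (f : conf L -> R) :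
  \sum_(eta <- enumE L N.+1) (weight al eta * gR al (eta x) * f eta) =
  \sum_(xi <- enumE L N) (weight al xi * f (addp x xi)).
Proof.
rewrite (bigID (fun eta : conf L => (0 < eta x)%N)) /= [X in _ + X]big1 => [|eta]; last first.
  by rewrite lt0n negbK => /eqP -> /=; lra.
rewrite Rplus_0_r sum_addp; apply: eq_bigr => xi _.
by rewrite -(weight_addp x xi) ffunE eqxx addn1.
Qed.

Definition adj_gen (F : conf L -> R) eta : R :=
  \sum_(x < L) (gR al (eta x) * (F (Defs.sigma x (ord_pred x) eta) - F eta)).

Lemma sum_jump N (f : 'I_L -> 'I_L) (F G : conf L -> R) :
  \sum_(eta <- enumE L N.+1) (weight al eta * (G eta *
     \sum_(x < L) (gR al (eta x) * (F (Defs.sigma x (f x) eta) - F eta)))) =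
  \sum_(xi <- enumE L N) (weight al xi *
     \sum_(x < L) (G (addp x xi) * (F (addp (f x) xi) - F (addp x xi)))).
Proof.
transitivity (\sum_(x < L) \sum_(eta <- enumE L N.+1) (weight al eta * gR al (eta x) *
     (G eta * (F (Defs.sigma x (f x) eta) - F eta)))).
  rewrite exchange_big; apply: eq_bigr => eta _.
  by rewrite !sumR_mull; apply: eq_bigr => x _; ring.
transitivity (\sum_(x < L) \sum_(xi <- enumE L N) (weight al xi *
     (G (addp x xi) * (F (addp (f x) xi) - F (addp x xi))))).
  by apply: eq_bigr => x _; rewrite sum_rate; apply: eq_bigr => xi _; rewrite sigma_addp.
by rewrite exchange_big; apply: eq_bigr => eta _; rewrite sumR_mull.
Qed.

Lemma gen_pair N (F G : conf L -> R) :
  \sum_(eta <- enumE L N.+1) (weight al eta * (G eta * gen al F eta)) =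
  \sum_(xi <- enumE L N) (weight al xi *
     \sum_(x < L) (G (addp x xi) * (F (addp (succ x) xi) - F (addp x xi)))).
Proof. exact: sum_jump. Qed.

(** Over a fixed background [xi], the configurations [addp x xi] form a cycle run through at
    constant stationary rate [weight al xi]. The transpose of this cyclic walk is the walk in the
    opposite direction, and reindexing by [ordS] shows it. *)
Lemma gen_adjoint N (F G : conf L -> R) :
  \sum_(eta <- enumE L N.+1) (weight al eta * (G eta * adj_gen F eta)) =
  \sum_(eta <- enumE L N.+1) (weight al eta * (F eta * gen al G eta)).
Proof.
rewrite gen_pair sum_jump; apply: eq_bigr => xi _; congr (_ * _).
rewrite (eq_bigr (fun x => G (addp x xi) * F (addp (ord_pred x) xi) -
   G (addp x xi) * F (addp x xi))) => [|x _]; last by ring.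
rewrite [RHS](eq_bigr (fun x => F (addp x xi) * G (addp (succ x) xi) -
   G (addp x xi) * F (addp x xi))) => [|x _]; last by ring.
rewrite !sumR_sub; congr (_ - _).
rewrite (reindex (@ordS L)) /=; last first.
  by exists (@ord_pred L) => x _; rewrite ?ordSK ?ord_predK.
by apply: eq_bigr => x _; rewrite ordSK Rmult_comm.
Qed.

Lemma sum_gen N (F : conf L -> R) :
  \sum_(eta <- enumE L N.+1) (weight al eta * gen al F eta) = 0.
Proof.
transitivity (\sum_(eta <- enumE L N.+1) (weight al eta * (1 * gen al F eta))).
  by apply: eq_bigr => eta _; rewrite Rmult_1_l.
rewrite -(gen_adjoint N (fun=> 1) F) big1 // => eta _; rewrite /adj_gen big1; first by ring.
by move=> x _; ring.
Qed.

(** On each cycle [u x := F (addp x xi)] has the same sum of squares as its shift, so half the sum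
    of squared increments is the sum of [u x ^ 2 - u x * u (succ x)]. No reversibility is
    involved. *)
Lemma dirichlet_gen N (F : conf L -> R) :
  dirichlet al N.+1 F =
  - (/ WN al L N.+1 * \sum_(eta <- enumE L N.+1) (weight al eta * (F eta * gen al F eta))).
Proof.
have e1 x : sumE N.+1 (fun eta => muN al N.+1 eta * gR al (eta x)
                              * (F (Defs.sigma x (succ x) eta) - F eta) ^ 2) =
  / WN al L N.+1 * \sum_(xi <- enumE L N)
       (weight al xi * (F (addp (succ x) xi) - F (addp x xi)) ^ 2).
  rewrite sumE_enumE sumR_mull.
  transitivity (\sum_(eta <- enumE L N.+1) (weight al eta * gR al (eta x) *
     (/ WN al L N.+1 * (F (Defs.sigma x (succ x) eta) - F eta) ^ 2))).
    by apply: eq_bigr => eta _; rewrite /muN; ring.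
  by rewrite sum_rate; apply: eq_bigr => xi _; rewrite sigma_addp; ring.
rewrite /dirichlet (eq_bigr _ (fun x _ => e1 x)) -sumR_mull exchange_big gen_pair.
rewrite -Rmult_assoc [/ 2 * _]Rmult_comm Rmult_assoc Ropp_mult_distr_r; congr (_ * _).
rewrite -sumR_opp sumR_mull; apply: eq_bigr => xi _.
rewrite -sumR_mull -Rmult_assoc [/ 2 * _]Rmult_comm Rmult_assoc Ropp_mult_distr_r.
congr (_ * _); pose u x := F (addp x xi).
pose S2 := \sum_(x < L) (u x) ^ 2.
have h : \sum_(x < L) (u (succ x)) ^ 2 = S2.
  rewrite /S2 [RHS](reindex (@ordS L)) //.
  by exists (@ord_pred L) => x _; rewrite ?ordSK ?ord_predK.
rewrite -/(u _) (eq_bigr (fun x => ((u (succ x)) ^ 2 + (u x) ^ 2) +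
      (- 2) * (u x * u (succ x)))) => [|x _]; last by rewrite -/(u x) -/(u (succ x)); ring.
rewrite !sumR_add h -/S2 -sumR_mull.
rewrite [in RHS](eq_bigr (fun x => u x * u (succ x) - (u x) ^ 2)) => [|x _]; last first.
  by rewrite -/(u x) -/(u (succ x)); ring.
by rewrite sumR_sub -/S2; field.
Qed.

End Dynamics.

(** * The equilibrium potential *)

Lemma is_lim_seq_sumR (I : Type) (r : seq I) (P : pred I) (u : I -> nat -> R) (l : I -> R) :
  (forall i, P i -> is_lim_seq (u i) (l i)) ->
  is_lim_seq (fun n => \sum_(i <- r | P i) u i n) (\sum_(i <- r | P i) l i).
Proof.
move=> h; elim: r => [|i r IH].
  by rewrite big_nil; apply: is_lim_seq_ext (is_lim_seq_const 0) => n; rewrite big_nil.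
rewrite big_cons; case: ifP => Pi.
  apply: is_lim_seq_ext (is_lim_seq_plus' _ _ _ _ (h _ Pi) IH) => n.
  by rewrite big_cons Pi.
by apply: is_lim_seq_ext IH => n; rewrite big_cons Pi.
Qed.

Lemma seq_argmaxR (T : eqType) (s : seq T) (f : T -> R) x : x \in s ->
  exists2 y, y \in s & forall z, z \in s -> f z <= f y.
Proof.
elim: s x => // a s IH x _; case: s IH => [|b s] IH.
  by exists a; rewrite ?mem_head // => z; rewrite mem_seq1 => /eqP ->; lra.
have [y ys hy] := IH b (mem_head _ _).
case: (Rle_lt_dec (f y) (f a)) => h.
  exists a; rewrite ?mem_head // => z; rewrite inE => /orP[/eqP ->|/hy]; lra.
exists y; first by rewrite inE ys orbT.
by move=> z; rewrite inE => /orP[/eqP ->|/hy]; lra.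
Qed.

Section Potential.
Variables (al : R) (L : nat).
Implicit Types (N : nat) (eta xi : conf L) (x y z : 'I_L).

(** The number of right jumps that lead from [z] to [x0]; weighted by the occupation numbers it is
    the decreasing quantity behind [max_principle]. *)
Definition dist x0 z : nat := if (z <= x0)%N then (x0 - z)%N else (x0 + L - z)%N.

Lemma dist_succ x0 z : z != x0 -> (dist x0 (succ z) < dist x0 z)%N.
Proof.
move=> /eqP zx; have zx' : (z : nat) <> x0 by move=> h; apply: zx; exact: val_inj.
have hz := ltn_ord z; have hx := ltn_ord x0.
rewrite /dist /succ /ordS /=; have [e|e] := eqVneq z.+1 L.
  by rewrite e modnn leq0n; case: (leqP z x0) => ?; lia.
by rewrite modn_small; [case: (leqP z.+1 x0) => ?; case: (leqP z x0) => ?; lia|lia].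
Qed.

Lemma sum_addp_dist (w : 'I_L -> nat) x xi :
  (\sum_(z < L) (addp x xi z * w z) = \sum_(z < L) (xi z * w z) + w x)%N.
Proof.
rewrite (eq_bigr (fun z => xi z * w z + (z == x) * w z)%N) => [|z _]; last first.
  by rewrite ffunE mulnDl.
rewrite big_split /=; congr (_ + _)%N.
by rewrite (bigD1 x) //= eqxx mul1n big1 ?addn0 // => z /negbTE ->.
Qed.

(* A maximum above the boundary values propagates along the jumps, and moving
   all the particles to [x0] takes the process into [W]. *)
Lemma max_principle N (W : pred (conf L)) (V : conf L -> R) x0 b :
  (forall eta, isE N eta -> eta x0 = N -> W eta) ->
  (forall eta, isE N eta -> ~~ W eta -> gen al V eta = 0) ->
  (forall eta, isE N eta -> W eta -> V eta <= b) ->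
  forall eta, isE N eta -> V eta <= b.
Proof.
move=> hW hV hb eta0 h0.
have [em emE hmax] : exists2 em, em \in enumE L N & forall e, e \in enumE L N -> V e <= V em.
  by apply: (@seq_argmaxR _ _ _ eta0); rewrite mem_enumE.
have := hmax eta0; rewrite mem_enumE => /(_ h0) h1.
apply: Rle_trans h1 _; apply: Rnot_lt_le => hlt.
pose d (eta : conf L) := (\sum_(z < L) (eta z * dist x0 z))%N.
rewrite mem_enumE in emE.
suff : forall k eta, isE N eta -> V eta = V em -> (d eta < k)%N -> False.
  by move=> /(_ (d em).+1 em emE erefl (ltnSn _)).
elim=> // k IH eta hE he hd.
have nW : ~~ W eta by apply/negP => /(hb _ hE); lra.
have [z /andP[zx z0]|hz] := pickP (fun z => (z != x0) && (0 < eta z)%N); last first.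
  have e0 z : z != x0 -> eta z = 0%N.
    by move=> zx; have := hz z; rewrite zx /= lt0n => /negbFE/eqP.
  move/negP: nW; apply; apply: hW => //.
  by have /eqP := hE; rewrite (bigD1 x0) //= big1 ?addn0.
pose t x := gR al (eta x) * (V (Defs.sigma x (succ x) eta) - V eta).
have t0 x : t x <= 0.
  rewrite /t; case: (posnP (eta x)) => [->|h]; first by rewrite /=; lra.
  have := hmax (Defs.sigma x (succ x) eta); rewrite mem_enumE => /(_ (isE_sigma _ h hE)).
  by rewrite he; have := gR_gt0 al h; nra.
have tz : t z = 0.
  have hs : \sum_(x < L) t x = 0 := hV _ hE nW.
  have := @sumR_term _ predT (fun x => - t x) z isT; rewrite sumR_opp hs.
  have t0' x : true -> 0 <= - t x by have := t0 x; lra.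
  by move=> /(_ t0'); have := t0 z; lra.
move: tz; rewrite /t => /Rmult_integral[|hz]; first by have := gR_gt0 al z0; lra.
apply: (IH (Defs.sigma z (succ z) eta)); [exact: isE_sigma|lra|].
move: hd; rewrite (addp_sub z0) sigma_addp /d !sum_addp_dist.
by have := dist_succ zx; lia.
Qed.

Section Existence.
Variables (A B : pred (conf L)).

(** One step of the embedded jump chain, with the boundary values imposed on [A] and [B]. Iterated
    from [0], it gives the probability of meeting [A] before [B] in fewer than [k] jumps. *)
Definition step (V : conf L -> R) eta : R :=
  if A eta then 1 else if B eta then 0 else
  (\sum_(x < L) (gR al (eta x) * V (Defs.sigma x (succ x) eta))) /
  (\sum_(x < L) gR al (eta x)).

Lemma rates_ge0 eta : 0 <= \sum_(x < L) gR al (eta x).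
Proof. by apply: sumR_ge0 => x _; exact: gR_ge0. Qed.

Lemma step_mono V W : (forall eta, V eta <= W eta) -> forall eta, step V eta <= step W eta.
Proof.
move=> h eta; rewrite /step; case: ifP => _; [lra|case: ifP => _; first lra].
apply: div_mono; first exact: rates_ge0.
by apply: sumR_le => x _; apply: Rmult_le_compat_l; [exact: gR_ge0|exact: h].
Qed.

Lemma iter_step_mono k eta : iter k step (fun=> 0) eta <= iter k.+1 step (fun=> 0) eta.
Proof.
elim: k eta => [|k IH] eta; last by rewrite !iterS; exact: step_mono.
rewrite /= /step; case: ifP => _; [lra|case: ifP => _; first lra].
rewrite big1 => [|x _]; last by ring.
by rewrite /Rdiv; lra.
Qed.

Lemma iter_step_le1 k eta : iter k step (fun=> 0) eta <= 1.
Proof.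
elim: k eta => [|k IH] eta /=; first lra.
rewrite /step; case: ifP => _; [lra|case: ifP => _; first lra].
apply: Rle_trans (_ : (\sum_(x < L) gR al (eta x)) / (\sum_(x < L) gR al (eta x)) <= 1).
  apply: div_mono; first exact: rates_ge0.
  apply: sumR_le => x _; rewrite -[X in _ <= X]Rmult_1_r.
  by apply: Rmult_le_compat_l; [exact: gR_ge0|exact: IH].
have := rates_ge0 eta; case=> [h|<-]; last by rewrite /Rdiv; lra.
by rewrite /Rdiv Rinv_r; lra.
Qed.

(** The iterates of [step] from [0] increase and stay below [1], so they converge; each value of
    [step] involves finitely many others, so the limit is a fixed point of [step], which off [A] and
    [B] means harmonic. *)
Lemma potential_exists N :
  (forall eta, isE N.+1 eta -> A eta -> ~~ B eta) ->
  exists V, is_potential al N.+1 A B V.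
Proof.
move=> AB.
have cv eta : {l : R | Un_cv (fun k => iter k step (fun=> 0) eta) l}.
  apply: growing_cv; first by move=> k; exact: iter_step_mono.
  by exists 1 => _ [k ->]; exact: iter_step_le1.
pose V eta := sval (cv eta).
have Vl eta : is_lim_seq (fun k => iter k step (fun=> 0) eta) (V eta).
  by apply/is_lim_seq_Reals; rewrite /V; case: (cv eta).
have Vl1 eta := proj1 (is_lim_seq_incr_1 _ _) (Vl eta).
have lim_eq eta (f : nat -> R) (l : R) :
   (forall k, iter k.+1 step (fun=> 0) eta = f k) -> is_lim_seq f l -> V eta = l.
  move=> hf hl; have h := is_lim_seq_ext _ _ _ hf (Vl1 eta).
  by have := is_lim_seq_unique _ _ h; rewrite (is_lim_seq_unique _ _ hl) => -[->].
exists V; split; [|split] => eta hE.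
- by move=> hA; apply: lim_eq (is_lim_seq_const 1) => k; rewrite iterS /step hA.
- move=> hB; apply: lim_eq (is_lim_seq_const 0) => k; rewrite iterS /step hB.
  by case: ifP => // hA; move: (AB _ hE hA); rewrite hB.
move=> hA hB; pose S := \sum_(x < L) gR al (eta x).
have S0 : 0 < S.
  have [x hx] : exists x, (0 < eta x)%N.
    apply/existsP; move: hE; apply: contraLR; rewrite negb_exists => /forallP h.
    rewrite /Defs.inE big1 // => x _; apply/eqP; rewrite -leqn0 leqNgt; exact: h.
  apply: Rlt_le_trans (gR_gt0 al hx) _.
  by apply: (@sumR_term _ predT (fun x => gR al (eta x))) => // i _; exact: gR_ge0.
pose T := \sum_(x < L) (gR al (eta x) * V (Defs.sigma x (succ x) eta)).
have e : V eta = T / S.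
  refine (lim_eq eta (fun k => (\sum_(x < L) (gR al (eta x) *
    iter k step (fun=> 0) (Defs.sigma x (succ x) eta))) / S) _ _ _) => [k|].
    by rewrite iterS /step (negbTE hA) (negbTE hB).
  apply: (is_lim_seq_mult' _ _ _ _ _ (is_lim_seq_const _)).
  apply: is_lim_seq_sumR => x _.
  exact: (is_lim_seq_mult' _ _ _ _ (is_lim_seq_const _) (Vl _)).
rewrite /gen (eq_bigr (fun x => gR al (eta x) * V (Defs.sigma x (succ x) eta) -
   V eta * gR al (eta x))) => [|x _]; last by ring.
by rewrite sumR_sub -sumR_mull -/S -/T e; field; lra.
Qed.

End Existence.

(** [potential] is an arbitrary solution picked by [epsilon], so its bounds cannot be read off the
    construction above; they follow from the maximum principle applied to [V] and to [- V]. *)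
Lemma potentialP N (A B : pred (conf L)) x0 :
  (forall eta, isE N.+1 eta -> A eta -> ~~ B eta) ->
  (forall eta, isE N.+1 eta -> eta x0 = N.+1 -> A eta || B eta) ->
  is_potential al N.+1 A B (potential al N.+1 A B) /\
  forall eta, isE N.+1 eta -> 0 <= potential al N.+1 A B eta <= 1.
Proof.
move=> AB hx; have hP : is_potential al N.+1 A B (potential al N.+1 A B).
  by apply: epsilon_spec; exact: potential_exists.
split=> // eta hE; set V := potential _ _ _ _ in hP *; case: hP => hA [hB hV].
pose W := fun e => A e || B e.
have VW e : isE N.+1 e -> ~~ W e -> gen al V e = 0.
  by move=> he; rewrite negb_or => /andP[]; exact: hV.
split.
  suff : - V eta <= 0 by lra.
  apply: (@max_principle N.+1 W (fun e => - V e) x0) hE => //.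
    move=> e he /VW h; rewrite -[RHS]Ropp_0 -(h he) /gen -sumR_opp.
    by apply: eq_bigr => x _; ring.
  by move=> e he /orP[/hA|/hB] ->//; lra.
apply: (@max_principle N.+1 W V x0) hE => //.
by move=> e he /orP[/hA|/hB] ->//; lra.
Qed.

End Potential.

(** * Power weights *)

Lemma INR_le m n : (m <= n)%N -> INR m <= INR n. Proof. by move=> /leP/le_INR. Qed.
Lemma INR_ge1 n : (0 < n)%N -> 1 <= INR n. Proof. by move=> /INR_le. Qed.
Lemma INR_addn m n : INR (m + n) = INR m + INR n. Proof. exact: plus_INR. Qed.
Lemma INR_muln m n : INR (m * n) = INR m * INR n. Proof. exact: mult_INR. Qed.
Lemma INR_subn m n : (n <= m)%N -> INR (m - n) = INR m - INR n.
Proof. by move=> /leP h; rewrite minus_INR. Qed.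
Lemma INR_sum (I : Type) (r : seq I) (P : pred I) (f : I -> nat) :
  INR (\sum_(i <- r | P i) f i)%N = \sum_(i <- r | P i) INR (f i).
Proof. exact: (big_morph INR INR_addn erefl). Qed.

Lemma ln_le_sub1 y : 0 < y -> ln y <= y - 1.
Proof. by move=> y0; have := exp_ineq1_le (ln y); rewrite exp_ln //; lra. Qed.

Lemma exp_le_affine u : exp u <= 1 + u * exp u.
Proof.
have h := exp_ineq1_le (- u); have e : exp u * exp (- u) = 1.
  by rewrite -exp_plus Rplus_opp_r exp_0.
by have := exp_pos u; nra.
Qed.

Lemma exp_mono x y : x <= y -> exp x <= exp y.
Proof. by case=> [h|->]; [apply: Rlt_le; exact: exp_increasing|lra]. Qed.

Section PowerWeights.
Implicit Types (s t : R) (m n i : nat).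

Lemma aRE s n : (0 < n)%N -> aR s n = Rpower (INR n) s. Proof. by case: n. Qed.

Lemma aRD s t n : aR (s + t) n = aR s n * aR t n.
Proof. by case: n => [|n] /=; [ring|rewrite Rpower_plus]. Qed.

Lemma aR1 n : (0 < n)%N -> aR 1 n = INR n.
Proof. by move=> n0; rewrite aRE // Rpower_1 //; have := INR_ge1 n0; lra. Qed.

Lemma aR_muln s m n : (0 < m)%N -> (0 < n)%N -> aR s (m * n) = aR s m * aR s n.
Proof.
move=> m0 n0; rewrite !aRE ?muln_gt0 ?m0 // INR_muln Rpower_mult_distr //.
  by have := INR_ge1 m0; lra.
by have := INR_ge1 n0; lra.
Qed.

Lemma aR_ge1 s n : 0 <= s -> 1 <= aR s n.
Proof.
case: n => [|n] s0 /=; first lra.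
have h := @INR_ge1 n.+1 isT; have <- := Rpower_O (INR n.+1); last lra.
exact: Rle_Rpower.
Qed.

Lemma aR_exp_mono s t n : s <= t -> aR s n <= aR t n.
Proof.
case: n => [|n] st /=; first lra.
by apply: Rle_Rpower => //; exact: (@INR_ge1 n.+1 isT).
Qed.

Lemma aR_mono s m n : 0 <= s -> (m <= n)%N -> aR s m <= aR s n.
Proof.
move=> s0; case: m => [|m] mn; first exact: aR_ge1.
have h := @INR_ge1 m.+1 isT; have := INR_le mn.
case: n mn => [|n] // mn hmn; rewrite !aRE //.
by apply: Rle_Rpower_l => //; split=> //; lra.
Qed.

Lemma invaR_ge0 s n : 0 <= / aR s n.
Proof. by apply: Rlt_le; apply: Rinv_0_lt_compat; exact: aR_gt0. Qed.

Lemma invaR_exp_mono s t n : s <= t -> / aR t n <= / aR s n.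
Proof. by move=> st; apply: Rinv_le_contravar; [exact: aR_gt0|exact: aR_exp_mono]. Qed.

Lemma aR_quot s m n : (0 < m)%N -> (0 < n)%N ->
  aR s n / aR s m = exp (s * ln (INR n / INR m)).
Proof.
move=> m0 n0; have hm := INR_ge1 m0; have hn := INR_ge1 n0.
rewrite !aRE // /Rpower /Rdiv -exp_Ropp -exp_plus ln_mult; try lra; last first.
  by apply: Rinv_0_lt_compat; lra.
by rewrite ln_Rinv; [congr exp; ring|lra].
Qed.

(** From [ln (n / m) <= (n - m) / m <= K (n - m) / n]. The error is linear in [n - m], which in the
    applications counts particles on light sites and can be absorbed by their weights. *)
Lemma aR_quot_le s (K : R) m n : 0 <= s -> (0 < m)%N -> (m <= n)%N -> INR n <= K * INR m ->
  aR s n / aR s m <= 1 + s * exp (s * K) * K * (INR (n - m) / INR n).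
Proof.
move=> s0 m0 mn nK; have n0 : (0 < n)%N by lia.
have hm := INR_ge1 m0; have hn := INR_ge1 n0; have hmn := INR_le mn.
have K0 : 0 < K by nra.
rewrite aR_quot // INR_subn //; set x := INR n in hn hmn nK *; set y := INR m in hm hmn nK *.
have xy : x / y <= K by apply: (Rmult_le_reg_r y); [lra|rewrite /Rdiv Rmult_assoc Rinv_l; lra].
have h1 : ln (x / y) <= (x - y) / y.
  apply: Rle_trans (ln_le_sub1 _) _; first by apply: Rdiv_lt_0_compat; lra.
  by apply: Req_le; field; lra.
have h2 : (x - y) / y <= K * ((x - y) / x).
  have -> : (x - y) / y = (x / y) * ((x - y) / x) by field; lra.
  apply: Rmult_le_compat_r => //; apply: Rmult_le_pos; first lra.
  by apply: Rlt_le; apply: Rinv_0_lt_compat; lra.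
set u := s * ln (x / y).
have ln0 : 0 <= ln (x / y).
  rewrite -ln_1; apply: ln_le; first lra.
  by apply: (Rmult_le_reg_r y); [lra|rewrite /Rdiv Rmult_assoc Rinv_l; lra].
have u0 : 0 <= u by apply: Rmult_le_pos.
have uK : u <= s * K.
  apply: Rmult_le_compat_l => //; apply: Rle_trans h1 _.
  have -> : (x - y) / y = x / y - 1 by field; lra.
  lra.
have hu : u <= s * (K * ((x - y) / x)) by apply: Rmult_le_compat_l => //; lra.
apply: Rle_trans (exp_le_affine u) _.
have := exp_mono uK; have := exp_pos u; nra.
Qed.

(** For [n >= 2] the rate is [(1 + 1/(n-1))^s], which decreases to [1] with differences of order
    [1/n^2]. This is the source of the second-order cancellation in the adjoint generator. The bound
    [1 < m] excludes [g(1) = 1], where monotonicity fails. *)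
Lemma gR_quot s m n : 0 <= s -> (1 < m)%N -> (m <= n)%N ->
  1 <= gR s m / gR s n <= 1 + 2 * s * exp s * (INR (n - m) / (INR m) ^ 2).
Proof.
move=> s0 m1 mn; case: m m1 mn => [|[|m]] // _; case: n => [|[|n]] // mn.
have -> : gR s m.+2 / gR s n.+2 = exp (s * ln (INR m.+2 * INR n.+1 / (INR m.+1 * INR n.+2))).
  have := aR_quot s (isT : (0 < m.+1 * n.+2)%N) (isT : (0 < m.+2 * n.+1)%N).
  rewrite !aR_muln // !INR_muln => <-.
  rewrite /gR [m.+2.-1]/= [n.+2.-1]/=.
  have := aR_gt0 s m.+1; have := aR_gt0 s n.+1; have := aR_gt0 s m.+2; have := aR_gt0 s n.+2.
  by move=> *; field; do ?split; apply: Rgt_not_eq.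
have hmn := INR_le mn; rewrite INR_subn //.
have hm : 1 <= INR m.+1 by apply: INR_ge1.
rewrite [INR n.+2]S_INR [INR m.+2]S_INR.
rewrite [INR n.+2]S_INR [INR m.+2]S_INR in hmn.
set x := INR n.+1 in hmn *; set y := INR m.+1 in hm hmn *.
pose d := (x - y) / (y * (x + 1)).
have -> : (y + 1) * x / (y * (x + 1)) = 1 + d by rewrite /d; field; lra.
have pos : 0 < y * (x + 1) by nra.
have d0 : 0 <= d by apply: Rmult_le_pos; [lra|apply: Rlt_le; exact: Rinv_0_lt_compat].
have d1 : d <= 1.
  by apply: (Rmult_le_reg_r (y * (x + 1))) => //; rewrite /d /Rdiv Rmult_assoc Rinv_l; nra.
have d2 : d <= 2 * ((x + 1 - (y + 1)) / (y + 1) ^ 2).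
  have e : 2 * ((x + 1 - (y + 1)) / (y + 1) ^ 2) - d =
     (x - y) * ((2 * (y * (x + 1)) - (y + 1) ^ 2) / ((y + 1) ^ 2 * (y * (x + 1)))).
    by rewrite /d; field; lra.
  suff : 0 <= 2 * ((x + 1 - (y + 1)) / (y + 1) ^ 2) - d by lra.
  rewrite e; apply: Rmult_le_pos; first lra.
  apply: Rmult_le_pos; first by nra.
  by apply: Rlt_le; apply: Rinv_0_lt_compat; apply: Rmult_lt_0_compat => //; nra.
have l0 : 0 <= ln (1 + d) by rewrite -ln_1; apply: ln_le; lra.
have l1 : ln (1 + d) <= d by have := @ln_le_sub1 (1 + d); lra.
set u := s * ln (1 + d).
have u0 : 0 <= u by apply: Rmult_le_pos.
have u1 : u <= s * d by apply: Rmult_le_compat_l.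
have u2 : u <= s by nra.
split; first by have := exp_ineq1_le u; lra.
apply: Rle_trans (exp_le_affine u) _.
have e1 := exp_mono u2; have e2 := exp_pos u.
have : u * exp u <= (s * d) * exp s by apply: Rmult_le_compat; lra.
have : s * exp s * d <= s * exp s * (2 * ((x + 1 - (y + 1)) / (y + 1) ^ 2)).
  by apply: Rmult_le_compat_l => //; apply: Rmult_le_pos; [|apply: Rlt_le; exact: exp_pos].
lra.
Qed.

Lemma gR_le s n : 0 <= s -> gR s n <= aR s 2.
Proof.
move=> s0; case: n => [|[|n]] /=; [by have := aR_ge1 2 s0; rewrite /=; lra| |].
  have -> : Rpower 1 s = 1 by rewrite /Rpower ln_1 Rmult_0_r exp_0.
  by have := aR_ge1 2 s0; rewrite /=; lra.
rewrite -[X in X / _]/(aR s n.+2) -[X in _ / X]/(aR s n.+1) -[X in _ <= X]/(aR s 2).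
apply: (Rmult_le_reg_r (aR s n.+1)); first exact: aR_gt0.
rewrite /Rdiv Rmult_assoc Rinv_l; last by apply: Rgt_not_eq; exact: aR_gt0.
by rewrite Rmult_1_r -aR_muln //; apply: aR_mono => //; lia.
Qed.

(** A discrete integral test: [n^(-s)] is compared with the decrement of [n^(1-s) / (s-1)]. The
    indices start at 1 because [aR] is [1] at [0]. *)
Lemma invaR_telescope s n : 1 < s ->
  / aR s n.+2 <= / (s - 1) * (/ aR (s - 1) n.+1 - / aR (s - 1) n.+2).
Proof.
move=> s1; set t := s - 1; have t0 : 0 < t by rewrite /t; lra.
have q := aR_quot t (isT : (0 < n.+1)%N) (isT : (0 < n.+2)%N).
have p1 := aR_gt0 t n.+1; have p2 := aR_gt0 t n.+2.
have hx : 1 <= INR n.+1 by apply: INR_ge1.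
have e : aR s n.+2 = aR t n.+2 * INR n.+2.
  by rewrite -(aR1 (isT : (0 < n.+2)%N)) -aRD /t; congr (aR _ _); lra.
have l : / INR n.+2 <= ln (INR n.+2 / INR n.+1).
  have -> : ln (INR n.+2 / INR n.+1) = - ln (INR n.+1 / INR n.+2).
    rewrite -ln_Rinv; last by apply: Rdiv_lt_0_compat; rewrite ?S_INR; rewrite S_INR in hx; lra.
    by congr ln; rewrite S_INR; field; lra.
  have h : INR n.+1 / INR n.+2 - 1 = - / INR n.+2 by rewrite [INR n.+2]S_INR; field; lra.
  have := @ln_le_sub1 (INR n.+1 / INR n.+2); rewrite h => hh.
  suff : ln (INR n.+1 / INR n.+2) <= - / INR n.+2 by lra.
  by apply: hh; apply: Rdiv_lt_0_compat; rewrite ?[INR n.+2]S_INR; lra.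
have h2 : 1 + t * / INR n.+2 <= aR t n.+2 / aR t n.+1.
  rewrite q; apply: Rle_trans (exp_ineq1_le _).
  by apply: Rplus_le_compat_l; apply: Rmult_le_compat_l; lra.
rewrite e; apply: (Rmult_le_reg_l (t * aR t n.+2)); first by apply: Rmult_lt_0_compat.
have -> : t * aR t n.+2 * / (aR t n.+2 * INR n.+2) = t * / INR n.+2.
  by rewrite S_INR; field; split; lra.
have -> : t * aR t n.+2 * (/ t * (/ aR t n.+1 - / aR t n.+2)) = aR t n.+2 / aR t n.+1 - 1.
  by field; lra.
lra.
Qed.

Lemma pseries_cv s : 1 < s -> exists Z : R, is_lim_seq (fun n => \sum_(i < n) / aR s i) Z.
Proof.
move=> s1.
have b n : \sum_(i < n.+2) / aR s i <= 2 + / (s - 1) * (1 - / aR (s - 1) n.+1).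
  elim: n => [|n IH].
    rewrite !big_ord_recr big_ord0 /= !Rplus_0_l /Rpower ln_1 !Rmult_0_r exp_0 Rinv_1; lra.
  rewrite big_ord_recr; have := invaR_telescope n s1; rewrite /= in IH *; lra.
have [l hl] : {l : R | Un_cv (fun n => \sum_(i < n) / aR s i) l}; last first.
  by exists l; apply/is_lim_seq_Reals.
apply: growing_cv.
  by move=> n; rewrite big_ord_recr /=; have := invaR_ge0 s n; lra.
exists (2 + / (s - 1)) => _ [n ->].
have si : 0 < / (s - 1) by apply: Rinv_0_lt_compat; lra.
case: n => [|[|n]]; [by rewrite big_ord0; lra|rewrite big_ord_recr big_ord0 /=; lra|].
by apply: Rle_trans (b n) _; have := invaR_ge0 (s - 1) n.+1; nra.
Qed.

End PowerWeights.

Section NonnegSeries.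
Variables (f : nat -> R) (Z : R).
Hypothesis f0 : forall i, 0 <= f i.
Hypothesis hZ : is_lim_seq (fun n => \sum_(i < n) f i) Z.

Lemma psum_le_lim n : \sum_(i < n) f i <= Z.
Proof.
apply: (is_lim_seq_incr_compare (fun n => \sum_(i < n) f i)) => // k.
by rewrite big_ord_recr /=; have := f0 k; lra.
Qed.

Lemma psum_split m n : \sum_(i < n | (m <= i)%N) f i <= Z - \sum_(i < m) f i.
Proof.
case: (leqP m n) => [mn|nm].
  suff e : \sum_(i < n) f i = \sum_(i < m) f i + \sum_(i < n | (m <= i)%N) f i.
    by have := psum_le_lim n; rewrite e; lra.
  have sp (P : pred nat) : \sum_(i < n | P i) f i =
      \sum_(i < m | P i) f i + \sum_(i < n - m | P (m + i)%N) f (m + i)%N.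
    have := @big_split_ord R 0 Rplus m (n - m) (fun i => P i) (fun i => f i).
    by rewrite /= subnKC.
  rewrite (sp predT) (sp (leq m)) [X in _ = _ + (X + _)]big1 => [|i]; last first.
    by rewrite leqNgt ltn_ord.
  rewrite Rplus_0_l; congr (_ + _).
  by apply: eq_bigl => i; rewrite leq_addr.
rewrite big1 => [|i]; first by have := psum_le_lim m; lra.
by rewrite leqNgt (ltn_trans (ltn_ord i) nm).
Qed.

End NonnegSeries.

(** * Product sums over configurations of fixed mass *)

Section ProductSums.
Variables (L N : nat) (p : 'I_L) (h : 'I_L -> nat -> R).
Implicit Types (s t : {ffun 'I_L -> 'I_N.+1}).

(* The occupation of [p] is determined by the other sites, so a sum over [E_N] of a
   product over the other sites is a truncated product of one-site sums. *)
Let rest s : nat := (\sum_(z < L | z != p) s z)%N.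

Lemma sum_configs :
  \sum_(eta <- enumE L N) \prod_(z < L | z != p) h z (eta z) =
  \sum_(s : {ffun 'I_L -> 'I_N.+1} | (s p == ord0) && (rest s <= N)%N)
     \prod_(z < L | z != p) h z (s z).
Proof.
rewrite -sumE_enumE /sumE.
pose fill s : {ffun 'I_L -> 'I_N.+1} := [ffun z => if z == p then inord (N - rest s) else s z].
pose clear t : {ffun 'I_L -> 'I_N.+1} := [ffun z => if z == p then ord0 else t z].
have rest_fill s : rest (fill s) = rest s.
  by apply: eq_bigr => z /negbTE zp; rewrite ffunE zp.
have rest_clear t : rest (clear t) = rest t.
  by apply: eq_bigr => z /negbTE zp; rewrite ffunE zp.
have tot t : (\sum_(x < L) t x = t p + rest t)%N by rewrite (bigD1 p).
rewrite (reindex_onto fill clear) => [|t /eqP ht]; last first.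
  apply/ffunP => z; rewrite !ffunE; case: eqP => [->|//]; rewrite rest_clear.
  by apply: val_inj; rewrite /= inordK; rewrite tot in ht; lia.
apply: eq_big => [s|s _]; last first.
  by apply: eq_bigr => z /negbTE zp; rewrite !ffunE zp.
rewrite tot rest_fill ffunE eqxx.
apply/andP/andP => [[/eqP h1 /eqP h2]|[/eqP h1 h2]].
  split; first by rewrite -h2 ffunE eqxx.
  by rewrite -[X in (_ <= X)%N]h1 leq_addl.
split; first by rewrite inordK; lia.
by apply/eqP/ffunP => z; rewrite !ffunE; case: eqP => // ->.
Qed.

Lemma prod_sum_rest :
  \prod_(z < L | z != p) \sum_(i < N.+1) h z i =
  \sum_(s : {ffun 'I_L -> 'I_N.+1} | s p == ord0) \prod_(z < L | z != p) h z (s z).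
Proof.
pose Q (z : 'I_L) (i : 'I_N.+1) := (z == p) ==> (i == ord0).
pose F (z : 'I_L) (i : 'I_N.+1) := if z == p then 1 else h z i.
have e := @bigA_distr_big_dep R 0 1 Rmult Rplus _ _ Q F.
transitivity (\big[Rmult/1]_(z : 'I_L) \big[Rplus/0]_(i : 'I_N.+1 | Q z i) F z i).
  rewrite [RHS](prodR_D1 (j := p)) //.
  have -> : \big[Rplus/0]_(i : 'I_N.+1 | Q p i) F p i = 1.
    rewrite (eq_big (fun i => i == ord0) (fun _ => 1)) ?big_pred1_eq //.
    - by move=> i; rewrite /Q eqxx.
    - by move=> i _; rewrite /F eqxx.
  rewrite Rmult_1_l; apply: eq_big => // z /negbTE zp.
  by apply: eq_big => [i|i _]; rewrite /Q /F zp.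
apply: etrans e _; apply: eq_big => [s|s _].
  apply/familyP/eqP => [hs|hs z]; first by have := hs p; rewrite unfold_in /Q eqxx => /eqP.
  by rewrite unfold_in /Q; apply/implyP => /eqP ->; rewrite hs.
rewrite [LHS](prodR_D1 (j := p)) // /F eqxx Rmult_1_l.
by apply: eq_bigr => z /negbTE ->.
Qed.

Lemma sum_prod_le : (forall z i, 0 <= h z i) ->
  \sum_(eta <- enumE L N) \prod_(z < L | z != p) h z (eta z) <=
  \prod_(z < L | z != p) \sum_(i < N.+1) h z i.
Proof.
move=> h0; rewrite sum_configs prod_sum_rest; apply: sumR_mono.
  by move=> s /andP[].
by move=> s _; apply: prodR_ge0.
Qed.

(** If the factors vanish outside boxes of total size at most [N], the mass constraint is automatic
    and the sum factorizes exactly. Lower bounds use it with one-site sums truncated at a suitable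
    level. *)
Lemma sum_prod_eq (b : 'I_L -> nat) :
  (forall z i, (b z < i)%N -> h z i = 0) -> (\sum_(z < L | z != p) b z <= N)%N ->
  \sum_(eta <- enumE L N) \prod_(z < L | z != p) h z (eta z) =
  \prod_(z < L | z != p) \sum_(i < N.+1) h z i.
Proof.
move=> hb bN; rewrite sum_configs prod_sum_rest.
rewrite sumR_mask [RHS]sumR_mask; apply: eq_bigr => s _.
case: (s p == ord0) => //=; case: leqP => //= hs.
suff [z zp hz] : exists2 z, z != p & (b z < s z)%N.
  by rewrite (prodR_D1 (j := z)) // hb //; ring.
apply/exists_inP; move: hs; rewrite ltnNge; apply: contraR.
rewrite negb_exists => /forallP hz; apply: leq_trans bN; apply: leq_sum => z zp.
by have := hz z; rewrite zp /= -leqNgt.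
Qed.

End ProductSums.

(** * The test function *)

Section Arcs.
Variable L : nat.
Implicit Types (eta xi : conf L) (x y z p r : 'I_L).

(* The cyclic interval [r, p). The adjoint dynamics moves particles from [z] to [z - 1],
   so a particle in it meets [r] before [p]: when [r] and [p] are the two heavy sites,
   [mass r p] counts the particles that belong to [r]. *)
Definition arc r p z : bool :=
  if (r <= p)%N then (r <= z < p)%N else (r <= z)%N || (z < p)%N.

Lemma neq_ord x y : x != y -> (x : nat) <> y.
Proof. by move=> /eqP h e; apply: h; exact: val_inj. Qed.

Lemma arcC r p z : r != p -> arc p r z = ~~ arc r p z.
Proof. by move=> /neq_ord; rewrite /arc; case: (leqP r p); case: (leqP p r); lia. Qed.

Lemma arc_l r p : r != p -> arc r p r.
Proof. by move=> /neq_ord; rewrite /arc; case: (leqP r p); lia. Qed.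

Lemma arc_r r p : arc r p p = false.
Proof. by rewrite /arc; case: (leqP r p); lia. Qed.

(** A left jump crosses an end of the arc only when it starts at [p], entering it, or at [r],
    leaving it. Hence only jumps out of the two heavy sites change [mass r p] under the adjoint
    dynamics. *)
Lemma arc_pred r p z : r != p ->
  arc r p (ord_pred z) = if z == p then true else if z == r then false else arc r p z.
Proof.
move=> /neq_ord rp.
have hz := ltn_ord z; have hr := ltn_ord r; have hp := ltn_ord p.
have e : (ord_pred z : nat) = if (z == 0 :> nat)%N then L.-1 else z.-1.
  rewrite /=; case: eqP => [->|z0]; first by rewrite add0n modn_small; lia.
  by rewrite (_ : (z + L).-1 = z.-1 + L)%N ?modnDr ?modn_small; lia.
rewrite /arc e; case: (eqVneq z p) => [zp|nzp].
  by have e2 := congr1 val zp; rewrite /= in e2; case: (leqP r p); case: eqP; lia.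
case: (eqVneq z r) => [zr|nzr].
  by have e2 := congr1 val zr; rewrite /= in e2; case: (leqP r p); case: eqP; lia.
have zp := neq_ord nzp; have zr := neq_ord nzr.
by case: (leqP r p); case: eqP; lia.
Qed.

Definition mass r p eta : nat := (\sum_(z < L | arc r p z) eta z)%N.

Lemma mass_addp r p x xi : mass r p (addp x xi) = (mass r p xi + arc r p x)%N.
Proof.
rewrite /mass (eq_bigr (fun z => xi z + (z == x))%N) => [|z _]; last by rewrite ffunE.
rewrite big_split /=; congr (_ + _)%N; case ax: (arc r p x).
  by rewrite (bigD1 x) //= eqxx big1 // => z /andP[_ /negbTE ->].
by rewrite big1 // => z az; case: eqP => // e; move: az; rewrite e ax.
Qed.

Lemma massC N r p eta : r != p -> isE N eta -> (mass r p eta + mass p r eta)%N = N.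
Proof.
move=> rp /eqP <-; rewrite [in RHS](bigID (arc r p)) /=; congr (_ + _)%N.
by apply: eq_bigl => z; exact: arcC.
Qed.

Lemma mass_ge r p eta : r != p -> (eta r <= mass r p eta)%N.
Proof. by move=> rp; rewrite /mass (bigD1 r) ?arc_l //= leq_addr. Qed.

Lemma mass_le N r p eta : r != p -> isE N eta -> (mass r p eta <= N - eta p)%N.
Proof.
move=> rp hE; have := massC rp hE.
by have := @mass_ge p r eta; rewrite eq_sym => /(_ rp); lia.
Qed.

Lemma sigma_mass p r x eta : r != p -> (0 < eta x)%N ->
  (mass r p (Defs.sigma x (ord_pred x) eta) + arc r p x =
   mass r p eta + (if x == p then true else if x == r then false else arc r p x))%N.
Proof.
move=> rp h; rewrite {1 2}(addp_sub h) sigma_addp !mass_addp arc_pred //; lia.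
Qed.

Lemma sigma_close x y eta z :
  (Defs.sigma x y eta z <= (eta z).+1)%N && (eta z <= (Defs.sigma x y eta z).+1)%N.
Proof. by rewrite ffunE; case: (z == x); case: (z == y); lia. Qed.

Lemma sum_others N p eta : isE N eta -> (N - eta p = \sum_(z < L | z != p) eta z)%N.
Proof. by move=> /eqP <-; rewrite (bigD1 p) //= addKn. Qed.

Lemma sum_others2 N p r eta : r != p -> isE N eta ->
  (N - eta p = eta r + \sum_(z < L | (z != p) && (z != r)) eta z)%N.
Proof. by move=> rp hE; rewrite (sum_others p hE) (bigD1 r). Qed.

Variable x0 : 'I_L.

Definition largest eta : 'I_L := [arg max_(x > x0) eta x].
(** The default [succ p] is the required witness of a site other than [p]; it is one as soon as
    [2 <= L]. *)
Definition second p eta : 'I_L := [arg max_(x > succ p | x != p) eta x].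

Lemma largestP eta z : (eta z <= eta (largest eta))%N.
Proof. by rewrite /largest; case: arg_maxnP => // i _ h; exact: h. Qed.

Hypothesis HL : (2 <= L)%N.

Lemma succ_neq p : succ p != p.
Proof.
apply/eqP => /(congr1 val) /=; have := ltn_ord p; have [e|e] := eqVneq p.+1 L.
  by rewrite e modnn; lia.
by move=> h; rewrite modn_small; lia.
Qed.

Lemma secondP p eta : (second p eta != p) /\ forall z, z != p -> (eta z <= eta (second p eta))%N.
Proof. by rewrite /second; case: arg_maxnP => [|i ip h]; [exact: succ_neq|split]. Qed.

Lemma others_le N p eta : isE N eta -> (N - eta p <= L.-1 * eta (second p eta))%N.
Proof.
move=> hE; have [_ h] := secondP p eta; rewrite (sum_others p hE).
apply: leq_trans (_ : \sum_(z < L | z != p) eta (second p eta) <= _)%N; first exact: leq_sum.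
rewrite sum_nat_const leq_mul2r; apply/orP; right.
by rewrite (cardC1 p) card_ord.
Qed.

Lemma largest_ge N eta : isE N eta -> (N <= L * eta (largest eta))%N.
Proof.
move=> /eqP <-; apply: leq_trans (_ : \sum_(z < L) eta (largest eta) <= _)%N.
  by apply: leq_sum => z _; exact: largestP.
by rewrite sum_nat_const card_ord.
Qed.

End Arcs.

(** * The one-dimensional profile between two heavy sites *)

Section Phi.
Variables (al : R) (N : nat).
Hypothesis al0 : 0 <= al.
Hypothesis N0 : (0 < N)%N.

(** The resistance of the edge from [i] to [i + 1] for two sites sharing [N] particles: the inverse
    weight of the background [i], [N - 1 - i]. *)
Definition phi i : R := aR al i * aR al (N.-1 - i).
Definition phi_total : R := \sum_(i < N) phi i.
Definition Phi (M : nat) : R := / phi_total * \sum_(i < M) phi i.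

Lemma phi_gt0 i : 0 < phi i.
Proof. by apply: Rmult_lt_0_compat; exact: aR_gt0. Qed.

Lemma phi_total_gt0 : 0 < phi_total.
Proof.
rewrite /phi_total; case: N N0 phi_gt0 => // n _ h; rewrite big_ord_recr /=.
have := h n; suff : 0 <= \sum_(i < n) phi i by rewrite /phi /=; lra.
by apply: sumR_ge0 => i _; apply: Rlt_le; exact: phi_gt0.
Qed.

Lemma PhiS M : Phi M.+1 - Phi M = / phi_total * phi M.
Proof. by rewrite /Phi big_ord_recr /=; ring. Qed.

Lemma Phi_ge0 M : 0 <= Phi M.
Proof.
apply: Rmult_le_pos; first by apply: Rlt_le; apply: Rinv_0_lt_compat; exact: phi_total_gt0.
by apply: sumR_ge0 => i _; apply: Rlt_le; exact: phi_gt0.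
Qed.

(** [phi] is invariant under the exchange of [i] and [N - 1 - i]. This makes [pairF] independent of
    the order of the two heavy sites. *)
Lemma PhiC M : (M <= N)%N -> Phi M + Phi (N - M) = 1.
Proof.
move=> MN; have h := phi_total_gt0.
suff e : phi_total = \sum_(i < M) phi i + \sum_(i < N - M) phi i.
  by rewrite /Phi -Rmult_plus_distr_l -e; field; lra.
have -> : phi_total = \sum_(i < M) phi i + \sum_(i < N - M) phi (M + i)%N.
  have := @big_split_ord R 0 Rplus M (N - M) xpredT (fun i => phi i).
  by rewrite /= subnKC.
congr (_ + _); rewrite (reindex_inj rev_ord_inj) /=; apply: eq_bigr => i _.
have hi := ltn_ord i; rewrite /phi Rmult_comm.
by congr (aR _ _ * aR _ _); lia.
Qed.

Lemma Phi_le1 M : (M <= N)%N -> Phi M <= 1.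
Proof. by move=> h; have := PhiC h; have := Phi_ge0 (N - M); lra. Qed.

(** Each of the [M] increments is at most [a(M) a(N)] before normalization. The hypothesis on
    [phi_total] is its order of magnitude for large [N], carried as an assumption by all the
    estimates at fixed [N]. *)
Lemma Phi_le (C : R) M : / phi_total <= C / aR (2 * al + 1) N -> (M <= N)%N ->
  Phi M <= C * (aR (al + 1) M / aR (al + 1) N).
Proof.
move=> hC MN; have n0 := phi_total_gt0; have a1 := aR_gt0 (2 * al + 1) N.
have C0 : 0 < C.
  have : 0 < / phi_total by apply: Rinv_0_lt_compat.
  move=> h; apply: (Rmult_lt_reg_r (/ aR (2 * al + 1) N)); first exact: Rinv_0_lt_compat.
  by rewrite /Rdiv in hC; lra.
have a2 := aR_gt0 (al + 1) N; have a4 := aR_gt0 (al + 1) M.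
case: (posnP M) => [M0|M0].
  rewrite M0 /Phi big_ord0 Rmult_0_r; apply: Rmult_le_pos; first lra.
  by apply: Rlt_le; apply: Rdiv_lt_0_compat => //; exact: aR_gt0.
have b : \sum_(i < M) phi i <= aR (al + 1) M * aR al N.
  apply: Rle_trans (_ : \sum_(i < M) (aR al M * aR al N) <= _).
    apply: sumR_le => i _; apply: Rmult_le_compat; try (apply: Rlt_le; exact: aR_gt0).
      by apply: aR_mono => //; exact: ltnW.
    by apply: aR_mono => //; lia.
  rewrite sumR_const_ord aRD aR1 //; apply: Req_le; ring.
rewrite /Phi; apply: Rle_trans (_ : C / aR (2 * al + 1) N * (aR (al + 1) M * aR al N) <= _).
  apply: Rmult_le_compat => //; first by apply: Rlt_le; exact: Rinv_0_lt_compat.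
  by apply: sumR_ge0 => i _; apply: Rlt_le; exact: phi_gt0.
rewrite (_ : 2 * al + 1 = al + (al + 1)) ?[aR (al + (_ + _)) _]aRD; last ring.
by apply: Req_le; field; split; apply: Rgt_not_eq; exact: aR_gt0.
Qed.

End Phi.

(** * The test function near the wells and along clear configurations *)

Section TestFunction.
Variables (L : nat) (x0 : 'I_L) (al : R) (A : {set 'I_L}) (N : nat).
Hypotheses (HL : (2 <= L)%N) (al0 : 0 <= al) (N0 : (0 < N)%N).
Implicit Types (eta xi : conf L) (x y z p r : 'I_L).

Definition pairF p r eta : R :=
  indR (p \in A) + (indR (r \in A) - indR (p \in A)) * Phi al N (mass r p eta).

(* Defined through the two largest sites of [eta]; [pairF] is symmetric in them, so only
   a tie between the second and the third largest site makes [testF] jump. *)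
Definition testF eta : R :=
  pairF (largest x0 eta) (second (largest x0 eta) eta) eta.

Lemma pairF_sym p r eta : p != r -> isE N eta -> pairF p r eta = pairF r p eta.
Proof.
move=> pr hE; have e := massC pr hE.
have h : Phi al N (mass p r eta) + Phi al N (mass r p eta) = 1.
  have -> : mass r p eta = (N - mass p r eta)%N by lia.
  by apply: PhiC => //; lia.
rewrite /pairF; have -> : Phi al N (mass r p eta) = 1 - Phi al N (mass p r eta) by lra.
ring.
Qed.

(** Strictness forces the two selected sites to be [p] and [r] in some order, and [pairF_sym] makes
    the order immaterial; [p] and [r] themselves may tie. *)
Lemma testF_clear p r eta : p != r -> isE N eta ->
  (forall z, z != p -> z != r -> (eta z < eta p)%N && (eta z < eta r)%N) ->
  testF eta = pairF p r eta.
Proof.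
move=> pr hE hc; rewrite /testF; set t := largest x0 eta; have ht := largestP x0 eta.
have [hs1 hs2] := secondP HL t eta; set s := second t eta in hs1 hs2 *.
have [tp|tp] := eqVneq t p.
  suff -> : s = r by rewrite tp.
  apply/eqP; apply: contraT => sr; rewrite tp in hs1 hs2.
  have := hc s hs1 sr; have := hs2 r; rewrite eq_sym => /(_ pr); lia.
have [tr|tr] := eqVneq t r; last first.
  by have := hc t tp tr; have := ht p; rewrite -/t; lia.
suff -> : s = p by rewrite tr (pairF_sym pr).
apply/eqP; apply: contraT => sp; rewrite tr in hs1 hs2.
by have := hc s sp hs1; have := hs2 p pr; lia.
Qed.

Lemma pairF_01 p r eta : r != p -> isE N eta -> 0 <= pairF p r eta <= 1.
Proof.
move=> rp hE; rewrite /pairF; have h0 := @Phi_ge0 al N N0 (mass r p eta).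
have h1 : Phi al N (mass r p eta) <= 1.
  by apply: Phi_le1 => //; have := mass_le rp hE; lia.
by case: (p \in A); case: (r \in A); rewrite /indR; nra.
Qed.

Lemma testF_01 eta : isE N eta -> 0 <= testF eta <= 1.
Proof. by move=> hE; apply: pairF_01 => //; case: (secondP HL (largest x0 eta) eta). Qed.

Variable (Cs : R).
Hypothesis hCs : / phi_total al N <= Cs / aR (2 * al + 1) N.

Definition dev_const := Cs + aR (al + 1) 2.

Lemma Cs_gt0 : 0 < Cs.
Proof.
have a1 := aR_gt0 (2 * al + 1) N.
have : 0 < / phi_total al N by apply: Rinv_0_lt_compat; exact: phi_total_gt0.
move=> h; apply: (Rmult_lt_reg_r (/ aR (2 * al + 1) N)); first exact: Rinv_0_lt_compat.
by move: hCs; rewrite /Rdiv; lra.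
Qed.

Lemma dev_const_gt0 : 0 < dev_const.
Proof. by have := Cs_gt0; have := aR_gt0 (al + 1) 2; rewrite /dev_const; lra. Qed.

Lemma pow_quot_le b c m n : 0 <= b -> b <= c -> (m <= n)%N ->
  b * (aR (al + 1) m / aR (al + 1) N) <= c * (aR (al + 1) n / aR (al + 1) N).
Proof.
move=> b0 bc mn.
have h : aR (al + 1) m / aR (al + 1) N <= aR (al + 1) n / aR (al + 1) N.
  apply: div_mono; first by apply: Rlt_le; exact: aR_gt0.
  by apply: aR_mono => //; lra.
apply: Rmult_le_compat => //.
by apply: Rlt_le; apply: Rdiv_lt_0_compat; exact: aR_gt0.
Qed.

(** If [p] is the largest site, the deviation is at most [Phi] of a mass bounded by [N - eta p],
    which gives the summand [Cs] of [dev_const]. Otherwise at least half of the particles are off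
    [p], and the trivial bound [1] costs the summand [2^(al+1)]. *)
Lemma testF_bound p eta : isE N eta ->
  Rabs (testF eta - indR (p \in A)) <= dev_const * (aR (al + 1) (N - eta p) / aR (al + 1) N).
Proof.
move=> hE; have c0 := Cs_gt0; have c1 := aR_gt0 (al + 1) 2.
have [tp|tp] := eqVneq (largest x0 eta) p.
  rewrite /testF tp /pairF; have [rp _] := secondP HL p eta.
  set r := second p eta in rp *; set M := mass r p eta.
  have MN : (M <= N - eta p)%N := mass_le rp hE.
  have MN' : (M <= N)%N by lia.
  have h := Phi_le al0 N0 hCs MN'; have h0 := @Phi_ge0 al N N0 M.
  have : Rabs (indR (p \in A) + (indR (r \in A) - indR (p \in A)) * Phi al N M - indR (p \in A))
     <= Phi al N M.
    by case: (p \in A); case: (r \in A); rewrite /indR; apply: Rabs_le; lra.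
  have hCC : Cs <= dev_const by rewrite /dev_const; lra.
  by have := pow_quot_le (Rlt_le _ _ c0) hCC MN; lra.
have h01 := testF_01 hE.
have : Rabs (testF eta - indR (p \in A)) <= 1.
  by case: (p \in A); rewrite /indR; apply: Rabs_le; lra.
suff : 1 <= dev_const * (aR (al + 1) (N - eta p) / aR (al + 1) N) by lra.
have hN : (N <= 2 * (N - eta p))%N.
  have := largestP x0 eta p; have /eqP := hE.
  rewrite (bigD1 p) //= (bigD1 (largest x0 eta)) //=; lia.
have Np : (0 < N - eta p)%N by lia.
have a1 := aR_gt0 (al + 1) N; have a2 := aR_gt0 (al + 1) (N - eta p).
have a3 : aR (al + 1) N <= aR (al + 1) 2 * aR (al + 1) (N - eta p).
  by rewrite -aR_muln //; apply: aR_mono => //; lra.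
apply: (Rmult_le_reg_r (aR (al + 1) N)) => //.
rewrite /Rdiv -Rmult_assoc Rmult_assoc Rinv_l; last lra.
by rewrite /dev_const; nra.
Qed.

(** One jump can raise [z] by one and lower [p] or [r] by one; a gap of 3 keeps [p] and [r] strictly
    on top. So [testF] is the same [pairF] on all the configurations involved, and only the jumps
    out of [p] and [r] change the mass. *)
Lemma adj_gen_clear p r eta : r != p -> isE N eta -> (0 < eta p)%N -> (0 < eta r)%N ->
  (forall z, z != p -> z != r -> (eta z + 3 <= eta p)%N && (eta z + 3 <= eta r)%N) ->
  adj_gen al testF eta = (indR (r \in A) - indR (p \in A)) *
    (gR al (eta p) * (Phi al N (mass r p eta).+1 - Phi al N (mass r p eta)) -
     gR al (eta r) * (Phi al N (mass r p eta) - Phi al N (mass r p eta).-1)).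
Proof.
move=> rp hE p0 r0 hc; have pr : p != r by rewrite eq_sym.
have e x : (0 < eta x)%N ->
  testF (Defs.sigma x (ord_pred x) eta) - testF eta = (indR (r \in A) - indR (p \in A)) *
   (Phi al N (mass r p (Defs.sigma x (ord_pred x) eta)) - Phi al N (mass r p eta)).
  move=> hx; rewrite (testF_clear pr hE) => [|z zp zr]; last by have := hc z zp zr; lia.
  rewrite (testF_clear pr (isE_sigma _ hx hE)) => [|z zp zr]; first by rewrite /pairF; ring.
  have := hc z zp zr; have := sigma_close x (ord_pred x) eta z.
  by have := sigma_close x (ord_pred x) eta p; have := sigma_close x (ord_pred x) eta r; lia.
rewrite /adj_gen (sumR_D1 (j := p)) // (sumR_D1 (j := r)) // big1 => [|z /andP[zp zr]]; last first.
  case: (posnP (eta z)) => [->|hz]; first by rewrite /=; ring.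
  have := sigma_mass rp hz; rewrite (negbTE zp) (negbTE zr) => /addIn m.
  by rewrite e // m; ring.
have mp : mass r p (Defs.sigma p (ord_pred p) eta) = (mass r p eta).+1.
  by have := sigma_mass rp p0; rewrite eqxx arc_r; lia.
have mr : mass r p (Defs.sigma r (ord_pred r) eta) = (mass r p eta).-1.
  by have := sigma_mass rp r0; rewrite eqxx (negbTE rp) arc_l //; lia.
by rewrite !e // mp mr; ring.
Qed.

End TestFunction.

(** * The adjoint generator of the test function off the wells *)

Section PartialWeights.
Variables (L : nat) (al ga : R).
Hypotheses (ga1 : 1 < ga) (ga2 : ga <= 2) (gaal : 2 * ga + 1 <= al).
Implicit Types (eta xi : conf L) (x y z p r t : 'I_L).

(** The exponent is a parameter so that estimates can trade [al] for the smaller [ga], paying for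
    powers of the occupation numbers. *)
Definition rest_weight s p eta : R := \prod_(z < L | z != p) / aR s (eta z).

Lemma rest_weight_gt0 s p eta : 0 < rest_weight s p eta.
Proof. by apply: prodR_gt0 => z _; apply: Rinv_0_lt_compat; exact: aR_gt0. Qed.

Lemma weight_rest p eta : weight al eta = / aR al (eta p) * rest_weight al p eta.
Proof. by rewrite /weight (prodR_D1 (j := p)). Qed.

Lemma invaR_id_le n : INR n * / aR al n <= / aR ga n.
Proof.
case: n => [|n]; first by rewrite /= /INR; lra.
rewrite -(aR1 (isT : (0 < n.+1)%N)).
apply: (Rmult_le_reg_l (aR al n.+1)); first exact: aR_gt0.
have a1 := aR_gt0 al n.+1; have a2 := aR_gt0 ga n.+1; have a3 := aR_gt0 1 n.+1.
have -> : aR al n.+1 * (aR 1 n.+1 * / aR al n.+1) = aR 1 n.+1 by field; lra.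
apply: (Rmult_le_reg_r (aR ga n.+1)) => //.
rewrite Rmult_assoc Rinv_l ?Rmult_1_r; last lra.
by rewrite -aRD; apply: aR_exp_mono; lra.
Qed.

(** A factor [eta z] lowers the exponent at [z] by one, and [ga + 1 <= al] leaves room for it. *)
Lemma prod_others_le (P : pred 'I_L) eta z : P z ->
  INR (eta z) * \prod_(v < L | P v) / aR al (eta v) <= \prod_(v < L | P v) / aR ga (eta v).
Proof.
move=> Pz; rewrite (prodR_D1 (j := z)) // [X in _ <= X](prodR_D1 (j := z)) //.
rewrite -Rmult_assoc; apply: Rmult_le_compat.
- by apply: Rmult_le_pos; [exact: pos_INR|exact: invaR_ge0].
- by apply: prodR_ge0 => v _; exact: invaR_ge0.
- exact: invaR_id_le.
- by apply: prodR_le => v _; split; [exact: invaR_ge0|apply: invaR_exp_mono; lra].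
Qed.

(** The left side is the error of [adj_gen_clear_le] times the weight off [p]. The power [a(eta r)]
    cancels the weight of [r], the number of light particles is absorbed by the light sites, and
    [1 / (eta r)^2] is at most [1 / (eta r)^ga] because [ga <= 2]. *)
Lemma rest_weight_clear p r eta : r != p -> (0 < eta r)%N ->
  aR al (eta r) * (INR (\sum_(z < L | (z != p) && (z != r)) eta z)%N / INR (eta r) ^ 2)
    * rest_weight al p eta <= INR L * rest_weight ga p eta.
Proof.
move=> rp r0; have a1 := aR_gt0 al (eta r); have hr := INR_ge1 r0.
rewrite /rest_weight (prodR_D1 (j := r)) // [X in _ <= _ * X](prodR_D1 (j := r)) //.
set P1 := \prod_(z < L | _) _; set P2 := (X in _ <= _ * (_ * X)).
have e : INR (\sum_(z < L | (z != p) && (z != r)) eta z)%N * P1 <= INR L * P2.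
  rewrite INR_sum sumR_mulr.
  apply: Rle_trans (_ : \sum_(z < L | (z != p) && (z != r)) P2 <= _).
    by apply: sumR_le => z hz; exact: (@prod_others_le (fun z => (z != p) && (z != r))).
  rewrite sumR_const; apply: Rmult_le_compat_r.
    by apply: prodR_ge0 => v _; exact: invaR_ge0.
  by apply: INR_le; rewrite -[X in (_ <= X)%N]card_ord max_card.
have h2 : / INR (eta r) ^ 2 <= / aR ga (eta r).
  apply: Rinv_le_contravar; first exact: aR_gt0.
  have -> : INR (eta r) ^ 2 = aR 2 (eta r).
    by rewrite (_ : 2 = 1 + 1) // aRD aR1 //; ring.
  exact: aR_exp_mono.
have -> : forall k, aR al (eta r) * (k / INR (eta r) ^ 2) * (/ aR al (eta r) * P1) =
     / INR (eta r) ^ 2 * (k * P1).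
  by move=> k; field; split; lra.
have -> : INR L * (/ aR ga (eta r) * P2) = / aR ga (eta r) * (INR L * P2) by ring.
apply: Rmult_le_compat => //.
  by apply: Rlt_le; apply: Rinv_0_lt_compat; apply: pow_lt; lra.
apply: Rmult_le_pos; first exact: pos_INR.
by apply: prodR_ge0 => v _; exact: invaR_ge0.
Qed.

(** After the weight of [r] cancels, [eta r / (eta t)^al] remains. As [eta r <= 3 * eta t], it is at
    most a constant times [(eta r)^(-ga) (eta t)^(-ga)], and this takes the full strength of
    [2 * ga + 1 <= al]. *)
Lemma rest_weight_tie p r t eta : r != p -> t != p -> t != r ->
  (0 < eta t)%N -> (0 < eta r <= 3 * eta t)%N ->
  aR (al + 1) (eta r) * rest_weight al p eta <= aR (1 + ga) 3 * rest_weight ga p eta.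
Proof.
move=> rp tp tr t0 /andP[r0 r3].
rewrite /rest_weight (prodR_D1 (j := r)) // [X in _ <= _ * X](prodR_D1 (j := r)) //.
rewrite (prodR_D1 (j := t)) ?tp // [X in _ <= _ * (_ * X)](prodR_D1 (j := t)) ?tp //.
set P1 := \prod_(z < L | _) _; set P2 := (X in _ <= _ * (_ * (_ * X))).
have P12 : P1 <= P2.
  by apply: prodR_le => z _; split; [exact: invaR_ge0|apply: invaR_exp_mono; lra].
have P10 : 0 <= P1 by apply: prodR_ge0 => z _; exact: invaR_ge0.
have a1 := aR_gt0 al (eta r); have a2 := aR_gt0 al (eta t).
have a3 := aR_gt0 ga (eta r); have a4 := aR_gt0 ga (eta t).
have -> : aR (al + 1) (eta r) * (/ aR al (eta r) * (/ aR al (eta t) * P1)) =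
    (aR 1 (eta r) / aR al (eta t)) * P1.
  by rewrite aRD; field; split; lra.
have -> : aR (1 + ga) 3 * (/ aR ga (eta r) * (/ aR ga (eta t) * P2)) =
    (aR (1 + ga) 3 / (aR ga (eta r) * aR ga (eta t))) * P2 by field; split; lra.
apply: Rmult_le_compat => //.
  by apply: Rlt_le; apply: Rdiv_lt_0_compat => //; exact: aR_gt0.
apply: (Rmult_le_reg_r (aR al (eta t) * (aR ga (eta r) * aR ga (eta t)))).
  by apply: Rmult_lt_0_compat => //; apply: Rmult_lt_0_compat.
have -> : aR 1 (eta r) / aR al (eta t) * (aR al (eta t) * (aR ga (eta r) * aR ga (eta t))) =
   aR (1 + ga) (eta r) * aR ga (eta t) by rewrite aRD; field; lra.
have -> : aR (1 + ga) 3 / (aR ga (eta r) * aR ga (eta t)) *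
   (aR al (eta t) * (aR ga (eta r) * aR ga (eta t))) = aR (1 + ga) 3 * aR al (eta t).
  by field; lra.
apply: Rle_trans (_ : aR (1 + ga) 3 * aR (1 + ga) (eta t) * aR ga (eta t) <= _).
  apply: Rmult_le_compat_r; first lra.
  by rewrite -aR_muln //; apply: aR_mono => //; lra.
rewrite Rmult_assoc -aRD; apply: Rmult_le_compat_l; first by apply: Rlt_le; exact: aR_gt0.
by apply: aR_exp_mono; lra.
Qed.

Lemma weight_largest (N : nat) p eta : (0 < N)%N -> (N <= L * eta p)%N ->
  weight al eta <= aR al L / aR al N * rest_weight al p eta.
Proof.
move=> N0 h; rewrite (weight_rest p); apply: Rmult_le_compat_r.
  by apply: Rlt_le; exact: rest_weight_gt0.
have p0 : (0 < eta p)%N by case: (posnP (eta p)) h => // ->; lia.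
have L0 : (0 < L)%N by have := ltn_ord p; lia.
have a1 := aR_gt0 al (eta p); have a2 := aR_gt0 al N.
apply: (Rmult_le_reg_r (aR al N * aR al (eta p))); first exact: Rmult_lt_0_compat.
have -> : / aR al (eta p) * (aR al N * aR al (eta p)) = aR al N by field; lra.
have -> : aR al L / aR al N * (aR al N * aR al (eta p)) = aR al L * aR al (eta p).
  by field; lra.
by rewrite -aR_muln //; apply: aR_mono => //; lra.
Qed.

Lemma WN_ge (N : nat) p : / aR al N <= WN al L N.
Proof.
rewrite /WN sumE_enumE.
pose eta : conf L := [ffun z => if z == p then N else 0%N].
have hE : eta \in enumE L N.
  rewrite mem_enumE /Defs.inE (bigD1 p) //= ffunE eqxx big1 ?addn0 // => z /negbTE zp.
  by rewrite ffunE zp.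
rewrite (sumR_D1_seq _ hE) ?enumE_uniq //.
have -> : weight al eta = / aR al N.
  rewrite (weight_rest p) ffunE eqxx /rest_weight big1 ?Rmult_1_r // => z /negbTE zp.
  by rewrite ffunE zp /= Rinv_1.
rewrite -[X in X <= _]Rplus_0_r; apply: Rplus_le_compat_l.
by apply: sumR_ge0 => i _; apply: Rlt_le; exact: weight_gt0.
Qed.

Lemma WN_gt0 (N : nat) p : 0 < WN al L N.
Proof.
by apply: Rlt_le_trans (WN_ge N p); apply: Rinv_0_lt_compat; exact: aR_gt0.
Qed.

End PartialWeights.

Section Pointwise.
Variables (L : nat) (x0 : 'I_L) (al ga : R) (A : {set 'I_L}) (N : nat) (Cs : R).
Hypotheses (HL : (2 <= L)%N) (N0 : (0 < N)%N).
Hypotheses (ga1 : 1 < ga) (ga2 : ga <= 2) (gaal : 2 * ga + 1 <= al).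
Hypothesis hCs : / phi_total al N <= Cs / aR (2 * al + 1) N.
Implicit Types (eta xi : conf L) (x y z p r t : 'I_L).

Let al0 : 0 <= al. Proof. lra. Qed.
Let F := testF x0 al A N.

(* With [M = mass r p eta], detailed balance along the segment makes the two jumps cancel
   up to [g(eta_p) / g(N - M) - g(eta_r) / g(M)], which only sees the light sites. *)
Lemma adj_gen_clear_le p r eta : r != p -> isE N eta -> (2 <= eta r)%N ->
  (eta r <= eta p)%N -> (mass r p eta <= L * eta r)%N ->
  (forall z, z != p -> z != r -> (eta z + 3 <= eta r)%N) ->
  Rabs (adj_gen al F eta) <=
    Cs * aR al L * (2 * al * exp al) / aR (al + 1) N *
    (aR al (eta r) * (INR (\sum_(z < L | (z != p) && (z != r)) eta z)%N / INR (eta r) ^ 2)).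
Proof.
move=> rp hE r2 rlep hM hc.
rewrite /F (adj_gen_clear x0 al A HL N0 rp hE); [|lia|lia|]; last first.
  by move=> z zp zr; have := hc z zp zr; lia.
set M := mass r p eta in hM *; set k := (\sum_(z < L | _) _)%N.
have k_eq : (k + eta r + eta p)%N = N.
  by have /eqP := hE; rewrite (bigD1 p) //= (bigD1 r) //= -/k; lia.
have Mr : (eta r <= M)%N by exact: mass_ge.
have Mp : (eta p <= N - M)%N.
  have := massC rp hE; rewrite -/M.
  by have := @mass_ge L p r eta; rewrite eq_sym => /(_ rp); lia.
have [n0 n1] : 0 < phi_total al N /\ 0 < / phi_total al N.
  by have h := phi_total_gt0 al N0; split=> //; exact: Rinv_0_lt_compat.
have dS : Phi al N M - Phi al N M.-1 = / phi_total al N * (aR al M.-1 * aR al (N - M)).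
  have -> : Phi al N M = Phi al N M.-1.+1 by rewrite prednK //; lia.
  rewrite PhiS /phi; congr (_ * (_ * aR _ _)); lia.
have ppos n : (2 <= n)%N -> aR al n.-1 = aR al n / gR al n.
  move=> hn; have := aR_gt0 al n; have := aR_gt0 al n.-1.
  by case: n hn => // n _ ? ?; rewrite /gR; field; split; apply: Rgt_not_eq.
have dN : aR al (N.-1 - M) = aR al (N - M) / gR al (N - M).
  by rewrite -ppos; [congr aR; lia|lia].
rewrite PhiS /phi dS dN ppos; last lia.
have g1 := gR_quot al0 (_ : (1 < eta p)%N) Mp; have {}g1 := g1 ltac:(lia).
have g2 := gR_quot al0 (_ : (1 < eta r)%N) Mr; have {}g2 := g2 ltac:(lia).
set q1 := gR al (eta p) / _ in g1; set q2 := gR al (eta r) / _ in g2.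
have gM : 0 < gR al M by apply: gR_gt0; lia.
have gNM : 0 < gR al (N - M) by apply: gR_gt0; lia.
have -> : gR al (eta p) * (/ phi_total al N * (aR al M * (aR al (N - M) / gR al (N - M)))) -
   gR al (eta r) * (/ phi_total al N * (aR al M / gR al M * aR al (N - M))) =
   / phi_total al N * aR al M * aR al (N - M) * (q1 - q2).
  by rewrite /q1 /q2; field; do ?split; apply: Rgt_not_eq.
set E := exp al in g1 g2 *; have E0 : 0 < E := exp_pos al.
have hr : 2 <= INR (eta r) by apply: (INR_le r2).
have hpr : INR (eta r) <= INR (eta p) := INR_le rlep.
have kk : INR (N - M - eta p) + INR (M - eta r) = INR k.
  by rewrite -INR_addn; congr INR; lia.
have k1 := pos_INR (N - M - eta p); have k2 := pos_INR (M - eta r).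
have i1 : INR (N - M - eta p) / INR (eta p) ^ 2 <= INR (N - M - eta p) / INR (eta r) ^ 2.
  apply: Rmult_le_compat_l => //; apply: Rinv_le_contravar; first by apply: pow_lt; lra.
  by apply: pow_incr; lra.
have j1 : 0 <= INR (N - M - eta p) / INR (eta p) ^ 2.
  by apply: Rmult_le_pos => //; apply: Rlt_le; apply: Rinv_0_lt_compat; apply: pow_lt; lra.
have j2 : 0 <= INR (M - eta r) / INR (eta r) ^ 2.
  by apply: Rmult_le_pos => //; apply: Rlt_le; apply: Rinv_0_lt_compat; apply: pow_lt; lra.
have aE : 0 <= 2 * al * E by nra.
have hq : Rabs (q1 - q2) <= 2 * al * E * (INR k / INR (eta r) ^ 2).
  have -> : INR k / INR (eta r) ^ 2 =
     INR (N - M - eta p) / INR (eta r) ^ 2 + INR (M - eta r) / INR (eta r) ^ 2.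
    by rewrite -kk /Rdiv; ring.
  have m1 := Rmult_le_compat_l _ _ _ aE i1.
  have m2 := Rmult_le_pos _ _ aE j1; have m3 := Rmult_le_pos _ _ aE j2.
  by rewrite Rmult_plus_distr_l; apply: Rabs_le; split; lra.
rewrite !Rabs_mult.
have -> : Rabs (/ phi_total al N) = / phi_total al N by apply: Rabs_pos_eq; lra.
have -> : Rabs (aR al M) = aR al M by apply: Rabs_pos_eq; apply: Rlt_le; exact: aR_gt0.
have -> : Rabs (aR al (N - M)) = aR al (N - M).
  by apply: Rabs_pos_eq; apply: Rlt_le; exact: aR_gt0.
have b1 : Rabs (indR (r \in A) - indR (p \in A)) <= 1.
  by case: (r \in A); case: (p \in A); rewrite /indR; apply: Rabs_le; lra.
have a1 : aR al M <= aR al L * aR al (eta r).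
  by rewrite -aR_muln; [exact: aR_mono|lia|lia].
have a2 : aR al (N - M) <= aR al N by apply: aR_mono => //; lia.
have p1 := aR_gt0 al M; have p2 := aR_gt0 al (N - M); have p3 := aR_gt0 al N.
have p4 := aR_gt0 (al + 1) N.
set X := INR k / INR (eta r) ^ 2 in hq *.
have b0 := Rabs_pos (indR (r \in A) - indR (p \in A)); have q0 := Rabs_pos (q1 - q2).
apply: Rle_trans (_ : 1 * (Cs / aR (2 * al + 1) N * (aR al L * aR al (eta r)) * aR al N *
   (2 * al * E * X)) <= _).
  apply: Rmult_le_compat => //.
    by repeat apply: Rmult_le_pos => //; lra.
  apply: Rmult_le_compat => //; first by repeat apply: Rmult_le_pos => //; lra.
  apply: Rmult_le_compat => //; try lra; first by apply: Rmult_le_pos => //; lra.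
  by apply: Rmult_le_compat => //; lra.
rewrite (_ : 2 * al + 1 = al + (al + 1)) ?[aR (al + (_ + _)) _]aRD; last ring.
by apply: Req_le; field; split; lra.
Qed.

End Pointwise.

Section Pointwise2.
Variables (L : nat) (x0 : 'I_L) (al ga : R) (A : {set 'I_L}) (N : nat) (Cs : R).
Hypotheses (HL : (2 <= L)%N) (N0 : (0 < N)%N).
Hypotheses (ga1 : 1 < ga) (ga2 : ga <= 2) (gaal : 2 * ga + 1 <= al).
Hypothesis hCs : / phi_total al N <= Cs / aR (2 * al + 1) N.
Implicit Types (eta xi : conf L) (x y z p r t : 'I_L).

Let al0 : 0 <= al. Proof. lra. Qed.
Let F := testF x0 al A N.

(** At [eta] and at every configuration one jump away, [testF] is close to the same constant
    [indR (p \in A)]; the successor in the bound on [m] accounts for the jump. *)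
Lemma adj_gen_le p eta (m : nat) : isE N eta -> ((N - eta p).+1 <= m)%N ->
  Rabs (adj_gen al F eta) <=
    INR L * (aR al 2 * (2 * dev_const al Cs * (aR (al + 1) m / aR (al + 1) N))).
Proof.
move=> hE hm; have cb0 := dev_const_gt0 N0 hCs.
have bd e : isE N e -> (N - e p <= m)%N ->
    Rabs (F e - indR (p \in A)) <= dev_const al Cs * (aR (al + 1) m / aR (al + 1) N).
  move=> he hem; apply: Rle_trans (testF_bound x0 A HL al0 N0 hCs p he) _.
  apply: Rmult_le_compat_l; first lra.
  apply: div_mono; first by apply: Rlt_le; exact: aR_gt0.
  by apply: aR_mono => //; lra.
have pos : 0 <= aR (al + 1) m / aR (al + 1) N.
  by apply: Rlt_le; apply: Rdiv_lt_0_compat; exact: aR_gt0.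
apply: Rle_trans (sumR_abs _ _ _) _; rewrite -sumR_const_ord.
apply: sumR_le => x _; case: (posnP (eta x)) => [->|hx].
  rewrite /= Rmult_0_l Rabs_R0; apply: Rmult_le_pos; first by apply: Rlt_le; exact: exp_pos.
  by apply: Rmult_le_pos => //; lra.
rewrite Rabs_mult Rabs_pos_eq; last exact: gR_ge0.
apply: Rmult_le_compat; [exact: gR_ge0|exact: Rabs_pos|exact: gR_le|].
have h1 : Rabs (F eta - indR (p \in A)) <= dev_const al Cs * (aR (al + 1) m / aR (al + 1) N).
  by apply: bd => //; lia.
have h2 : Rabs (F (Defs.sigma x (ord_pred x) eta) - indR (p \in A)) <=
    dev_const al Cs * (aR (al + 1) m / aR (al + 1) N).
  apply: bd; first exact: isE_sigma.
  by have := sigma_close x (ord_pred x) eta p; lia.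
move: h1 h2; set u := F eta; set v := F _; set b := indR _.
have := Rabs_triang (v - b) (- (u - b)); rewrite Rabs_Ropp.
have -> : v - b + - (u - b) = v - u by ring.
lra.
Qed.

(** The two summands belong to the clear and to the tied configurations; the common factor [aR al L]
    comes from [weight_largest]. *)
Definition err_const : R :=
  aR al L * (Cs * aR al L * (2 * al * exp al) * INR L +
    INR L * aR al 2 * 2 * dev_const al Cs * aR (al + 1) L * aR (1 + ga) 3).

Lemma err_const_gt0 : 0 < err_const.
Proof.
have c1 := Cs_gt0 N0 hCs; have c2 := dev_const_gt0 N0 hCs.
have a1 := aR_gt0 al L; have a2 := aR_gt0 al 2; have a3 := aR_gt0 (al + 1) L.
have a4 := aR_gt0 (1 + ga) 3; have e := exp_pos al.
have l : 1 <= INR L by apply: INR_ge1; lia.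
apply: Rmult_lt_0_compat => //; apply: Rplus_lt_0_compat.
  by repeat apply: Rmult_lt_0_compat; lra.
by repeat apply: Rmult_lt_0_compat; lra.
Qed.

(* At a tie the generator is only bounded by the oscillation of [testF], but then three
   sites are heavy; [2 * ga + 1 <= al] with [1 < ga], possible since [3 < al], pays for it. *)
Lemma weighted_adj_gen_le eta (p := largest x0 eta) : isE N eta -> (3 <= eta (second p eta))%N ->
  weight al eta * Rabs (adj_gen al F eta) <=
    err_const / (aR (al + 1) N * aR al N) * rest_weight ga p eta.
Proof.
move=> hE; have [rp hr] := secondP HL p eta; set r := second p eta in rp hr * => r3.
have hp := largestP x0 eta; rewrite -/p in hp.
have oth := others_le HL p hE; rewrite -/r in oth.
have c1 := Cs_gt0 N0 hCs; have c2 := dev_const_gt0 N0 hCs.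
have wt := @weight_largest L al ga ga1 gaal N p eta N0 (largest_ge x0 hE).
have w0 := weight_gt0 al eta; have pw0 := rest_weight_gt0 al p eta; have pwg := rest_weight_gt0 ga p eta.
have a1 := aR_gt0 al L; have a2 := aR_gt0 al 2; have a3 := aR_gt0 (al + 1) L.
have a4 := aR_gt0 (1 + ga) 3; have e := exp_pos al.
have a5 := aR_gt0 al N; have a6 := aR_gt0 (al + 1) N.
have l : 1 <= INR L by apply: INR_ge1; lia.
pose D := aR (al + 1) N * aR al N.
have D0 : 0 < D by exact: Rmult_lt_0_compat.
have fin (c X : R) : 0 <= c -> X * rest_weight al p eta <= c * rest_weight ga p eta ->
   (aR al L / aR al N * rest_weight al p eta) * (X / aR (al + 1) N) <= (aR al L * c) / D * rest_weight ga p eta.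
  move=> c0 hX.
  have -> : aR al L / aR al N * rest_weight al p eta * (X / aR (al + 1) N) =
     aR al L / D * (X * rest_weight al p eta) by rewrite /D; field; lra.
  have -> : aR al L * c / D * rest_weight ga p eta = aR al L / D * (c * rest_weight ga p eta).
    by rewrite /D; field; lra.
  by apply: Rmult_le_compat_l => //; apply: Rlt_le; exact: Rdiv_lt_0_compat.
have le2 (c1' c2' : R) : 0 <= c1' -> 0 <= c2' ->
   aR al L * c1' / D * rest_weight ga p eta <= aR al L * (c1' + c2') / D * rest_weight ga p eta.
  move=> h1 h2; apply: Rmult_le_compat_r; first lra.
  by apply: div_mono; [lra|apply: Rmult_le_compat_l; lra].
have pos1 : 0 <= Cs * aR al L * (2 * al * exp al) * INR L.
  by repeat apply: Rmult_le_pos; lra.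
have pos2 : 0 <= INR L * aR al 2 * 2 * dev_const al Cs * aR (al + 1) L * aR (1 + ga) 3.
  by repeat apply: Rmult_le_pos; lra.
have [/forall_inP hcl|] := boolP [forall z in predC1 p, (z != r) ==> (eta z + 3 <= eta r)%N].
  have hM : (mass r p eta <= L * eta r)%N.
    by have := mass_le rp hE; have := leq_pred L; nia.
  have := @adj_gen_clear_le L x0 al ga A N Cs HL N0 ga1 gaal hCs p r eta rp hE _ (hp r) hM.
  move=> /(_ _ _) h; apply: Rle_trans (Rle_trans _ _ _ _ (le2 _ _ pos1 pos2)).
    apply: Rmult_le_compat; [lra|exact: Rabs_pos|exact: wt|].
    by apply: h => [|z zp zr]; [lia|have := hcl z zp; rewrite zr].
  set X := aR al (eta r) * _.
  have := @fin (Cs * aR al L * (2 * al * exp al) * INR L)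
    (Cs * aR al L * (2 * al * exp al) * X) pos1.
  have -> : Cs * aR al L * (2 * al * exp al) / aR (al + 1) N * X =
    Cs * aR al L * (2 * al * exp al) * X / aR (al + 1) N by field; lra.
  apply; have r0 : (0 < eta r)%N by lia.
  have := rest_weight_clear ga1 ga2 gaal rp r0; rewrite -/X => hX.
  rewrite Rmult_assoc [X in _ <= X]Rmult_assoc; apply: Rmult_le_compat_l => //.
  by repeat apply: Rmult_le_pos; lra.
rewrite negb_forall => /existsP[t]; rewrite !negb_imply -ltnNge => /and3P[tp tr ht].
have tp' : t != p by [].
(* The light sites and [r] hold at most [(L - 1) * eta r] particles, and the remaining copy of
   [eta r] leaves room for the successor. *)
have hg := @adj_gen_le p eta (L * eta r) hE; have {}hg := hg ltac:(nia).
rewrite aR_muln in hg; [|lia|lia].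
rewrite /err_const [X in aR al L * X]Rplus_comm.
apply: Rle_trans (Rle_trans _ _ _ _ (le2 _ _ pos2 pos1)).
  apply: Rmult_le_compat; [lra|exact: Rabs_pos|exact: wt|exact: hg].
have := @fin (INR L * aR al 2 * 2 * dev_const al Cs * aR (al + 1) L * aR (1 + ga) 3)
   (INR L * aR al 2 * 2 * dev_const al Cs * aR (al + 1) L * aR (al + 1) (eta r)) pos2.
have -> : INR L * (aR al 2 * (2 * dev_const al Cs * (aR (al + 1) L * aR (al + 1) (eta r) / aR (al + 1) N))) =
  INR L * aR al 2 * 2 * dev_const al Cs * aR (al + 1) L * aR (al + 1) (eta r) / aR (al + 1) N.
  by field; lra.
apply; rewrite Rmult_assoc [X in _ <= X]Rmult_assoc; apply: Rmult_le_compat_l.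
  by repeat apply: Rmult_le_pos; lra.
(* A failed gap means [eta r <= eta t + 2]; with [3 <= eta r] this gives [0 < eta t] and
   [eta r <= 3 * eta t]. *)
by apply: (@rest_weight_tie L al ga ga1 gaal p r t) => //; [lia|lia].
Qed.

End Pointwise2.

Lemma pow_le_exponent (Zeta : R) m n : 1 <= Zeta -> (m <= n)%N -> Zeta ^ m <= Zeta ^ n.
Proof. by move=> Z1 /leP h; apply: Rle_pow. Qed.

(** * The L^1 norm of the adjoint generator off the wells *)

Section OffWells.
Variables (L : nat) (x0 : 'I_L) (al ga : R) (A : {set 'I_L}) (N : nat) (Cs Zeta : R).
Hypotheses (HL : (2 <= L)%N) (N0 : (0 < N)%N).
Hypotheses (ga1 : 1 < ga) (ga2 : ga <= 2) (gaal : 2 * ga + 1 <= al).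
Hypothesis hCs : / phi_total al N <= Cs / aR (2 * al + 1) N.
Hypothesis hZ : is_lim_seq (fun n => \sum_(i < n) / aR ga i) Zeta.
Implicit Types (eta xi : conf L) (x y z p r t : 'I_L).

Definition series_tail (k : nat) : R := Zeta - \sum_(i < k) / aR ga i.

Lemma Zeta_ge1 : 1 <= Zeta.
Proof.
have := psum_le_lim (invaR_ge0 ga) hZ 1; rewrite big_ord_recr big_ord0 /= Rinv_1; lra.
Qed.

(** Conservation of mass eliminates [p], the site [r] contributes a tail of the [ga]-series, and
    every other site at most [Zeta]; since [1 <= Zeta], the exponent [L] is a safe count. *)
Lemma heavy_sum_le p r (k : nat) : r != p ->
  \sum_(eta <- enumE L N) (indR (k <= eta r)%N * rest_weight ga p eta) <= Zeta ^ L * series_tail k.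
Proof.
move=> rp.
pose h z i := (if z == r then indR (k <= i)%N else 1) * / aR ga i.
have h0 z i : 0 <= h z i.
  by apply: Rmult_le_pos; [case: ifP => _; [exact: indR_ge0|lra]|exact: invaR_ge0].
have e eta : indR (k <= eta r)%N * rest_weight ga p eta = \prod_(z < L | z != p) h z (eta z).
  rewrite /rest_weight (prodR_D1 (j := r)) // [RHS](prodR_D1 (j := r)) //.
  rewrite /h eqxx -Rmult_assoc; congr (_ * _).
  by apply: eq_bigr => z /andP[_ /negbTE ->]; rewrite Rmult_1_l.
rewrite (eq_bigr _ (fun eta _ => e eta)).
apply: Rle_trans (sum_prod_le N p h0) _; rewrite (prodR_D1 (j := r)) // Rmult_comm.
have t0 : 0 <= series_tail k.
  by have := psum_le_lim (invaR_ge0 ga) hZ k; rewrite /series_tail; lra.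
apply: Rmult_le_compat.
- by apply: prodR_ge0 => z _; apply: sumR_ge0.
- by apply: sumR_ge0.
- apply: Rle_trans (_ : \prod_(z < L | (z != p) && (z != r)) Zeta <= _).
    apply: prodR_le => z /andP[_ /negbTE zr]; split; first exact: sumR_ge0.
    rewrite (eq_bigr (fun i : 'I_N.+1 => / aR ga i)) => [|i _]; last first.
      by rewrite /h zr Rmult_1_l.
    exact: (psum_le_lim (invaR_ge0 ga) hZ).
  rewrite prodR_const; apply: pow_le_exponent; first exact: Zeta_ge1.
  by rewrite -[X in (_ <= X)%N]card_ord max_card.
apply: Rle_trans (psum_split (invaR_ge0 ga) hZ k N.+1).
apply: Req_le; rewrite [RHS]big_mkcond; apply: eq_bigr => i _; rewrite /h eqxx.
by case: (k <= i)%N; rewrite /indR; lra.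
Qed.

(** Off the wells more than [l] particles are outside the largest site, so the second one holds at
    least [l %/ L], and at least 3 because [3 * L <= l]. Summing over all pairs [(p, r)] removes the
    dependence of these sites on [eta]. *)
Lemma off_wells_sum (l : nat) : (3 * L <= l)%N ->
  \sum_(eta <- enumE L N | [forall x, (eta x < N - l)%N]) (weight al eta *
     Rabs (adj_gen al (testF x0 al A N) eta)) <=
  err_const L al ga Cs / (aR (al + 1) N * aR al N) * (INR L * (INR L * (Zeta ^ L * series_tail (l %/ L)))).
Proof.
move=> hl; have K0 := err_const_gt0 HL N0 ga1 gaal hCs.
set c := err_const _ _ _ _ / _; have c0 : 0 <= c.
  apply: Rlt_le; apply: Rdiv_lt_0_compat => //.
  by apply: Rmult_lt_0_compat; exact: aR_gt0.
have t0 : 0 <= series_tail (l %/ L).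
  by have := psum_le_lim (invaR_ge0 ga) hZ (l %/ L); rewrite /series_tail; lra.
have Z1 := Zeta_ge1; have ZL : 0 <= Zeta ^ L by apply: pow_le; lra.
pose G p r eta := indR (r != p) * (indR (l %/ L <= eta r)%N * rest_weight ga p eta).
have G0 p r eta : 0 <= G p r eta.
  apply: Rmult_le_pos; first exact: indR_ge0.
  by apply: Rmult_le_pos; [exact: indR_ge0|apply: Rlt_le; exact: rest_weight_gt0].
apply: Rle_trans (_ : \sum_(eta <- enumE L N) (c * \sum_(p < L) \sum_(r < L) G p r eta) <= _).
  rewrite big_mkcond; apply: sumR_le_mem => eta; rewrite mem_enumE => hE _.
  have GG0 : 0 <= c * \sum_(p < L) \sum_(r < L) G p r eta.
    by apply: Rmult_le_pos => //; do 2 (apply: sumR_ge0 => ? _).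
  case: ifP => // /forallP hoff.
  set p := largest x0 eta; have [rp _] := secondP HL p eta; set r := second p eta in rp *.
  have hr : (l < L.-1 * eta r)%N.
    apply: leq_trans (others_le HL p hE).
    by rewrite ltn_subRL addnC -ltn_subRL; exact: (hoff p).
  have hr' : (l < L * eta r)%N.
    by apply: leq_trans hr _; rewrite leq_mul2r leq_pred orbT.
  have hr3 : (3 <= eta r)%N.
    have : (L * 3 < L * eta r)%N by lia.
    by rewrite ltn_mul2l => /andP[_] /ltnW.
  apply: Rle_trans (@weighted_adj_gen_le L x0 al ga A N Cs HL N0 ga1 ga2 gaal hCs eta hE hr3) _.
  rewrite -/c; apply: Rmult_le_compat_l => //.
  apply: Rle_trans (_ : G p r eta <= _).
    rewrite /G rp (_ : (l %/ L <= eta r)%N = true); first by rewrite /= !Rmult_1_l; exact: Rle_refl.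
    apply: leq_trans (_ : (L * eta r) %/ L <= _)%N; last by rewrite mulKn //; lia.
    by apply: leq_div2r; exact: ltnW.
  apply: Rle_trans (@sumR_term _ predT (fun p => \sum_(r < L) G p r eta) p isT _).
    exact: (@sumR_term _ predT (fun r => G p r eta)).
  by move=> q _; apply: sumR_ge0.
rewrite -sumR_mull; apply: Rmult_le_compat_l => //.
rewrite exchange_big -sumR_const_ord; apply: sumR_le => p _.
rewrite exchange_big -sumR_const_ord; apply: sumR_le => r _.
rewrite /G -sumR_mull; case rp: (r != p); rewrite /indR; last first.
  by rewrite Rmult_0_l; exact: Rmult_le_pos.
by rewrite Rmult_1_l; exact: heavy_sum_le.
Qed.

End OffWells.

(** * From the capacity to the test function *)

Section CapApprox.
Variables (L : nat) (x0 : 'I_L) (al : R) (A : {set 'I_L}) (n l : nat).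
Notation N := n.+1.
Hypothesis hl : (l + l < N)%N.
Implicit Types (eta xi : conf L) (x y z p r : 'I_L).

(** Written as a sum over sites, so that its generator splits into one flux per well; on [E_N] the
    wells are disjoint and the value is 0 or 1. *)
Definition well_indicator eta : R := \sum_(y in A) indR (N - l <= eta y)%N.

Lemma two_wells eta x y : isE N eta -> (N - l <= eta x)%N -> (N - l <= eta y)%N -> x = y.
Proof.
move=> /eqP hE hx hy; apply/eqP; apply: contraT => xy; move: hE.
rewrite (bigD1 x) //= (bigD1 y) 1?eq_sym //=; lia.
Qed.

Lemma well_indicator1 eta : isE N eta -> EN N l A eta -> well_indicator eta = 1.
Proof.
move=> hE /exists_inP[x xA hx]; rewrite /well_indicator (sumR_D1 (j := x)) // hx.
rewrite big1 ?Rplus_0_r // => y /andP[_ yx]; case hy: (N - l <= eta y)%N => //.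
by rewrite (two_wells hE hx hy) eqxx in yx.
Qed.

Lemma well_indicator0 eta : ~~ EN N l A eta -> well_indicator eta = 0.
Proof.
rewrite /EN negb_exists => /forallP h; rewrite /well_indicator big1 // => y yA.
by have := h y; rewrite yA /= => /negbTE ->.
Qed.

Lemma wells_disjoint eta : isE N eta -> EN N l A eta -> ~~ EN N l (~: A) eta.
Proof.
move=> hE /exists_inP[x xA hx]; apply/negP => /exists_inP[y]; rewrite !inE => yA hy.
by move: yA; rewrite -(two_wells hE hx hy) xA.
Qed.

Variables (F : conf L -> R) (e : R).
Hypothesis hF1 : forall eta, isE N eta -> EN N l A eta -> Rabs (F eta - 1) <= e.
Hypothesis hF0 : forall eta, isE N eta -> EN N l (~: A) eta -> Rabs (F eta) <= e.

Let cap := capN al N (EN N l A) (EN N l (~: A)).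
Let W := WN al L N.

(* [<F, -L V>] only sees the wells, where [F] is close to [V]; moving [L] to [F], it is
   [<-L* F, V>], where [V] may be replaced by the indicator of the wells of [A] at the
   cost of the mass of [L* F] off the wells. *)
Lemma cap_approx :
  let Y := - (/ W * \sum_(eta <- enumE L N) (weight al eta * (F eta * gen al well_indicator eta))) in
  0 <= cap /\
  Rabs (Y - cap) <= 2 * e * cap + / W *
   \sum_(eta <- enumE L N | [forall x, (eta x < N - l)%N]) (weight al eta * Rabs (adj_gen al F eta)).
Proof.
move=> Y; have W0 : 0 < W := WN_gt0 al N x0.
have Wi : 0 < / W by apply: Rinv_0_lt_compat.
have wells_x0 eta : isE N eta -> eta x0 = N -> EN N l A eta || EN N l (~: A) eta.
  move=> _ hx; case xA: (x0 \in A); apply/orP; [left|right]; apply/exists_inP;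
    exists x0; rewrite ?hx ?leq_subr // inE xA //.
have [[hA [hB hV]] hV01] := potentialP al wells_disjoint wells_x0.
move: (potential _ _ _ _) (erefl : cap = dirichlet al N (potential al N (EN N l A) (EN N l (~: A)))) hA hB hV hV01.
move=> V hcap hA hB hV hV01.
have gA eta : isE N eta -> EN N l A eta -> gen al V eta <= 0.
  move=> hE hw; apply: sumR_le0 => x _ _; rewrite (hA _ hE hw).
  case: (posnP (eta x)) => [->|hx]; first by rewrite /=; lra.
  by have := hV01 _ (isE_sigma (succ x) hx hE); have := gR_ge0 al (eta x); nra.
have gB eta : isE N eta -> EN N l (~: A) eta -> 0 <= gen al V eta.
  move=> hE hw; apply: sumR_ge0 => x _; rewrite (hB _ hE hw).
  case: (posnP (eta x)) => [->|hx]; first by rewrite /=; lra.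
  by have := hV01 _ (isE_sigma (succ x) hx hE); have := gR_ge0 al (eta x); nra.
have hD : cap = - (/ W * \sum_(eta <- enumE L N) (weight al eta * (V eta * gen al V eta))).
  by rewrite hcap dirichlet_gen.
set SV := \sum_(eta <- _) _ in hD.
have SV0 : SV <= 0.
  apply: sumR_le0 => eta; rewrite mem_enumE => hE _; have w0 := weight_gt0 al eta.
  case wA: (EN N l A eta).
    by have := gA _ hE wA; rewrite (hA _ hE wA); nra.
  case wB: (EN N l (~: A) eta); first by rewrite (hB _ hE wB); lra.
  by rewrite hV ?wA ?wB //; lra.
have cap0 : 0 <= cap by rewrite hD; nra.
split=> //.
have h1 : Rabs (\sum_(eta <- enumE L N) (weight al eta * (F eta * gen al V eta)) - SV) <=
   2 * e * (W * cap).
  rewrite -sumR_sub; apply: Rle_trans (sumR_abs _ _ _) _.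
  (* The new summand is [e] times the weight times the absolute value of [gen al V]: [V = 1] with a
     nonpositive generator, [V = 0] with a nonnegative one, or a vanishing generator. Its linear
     part sums to 0 by invariance. *)
  have -> : 2 * e * (W * cap) = \sum_(eta <- enumE L N)
     (e * (weight al eta * gen al V eta) - 2 * e * (weight al eta * (V eta * gen al V eta))).
    by rewrite sumR_sub -!sumR_mull sum_gen -/SV hD; field; lra.
  apply: sumR_le_mem => eta; rewrite mem_enumE => hE _; have w0 := weight_gt0 al eta.
  have -> : weight al eta * (F eta * gen al V eta) - weight al eta * (V eta * gen al V eta) =
    weight al eta * ((F eta - V eta) * gen al V eta) by ring.
  have -> : e * (weight al eta * gen al V eta) - 2 * e * (weight al eta * (V eta * gen al V eta)) =
    weight al eta * (e * (gen al V eta - 2 * V eta * gen al V eta)) by ring.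
  rewrite Rabs_mult (Rabs_pos_eq (weight _ _)); last lra.
  apply: Rmult_le_compat_l; first lra.
  rewrite Rabs_mult.
  case wA: (EN N l A eta).
    rewrite (hA _ hE wA); have g := gA _ hE wA; rewrite [Rabs (gen _ _ _)]Rabs_left1 //.
    by have := hF1 hE wA; have := Rabs_pos (F eta - 1); nra.
  case wB: (EN N l (~: A) eta).
    rewrite (hB _ hE wB); have g := gB _ hE wB; rewrite [Rabs (gen _ _ _)]Rabs_pos_eq //.
    by rewrite Rminus_0_r; have := hF0 hE wB; have := Rabs_pos (F eta); nra.
  by rewrite hV ?wA ?wB // Rabs_R0; lra.
set SF := \sum_(eta <- _) _ in h1.
pose off := \sum_(eta <- enumE L N | [forall x, (eta x < N - l)%N])
   (weight al eta * Rabs (adj_gen al F eta)).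
have h2 : Rabs (SF - \sum_(eta <- enumE L N) (weight al eta * (F eta * gen al well_indicator eta))) <= off.
  rewrite /SF -!gen_adjoint -sumR_sub; apply: Rle_trans (sumR_abs _ _ _) _.
  rewrite /off [X in _ <= X]big_mkcond; apply: sumR_le_mem => eta.
  rewrite mem_enumE => hE _; have w0 := weight_gt0 al eta.
  have -> : weight al eta * (V eta * adj_gen al F eta) - weight al eta * (well_indicator eta * adj_gen al F eta) =
     weight al eta * ((V eta - well_indicator eta) * adj_gen al F eta) by ring.
  rewrite !Rabs_mult (Rabs_pos_eq (weight _ _)); last lra.
  case wA: (EN N l A eta).
    rewrite (hA _ hE wA) (well_indicator1 hE wA) Rminus_diag Rabs_R0 Rmult_0_l Rmult_0_r.
    case: ifP => _; last lra.
    by apply: Rmult_le_pos; [lra|exact: Rabs_pos].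
  rewrite well_indicator0 ?wA // Rminus_0_r.
  case wB: (EN N l (~: A) eta).
    rewrite (hB _ hE wB) Rabs_R0 Rmult_0_l Rmult_0_r.
    case: ifP => _; last lra.
    by apply: Rmult_le_pos; [lra|exact: Rabs_pos].
  have -> : [forall x, (eta x < N - l)%N].
    apply/forallP => x; rewrite ltnNge; apply/negP => hx.
    case xA: (x \in A).
      by move: wA; rewrite /EN => /exists_inP; case; exists x.
    by move: wB; rewrite /EN => /exists_inP; case; exists x => //; rewrite inE xA.
  apply: Rmult_le_compat_l; first lra.
  rewrite -[X in _ <= X]Rmult_1_l; apply: Rmult_le_compat_r; first exact: Rabs_pos.
  by apply: Rabs_le; have := hV01 _ hE; lra.
rewrite -/off.
have -> : Y - cap = / W * ((SF - \sum_(eta <- enumE L N) (weight al eta *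
    (F eta * gen al well_indicator eta))) - (SF - SV)) by rewrite /Y hD; ring.
rewrite Rabs_mult (Rabs_pos_eq (/ W)); last lra.
have -> : 2 * e * cap + / W * off = / W * (off + 2 * e * (W * cap)) by field; lra.
apply: Rmult_le_compat_l; first lra.
apply: Rle_trans (Rabs_triang _ _) _; rewrite Rabs_Ropp; exact: Rplus_le_compat.
Qed.

End CapApprox.

(** * The flux into the wells *)

Section FixedSums.
Variables (L n : nat) (y r : 'I_L) (b : nat) (f : 'I_L -> nat -> R).
Hypothesis yr : y != r.
Hypothesis f0 : forall z i, 0 <= f z i.
Implicit Types (xi : conf L) (z : 'I_L).

Let h z i := if z == y then indR (i == b) else f z i.

Let h0 z i : 0 <= h z i.
Proof. by rewrite /h; case: ifP => _ //; exact: indR_ge0. Qed.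

Let hE xi : indR (xi y == b) * \prod_(z < L | (z != y) && (z != r)) f z (xi z) =
  \prod_(z < L | z != r) h z (xi z).
Proof.
rewrite [RHS](prodR_D1 (j := y)) // /h eqxx; congr (_ * _).
by apply: eq_big => [z|z /andP[/negbTE ->]//]; rewrite andbC.
Qed.

Let sum_eq_le1 k : \sum_(i < k) indR ((i : nat) == b) <= 1.
Proof.
elim: k => [|k IH]; first by rewrite big_ord0; lra.
rewrite big_ord_recr /=; case: eqP => [e|_]; last by rewrite Rplus_0_r.
have -> : \sum_(i < k) indR ((i : nat) == b) = 0; last by rewrite /=; lra.
by apply: big1 => i _; rewrite -e; case: eqP => // h1; have := ltn_ord i; lia.
Qed.

Lemma card_others : #|[pred z | (z != y) && (z != r)]| = (L - 2)%N.
Proof.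
have e := cardC (pred2 y r); rewrite card2 yr card_ord in e.
have -> : #|[pred z | (z != y) && (z != r)]| = #|[predC pred2 y r]|.
  by apply: eq_card => z; rewrite !inE negb_or.
have e2 : (2 + #|[predC pred2 y r]| = L)%N by [].
by rewrite -[X in _ = (X - 2)%N]e2 addKn.
Qed.

(** The indicator fixes the site [y] and conservation of mass eliminates [r]; [L - 2] free one-site
    sums remain, hence the power. *)
Lemma fixed_sum_le B : (forall z, \sum_(i < n.+1) f z i <= B) ->
  \sum_(xi <- enumE L n) (indR (xi y == b) * \prod_(z < L | (z != y) && (z != r)) f z (xi z))
  <= B ^ (L - 2).
Proof.
move=> hB; rewrite (eq_bigr _ (fun xi _ => hE xi)).
apply: Rle_trans (sum_prod_le n r h0) _; rewrite (prodR_D1 (j := y)) //.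
rewrite -card_others -prodR_const -[X in _ <= X]Rmult_1_l; apply: Rmult_le_compat.
- exact: sumR_ge0.
- by apply: prodR_ge0 => z _; exact: sumR_ge0.
- apply: Rle_trans (sum_eq_le1 n.+1); apply: Req_le; apply: eq_bigr => i _.
  by rewrite /h eqxx.
have e : \prod_(z < L | (z != y) && (z != r)) B = \prod_(z < L | (z != r) && (z != y)) B.
  by apply: eq_bigl => z; rewrite andbC.
rewrite e; apply: prodR_le => z /andP[_ /negbTE zy]; split; first exact: sumR_ge0.
by rewrite /h zy; exact: hB.
Qed.

(** With [f] supported on [[0, k]] and [b + L * k <= n], the mass constraint is never active. *)
Lemma fixed_sum_eq (k : nat) B : (forall z i, (k < i)%N -> f z i = 0) ->
  (b + L * k <= n)%N -> (forall z, \sum_(i < n.+1) f z i = B) ->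
  \sum_(xi <- enumE L n) (indR (xi y == b) * \prod_(z < L | (z != y) && (z != r)) f z (xi z))
  = B ^ (L - 2).
Proof.
move=> hk hbk hB; rewrite (eq_bigr _ (fun xi _ => hE xi)).
rewrite (@sum_prod_eq L n r h (fun z => if z == y then b else k)); first last.
- rewrite (bigD1 y) //= eqxx; apply: leq_trans hbk; rewrite leq_add2l.
  apply: leq_trans (_ : \sum_(z < L) k <= _)%N; last by rewrite sum_nat_const card_ord.
  rewrite big_mkcond leq_sum // => z _; case: ifP => // /andP[_ /negbTE ->] //.
- move=> z i; rewrite /h; case: ifP => _; last exact: hk.
  by case: eqP => // ->; rewrite ltnn.
rewrite (prodR_D1 (j := y)) //.
have -> : \sum_(i < n.+1) h y i = 1.
  have hb : (b < n.+1)%N by lia.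
  rewrite (sumR_D1 (j := Ordinal hb)) // /h eqxx /= eqxx big1 ?Rplus_0_r //.
  move=> i /eqP ib; case: eqP => // e; case: ib; exact: val_inj.
rewrite Rmult_1_l -card_others -prodR_const.
have e : \prod_(z < L | (z != y) && (z != r)) B = \prod_(z < L | (z != r) && (z != y)) B.
  by apply: eq_bigl => z; rewrite andbC.
by rewrite e; apply: eq_bigr => z /andP[_ /negbTE zy]; rewrite /h zy; exact: hB.
Qed.

End FixedSums.

Section Flux.
Variables (L : nat) (al : R) (A : {set 'I_L}) (n l : nat).
Hypothesis hl : (l <= n)%N.
Implicit Types (eta xi : conf L) (x y z p r : 'I_L).

(** The indicator of a well changes only on its border. The jump that completes the well of [y]
    comes from [ord_pred y], and the one that opens it goes out of [y]. Both have a background with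
    [n - l] particles at [y], one less than the threshold [N - l]. *)
Lemma well_indicator_flux (F : conf L -> R) :
  - \sum_(eta <- enumE L n.+1) (weight al eta * (F eta * gen al (well_indicator A n l) eta)) =
  \sum_(y in A) \sum_(xi <- enumE L n) (indR (xi y == (n - l)%N) *
     (weight al xi * (F (addp y xi) - F (addp (ord_pred y) xi)))).
Proof.
rewrite gen_pair exchange_big -sumR_opp; apply: eq_bigr => xi _ /=.
pose s y := indR (xi y == (n - l)%N).
have e x : well_indicator A n l (addp x xi) =
   \sum_(y in A) (indR (n.+1 - l <= xi y)%N + indR (y == x) * s y).
  apply: eq_bigr => y _; rewrite ffunE /s subSn //.
  case: (y == x); rewrite ?addn0 ?addn1 /indR; last by lra.
  by rewrite ltnS [(n - l <= _)%N]leq_eqVlt [_ == xi y]eq_sym;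
     case: ltngtP => /=; lra.
have d x : well_indicator A n l (addp (succ x) xi) - well_indicator A n l (addp x xi) =
   \sum_(y in A) (s y * (indR (y == succ x) - indR (y == x))).
  by rewrite !e -sumR_sub; apply: eq_bigr => y _; ring.
rewrite (eq_bigr (fun x => \sum_(y in A) (s y * (F (addp x xi) *
   (indR (y == succ x) - indR (y == x)))))) => [|x _]; last first.
  by rewrite d sumR_mull; apply: eq_bigr => y _; ring.
rewrite exchange_big Ropp_mult_distr_r -sumR_opp sumR_mull; apply: eq_bigr => y _ /=.
rewrite -sumR_mull -/(s y).
have -> : \sum_(x < L) (F (addp x xi) * (indR (y == succ x) - indR (y == x))) =
   F (addp (ord_pred y) xi) - F (addp y xi).
  rewrite (eq_bigr (fun x => F (addp x xi) * indR (y == succ x) - F (addp x xi) * indR (y == x)))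
     => [|x _]; last by ring.
  rewrite sumR_sub (sumR_D1 (j := ord_pred y)) // [X in _ - X](sumR_D1 (j := y)) //.
  rewrite /succ ord_predK !eqxx big1 => [|x xy]; last first.
    by case: eqP => [e1|_]; [rewrite e1 ordSK eqxx in xy|rewrite /=; ring].
  rewrite big1 => [|x xy]; last by rewrite eq_sym (negbTE xy) /=; ring.
  rewrite /indR; ring.
ring.
Qed.

End Flux.

Lemma half_lt (m c : nat) : (0 < m)%N -> (2 * c <= m)%N -> (c < m)%N.
Proof. lia. Qed.

(** If [r] ties with [t] and every site other than [y] and [r] holds at most [k], then at most
    [(L - 1) * k + 1] particles are off [y]; this is less than [l] when [2 * L * k <= l]. *)
Lemma tie_arith (a t k l L S : nat) :
  (a <= t + 1)%N -> (t <= k)%N -> (S <= (L - 2) * k)%N -> l = (a + S)%N ->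
  (k * (2 * L) <= l)%N -> (2 <= L)%N -> (3 * L <= l)%N -> False.
Proof.
move=> h1 h2 h3 h4 h5 h6 h7; have h8 : (2 * k <= L * k)%N by rewrite leq_mul2r h6 orbT.
move: h3 h5; rewrite mulnBl (_ : (k * (2 * L) = 2 * (L * k))%N); last by lia.
move: h8; move: (L * k)%N => X; lia.
Qed.

(** * Upper and lower bounds for the flux into one well *)

Section FluxBounds.
Variables (L : nat) (x0 : 'I_L) (al ga : R) (A : {set 'I_L}) (n l : nat) (Cs Zeta Gam : R).
Notation N := n.+1.
Hypothesis HL : (2 <= L)%N.
Hypotheses (ga1 : 1 < ga) (ga2 : ga <= 2) (gaal : 2 * ga + 1 <= al).
Hypothesis hCs : / phi_total al N <= Cs / aR (2 * al + 1) N.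
Hypothesis hZ : is_lim_seq (fun k => \sum_(i < k) / aR ga i) Zeta.
Hypothesis hGam : forall k, \sum_(i < k) / aR al i <= Gam.
Hypotheses (hl3 : (3 * L <= l)%N) (hln : (l + l + 3 <= n)%N).
Implicit Types (eta xi : conf L) (x y z p r t : 'I_L).

Variable y : 'I_L.
Hypothesis yA : y \in A.

Let al0 : 0 <= al. Proof. lra. Qed.
Let N0 : (0 < N)%N. Proof. by []. Qed.
Let F := testF x0 al A N.
Let D xi := F (addp y xi) - F (addp (ord_pred y) xi).
Let P s r xi := \prod_(z < L | (z != y) && (z != r)) / aR s (xi z).

Let P_ge0 s r xi : 0 <= P s r xi.
Proof. by apply: prodR_ge0 => z _; exact: invaR_ge0. Qed.

Let rest_weightE s r xi : r != y -> rest_weight s y xi = / aR s (xi r) * P s r xi.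
Proof. by move=> ry; rewrite /rest_weight (prodR_D1 (j := r)). Qed.

(** A particle added at [ord_pred y] belongs to the arc from [r], one added at [y] does not, so [D]
    is a single increment of [Phi]; it drops out when [r] is in [A] too. A gap of 2 is enough
    because only one particle is added. *)
Lemma flux_clear r xi : isE n xi -> xi y = (n - l)%N -> r != y ->
  (forall z, z != y -> z != r -> (xi z + 2 <= xi r)%N) ->
  D xi = (1 - indR (r \in A)) * (/ phi_total al N * phi al N (mass r y xi)).
Proof.
move=> hE hy ry hc; have yr : y != r by rewrite eq_sym.
have hz z : z != y -> (xi z <= l)%N.
  by move=> zy; have /eqP := hE; rewrite (bigD1 y) //= (bigD1 z) //=; lia.
have e x : (x == y) || true -> F (addp x xi) = pairF al A N y r (addp x xi).
  move=> _; apply: (testF_clear x0 al A HL N0 yr); first by rewrite isE_addp.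
  move=> z zy zr; have := hc z zy zr; have := hz z zy; rewrite !ffunE.
  by case: (z == x); case: (y == x); case: (r == x); rewrite ?addn0 ?addn1; lia.
rewrite /D !e ?orbT // /pairF !mass_addp arc_r arc_pred // eqxx addn0 addn1.
rewrite -(PhiS al N) yA /indR; ring.
Qed.

Lemma flux_abs xi : isE n xi -> xi y = (n - l)%N ->
  Rabs (D xi) <= 2 * dev_const al Cs * (aR (al + 1) l.+1 / aR (al + 1) N).
Proof.
move=> hE hy; have cb0 := dev_const_gt0 N0 hCs.
have e x : Rabs (F (addp x xi) - indR (y \in A)) <= dev_const al Cs * (aR (al + 1) l.+1 / aR (al + 1) N).
  have hx : isE N (addp x xi) by rewrite isE_addp.
  apply: Rle_trans (testF_bound x0 A HL al0 N0 hCs y hx) _.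
  apply: Rmult_le_compat_l; first lra.
  apply: div_mono; first by apply: Rlt_le; exact: aR_gt0.
  apply: aR_mono; [lra|rewrite ffunE hy; lia].
have h1 := e y; have h2 := e (ord_pred y); rewrite /D.
have -> : F (addp y xi) - F (addp (ord_pred y) xi) =
  (F (addp y xi) - indR (y \in A)) + - (F (addp (ord_pred y) xi) - indR (y \in A)) by ring.
by apply: Rle_trans (Rabs_triang _ _) _; rewrite Rabs_Ropp; lra.
Qed.

Let C1 := al * exp (al * INR L) * INR L.
Let rho := aR al n / aR al (n - l).

(** Since [xi r <= M] and [M <= l], the factors [a(M)] and [a(n - M)] of [phi] at least compensate
    the weights of [r] and [y]; the weight of the light sites is left. *)
Lemma weight_phi_ge r xi : isE n xi -> xi y = (n - l)%N -> r != y ->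
  P al r xi <= weight al xi * phi al N (mass r y xi).
Proof.
move=> hE hy ry; rewrite (weight_rest al y) (rest_weightE al _ ry) hy /phi [N.-1]/=.
have M1 := mass_ge xi ry; have M2 := mass_le ry hE; rewrite hy in M2.
set M := mass r y xi in M1 M2 *.
have a1 := aR_gt0 al (n - l); have a2 := aR_gt0 al (xi r).
have b1 : aR al (xi r) <= aR al M by exact: aR_mono.
have b2 : aR al (n - l) <= aR al (n - M) by apply: aR_mono => //; lia.
have -> : / aR al (n - l) * (/ aR al (xi r) * P al r xi) * (aR al M * aR al (n - M)) =
   (aR al M * aR al (n - M)) / (aR al (xi r) * aR al (n - l)) * P al r xi.
  by field; split; lra.
rewrite -[X in X <= _]Rmult_1_l; apply: Rmult_le_compat_r; first exact: P_ge0.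
apply: (Rmult_le_reg_r (aR al (xi r) * aR al (n - l))); first exact: Rmult_lt_0_compat.
rewrite /Rdiv Rmult_assoc Rinv_l; last by apply: Rmult_integral_contrapositive_currified; lra.
by rewrite Rmult_1_l Rmult_1_r; apply: Rmult_le_compat; lra.
Qed.

(** Here the compensation is reversed up to two factors: [rho], which tends to 1, and
    [a(l) / a(xi r)], whose excess over 1 is proportional to the number of light particles divided
    by [l]. *)
Lemma weight_phi_le r xi : isE n xi -> xi y = (n - l)%N -> r != y -> (l <= L * xi r)%N ->
  weight al xi * phi al N (mass r y xi) <=
  rho * (P al r xi + C1 * (INR L / INR l) * P ga r xi).
Proof.
move=> hE hy ry hr; rewrite (weight_rest al y) (rest_weightE al _ ry) hy /phi [N.-1]/=.
have M1 := mass_ge xi ry; have M2 := mass_le ry hE; rewrite hy in M2.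
set M := mass r y xi in M1 M2 *.
have a1 := aR_gt0 al (n - l); have a2 := aR_gt0 al (xi r).
have l0 : (0 < l)%N by lia.
have r0 : (0 < xi r)%N by case: (posnP (xi r)) hr => // ->; rewrite muln0; lia.
have Ml : (M <= l)%N by lia.
have rl : (xi r <= l)%N by lia.
have b1 : aR al M <= aR al l by exact: aR_mono.
have b2 : aR al (n - M) <= aR al n by apply: aR_mono => //; lia.
have q := @aR_quot_le al (INR L) (xi r) l al0 r0 rl.
have {}q := q ltac:(rewrite -INR_muln; exact: INR_le).
rewrite -/C1 in q.
have k_eq : (l - xi r = \sum_(z < L | (z != y) && (z != r)) xi z)%N.
  by have := sum_others2 ry hE; rewrite hy; lia.
have kP : INR (l - xi r) * P al r xi <= INR L * P ga r xi.
  rewrite k_eq INR_sum sumR_mulr.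
  apply: Rle_trans (_ : \sum_(z < L | (z != y) && (z != r)) P ga r xi <= _).
    by apply: sumR_le => z hz; exact: (@prod_others_le L al ga ga1 gaal (fun z => (z != y) && (z != r))).
  rewrite sumR_const; apply: Rmult_le_compat_r; first exact: P_ge0.
  by apply: INR_le; rewrite -[X in (_ <= X)%N]card_ord max_card.
have lp : 0 < INR l by have := INR_ge1 l0; lra.
have C10 : 0 <= C1.
  by repeat apply: Rmult_le_pos => //; [apply: Rlt_le; exact: exp_pos|exact: pos_INR].
have rho0 : 0 < rho by apply: Rdiv_lt_0_compat; exact: aR_gt0.
have p1 := aR_gt0 al M; have p2 := aR_gt0 al (n - M); have p3 := aR_gt0 al l.
have p4 := P_ge0 al r xi.
apply: Rle_trans (_ : rho * (aR al l / aR al (xi r) * P al r xi) <= _).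
  have -> : / aR al (n - l) * (/ aR al (xi r) * P al r xi) * (aR al M * aR al (n - M)) =
     (aR al (n - M) / aR al (n - l)) * (aR al M / aR al (xi r) * P al r xi).
    by field; split; lra.
  have i1 : 0 < / aR al (xi r) by apply: Rinv_0_lt_compat.
  have i2 : 0 < / aR al (n - l) by apply: Rinv_0_lt_compat.
  apply: Rmult_le_compat.
  - by apply: Rmult_le_pos; lra.
  - by apply: Rmult_le_pos => //; apply: Rmult_le_pos; lra.
  - by apply: Rmult_le_compat_r; lra.
  - by apply: Rmult_le_compat_r => //; apply: Rmult_le_compat_r; lra.
apply: Rmult_le_compat_l; first lra.
apply: Rle_trans (Rmult_le_compat_r _ _ _ p4 q) _.
rewrite Rmult_plus_distr_r Rmult_1_l; apply: Rplus_le_compat_l.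
have -> : C1 * (INR (l - xi r) / INR l) * P al r xi =
   C1 / INR l * (INR (l - xi r) * P al r xi) by field; lra.
have -> : C1 * (INR L / INR l) * P ga r xi = C1 / INR l * (INR L * P ga r xi) by field; lra.
apply: Rmult_le_compat_l => //; apply: Rmult_le_pos => //.
by apply: Rlt_le; apply: Rinv_0_lt_compat.
Qed.

Let T0 := / aR al (n - l) * (2 * dev_const al Cs) * aR (al + 1) L / aR (al + 1) N *
   aR (1 + ga) 3 * aR ga L / aR ga l.

Let T0_ge0 : 0 <= T0.
Proof.
have cb0 := dev_const_gt0 N0 hCs.
have a1 := aR_gt0 al (n - l); have a2 := aR_gt0 (al + 1) L; have a3 := aR_gt0 (al + 1) N.
have a4 := aR_gt0 (1 + ga) 3; have a5 := aR_gt0 ga L; have a6 := aR_gt0 ga l.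
have i1 : 0 < / aR al (n - l) by apply: Rinv_0_lt_compat.
have i2 : 0 < / aR (al + 1) N by apply: Rinv_0_lt_compat.
have i3 : 0 < / aR ga l by apply: Rinv_0_lt_compat.
by rewrite /T0 /Rdiv; repeat apply: Rmult_le_pos; lra.
Qed.

Lemma second_large xi (r := second y xi) : isE n xi -> xi y = (n - l)%N ->
  (l <= L * xi r)%N /\ (3 <= xi r)%N.
Proof.
move=> hE hy; have := others_le HL y hE; rewrite -/r hy => h.
have h1 : (l <= L.-1 * xi r)%N by apply: leq_trans h; lia.
have h2 : (l <= L * xi r)%N.
  by apply: leq_trans h1 _; rewrite leq_mul2r leq_pred orbT.
split=> //; have : (L * 3 <= L * xi r)%N by rewrite mulnC; exact: leq_trans h2.
by rewrite leq_mul2l => /orP[/eqP L0|//]; lia.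
Qed.

(** As in [rest_weight_tie], with one more gain: [P] leaves out the site [r], which holds at least
    [l / L] particles, and its weight supplies the vanishing factor [1 / a_ga(l)] of [T0]. *)
Lemma flux_tie xi (r := second y xi) t : isE n xi -> xi y = (n - l)%N ->
  t != y -> t != r -> (xi r <= xi t + 1)%N ->
  weight al xi * Rabs (D xi) <= T0 * P ga r xi.
Proof.
move=> hE hy ty tr ht; have [ry _] := secondP HL y xi; rewrite -/r in ry.
have [hr1 hr3] := second_large hE hy; rewrite -/r in hr1 hr3.
have l1 : (l.+1 <= L * xi r)%N.
  have := others_le HL y hE; rewrite -/r hy => h.
  have e : (L * xi r = L.-1 * xi r + xi r)%N by rewrite -{1}(ltn_predK HL) mulSn addnC.
  by rewrite e; apply: leq_trans (_ : l + xi r <= _)%N; [lia|rewrite leq_add2r; lia].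
have w0 := weight_gt0 al xi; have cb0 := dev_const_gt0 N0 hCs.
have a3 := aR_gt0 (al + 1) N; have a1 := aR_gt0 al (n - l); have a2 := aR_gt0 (al + 1) L.
have a4 := aR_gt0 (1 + ga) 3; have a5 := aR_gt0 ga L; have a6 := aR_gt0 ga l.
have a7 := aR_gt0 (al + 1) (xi r); have a8 := aR_gt0 ga (xi r).
have i1 : 0 < / aR al (n - l) by apply: Rinv_0_lt_compat.
have i2 : 0 < / aR (al + 1) N by apply: Rinv_0_lt_compat.
have i3 : 0 < / aR ga l by apply: Rinv_0_lt_compat.
have b1 : aR (al + 1) l.+1 <= aR (al + 1) L * aR (al + 1) (xi r).
  by rewrite -aR_muln; [apply: aR_mono => //; lra|lia|lia].
have b2 : aR ga l <= aR ga L * aR ga (xi r).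
  by rewrite -aR_muln; [apply: aR_mono => //; lra|lia|lia].
have b3 : / aR ga (xi r) <= aR ga L / aR ga l.
  apply: (Rmult_le_reg_r (aR ga l * aR ga (xi r))); first exact: Rmult_lt_0_compat.
  have -> : / aR ga (xi r) * (aR ga l * aR ga (xi r)) = aR ga l by field; lra.
  by have -> : aR ga L / aR ga l * (aR ga l * aR ga (xi r)) = aR ga L * aR ga (xi r) by field; lra.
have ht0 : (0 < xi t)%N by lia.
have hrt : (0 < xi r <= 3 * xi t)%N by lia.
have tie := @rest_weight_tie L al ga ga1 gaal y r t xi ry ty tr ht0 hrt.
have p0 := rest_weight_gt0 al y xi; have P0 := P_ge0 ga r xi.
apply: Rle_trans (Rmult_le_compat_l _ _ _ (Rlt_le _ _ w0) (flux_abs hE hy)) _.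
rewrite (weight_rest al y) hy.
set c := / aR al (n - l) * (2 * dev_const al Cs) * / aR (al + 1) N.
have c0 : 0 <= c by rewrite /c; repeat apply: Rmult_le_pos; lra.
have -> : / aR al (n - l) * rest_weight al y xi * (2 * dev_const al Cs * (aR (al + 1) l.+1 / aR (al + 1) N)) =
  c * (aR (al + 1) l.+1 * rest_weight al y xi) by rewrite /c; field; lra.
have -> : T0 * P ga r xi = c * (aR (al + 1) L * (aR (1 + ga) 3 * (aR ga L / aR ga l * P ga r xi))).
  by rewrite /T0 /c; field; lra.
apply: Rmult_le_compat_l => //.
apply: Rle_trans (_ : aR (al + 1) L * (aR (al + 1) (xi r) * rest_weight al y xi) <= _).
  by rewrite -Rmult_assoc; apply: Rmult_le_compat_r; lra.
apply: Rmult_le_compat_l; first lra.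
apply: Rle_trans tie _; apply: Rmult_le_compat_l; first lra.
by rewrite (rest_weightE ga _ ry); apply: Rmult_le_compat_r.
Qed.

Let b xi := indR (xi y == (n - l)%N).
Definition flux : R := \sum_(xi <- enumE L n) (b xi * (weight al xi * D xi)).

Let clearOrTie xi (r := second y xi) :
  (forall z, z != y -> z != r -> (xi z + 2 <= xi r)%N) \/
  (exists t, [/\ t != y, t != r & (xi r <= xi t + 1)%N]).
Proof.
have [/forallP h|] := boolP [forall z, (z != y) && (z != r) ==> (xi z + 2 <= xi r)%N].
  by left=> z zy zr; have := h z; rewrite zy zr.
rewrite negb_forall => /existsP[t]; rewrite negb_imply -ltnNge => /andP[/andP[ty tr] h].
by right; exists t; split=> //; lia.
Qed.

(** Summed over every [r], because the second site depends on [xi] whereas [fixed_sum_le] needs a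
    fixed [r]. *)
Let tieSum xi := T0 * \sum_(r < L | r != y) P ga r xi.

Let tie_le xi r : r != y -> T0 * P ga r xi <= tieSum xi.
Proof.
move=> ry; apply: Rmult_le_compat_l => //.
by apply: (@sumR_term _ (fun r => r != y) (fun r => P ga r xi)) => // q _; exact: P_ge0.
Qed.

Let tieSum_ge0 xi : 0 <= tieSum xi.
Proof. by apply: Rmult_le_pos => //; apply: sumR_ge0 => r _; exact: P_ge0. Qed.

Let Zs1 : 1 <= Zeta. Proof. exact: (Zeta_ge1 hZ). Qed.

Let P_sum s r B : r != y -> (forall k, \sum_(i < k) / aR s i <= B) ->
  \sum_(xi <- enumE L n) (b xi * P s r xi) <= B ^ (L - 2).
Proof.
move=> ry hB; rewrite eq_sym in ry.
by apply: (@fixed_sum_le L n y r (n - l) (fun _ i => / aR s i) ry) => // z i; exact: invaR_ge0.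
Qed.

Let tie_total : \sum_(xi <- enumE L n) (b xi * tieSum xi) <= T0 * (INR L * Zeta ^ (L - 2)).
Proof.
rewrite (eq_bigr (fun xi => T0 * \sum_(r < L | r != y) (b xi * P ga r xi))) => [|xi _]; last first.
  by rewrite /tieSum -sumR_mull Rmult_comm Rmult_assoc [_ * b xi]Rmult_comm.
rewrite -sumR_mull; apply: Rmult_le_compat_l => //.
have z0 : 0 <= Zeta ^ (L - 2) by apply: pow_le; lra.
rewrite exchange_big; apply: Rle_trans (_ : \sum_(r < L | r != y) Zeta ^ (L - 2) <= _).
  by apply: sumR_le => r ry; apply: P_sum => //; exact: (psum_le_lim (invaR_ge0 ga) hZ).
rewrite sumR_const; apply: Rmult_le_compat_r => //.
by apply: INR_le; rewrite -[X in (_ <= X)%N]card_ord max_card.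
Qed.

Let notA_neq r : r \notin A -> r != y.
Proof. by apply: contraNneq => ->. Qed.

Let card_notin : (#|A| + #|[pred r | r \notin A]| = L)%N.
Proof. exact: etrans (cardC A) (card_ord L). Qed.

Let nrm_inv : 0 < / phi_total al N.
Proof. by apply: Rinv_0_lt_compat; exact: phi_total_gt0. Qed.

(** A clear background is charged to its own second site, if that is outside [A], and a tied one to
    [tieSum]. As all charges are nonnegative, the sum may then run over every [r] outside [A]
    independently. *)
Lemma flux_upper :
  flux <= INR (L - #|A|) * (/ phi_total al N * (rho * (Gam ^ (L - 2) + C1 * (INR L / INR l) * Zeta ^ (L - 2))))
          + T0 * (INR L * Zeta ^ (L - 2)).
Proof.
have rho0 : 0 < rho by apply: Rdiv_lt_0_compat; exact: aR_gt0.
have lp : 0 < INR l by have := @INR_ge1 l ltac:(lia); lra.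
have c2 : 0 <= C1 * (INR L / INR l).
  apply: Rmult_le_pos.
    by repeat apply: Rmult_le_pos => //; [apply: Rlt_le; exact: exp_pos|exact: pos_INR].
  by apply: Rmult_le_pos; [exact: pos_INR|apply: Rlt_le; apply: Rinv_0_lt_compat].
set c := C1 * _ in c2 *.
pose Q r xi := P al r xi + c * P ga r xi.
have Q0 r xi : 0 <= Q r xi.
  by have := P_ge0 al r xi; have := Rmult_le_pos _ _ c2 (P_ge0 ga r xi); rewrite /Q; lra.
apply: Rle_trans (_ : \sum_(xi <- enumE L n) (\sum_(r | r \notin A) (/ phi_total al N * (rho * (b xi * Q r xi)))
    + b xi * tieSum xi) <= _).
  apply: sumR_le_mem => xi; rewrite mem_enumE => hE _.
  rewrite /b; case: eqP => hy; rewrite [indR _]/=; last first.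
    rewrite !Rmult_0_l big1 => [|r _]; first lra.
    by rewrite Rmult_0_l !Rmult_0_r.
  rewrite !Rmult_1_l; have w0 := weight_gt0 al xi.
  have S0 : 0 <= \sum_(r | r \notin A) (/ phi_total al N * (rho * (1 * Q r xi))).
    apply: sumR_ge0 => r _; rewrite Rmult_1_l.
    by apply: Rmult_le_pos; [lra|apply: Rmult_le_pos; [lra|]].
  have t0 := tieSum_ge0 xi.
  have [ry _] := secondP HL y xi; set r := second y xi in ry.
  have [hr1 hr3] := second_large hE hy; rewrite -/r in hr1 hr3.
  case: (clearOrTie xi) => [hc|[t [ty tr ht]]]; last first.
    have h1 := flux_tie hE hy ty tr ht; have h2 := tie_le xi ry.
    have h3 : weight al xi * D xi <= weight al xi * Rabs (D xi).
      by apply: Rmult_le_compat_l; [lra|exact: Rle_abs].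
    by rewrite -/r in h1; lra.
  rewrite (flux_clear hE hy ry hc); case rA: (r \in A); rewrite [indR _]/=; first lra.
  apply: Rle_trans (_ : / phi_total al N * (rho * (1 * Q r xi)) <= _).
    have := weight_phi_le hE hy ry hr1; rewrite -/c -/(Q r xi) => h.
    have := Rmult_le_compat_l _ _ _ (Rlt_le _ _ nrm_inv) h; lra.
  apply: Rle_trans (_ : \sum_(r | r \notin A) (/ phi_total al N * (rho * (1 * Q r xi))) <= _); last lra.
  apply: (@sumR_term _ (fun r => r \notin A) (fun r => / phi_total al N * (rho * (1 * Q r xi)))).
    by rewrite rA.
  by move=> q _; rewrite Rmult_1_l; apply: Rmult_le_pos; [lra|apply: Rmult_le_pos; [lra|]].
rewrite sumR_add; apply: Rplus_le_compat; last exact: tie_total.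
rewrite exchange_big.
have -> : (L - #|A| = #|[pred r | r \notin A]|)%N.
  by rewrite -[X in (X - _)%N]card_notin addKn.
rewrite -sumR_const; apply: sumR_le => r rA; have ry := notA_neq rA.
rewrite -!sumR_mull; apply: Rmult_le_compat_l; first lra.
apply: Rmult_le_compat_l; first lra.
rewrite (eq_bigr (fun xi => b xi * P al r xi + c * (b xi * P ga r xi))) => [|xi _]; last first.
  by rewrite /Q; ring.
rewrite sumR_add -sumR_mull; apply: Rplus_le_compat; first exact: P_sum.
apply: Rmult_le_compat_l => //; apply: P_sum => //; exact: (psum_le_lim (invaR_ge0 ga) hZ).
Qed.

Let k := (l %/ (2 * L))%N.

(** For a given [r] only backgrounds with at most [k = l %/ (2 * L)] particles on each light site
    are kept. The second site holds at least [l / L] particles, more than [k], so a background is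
    kept for at most one [r], and the truncated sums factorize. *)
Lemma flux_lower :
  INR (L - #|A|) * (/ phi_total al N * (\sum_(i < k.+1) / aR al i) ^ (L - 2))
   - T0 * (INR L * Zeta ^ (L - 2)) <= flux.
Proof.
have kl : (k * (2 * L) <= l)%N by exact: leq_trunc_div.
pose f (z : 'I_L) i := indR (i <= k)%N * / aR al i.
have f0 z i : 0 <= f z i by apply: Rmult_le_pos; [exact: indR_ge0|exact: invaR_ge0].
pose Q r xi := \prod_(z < L | (z != y) && (z != r)) f z (xi z).
have Q_eq0 r xi z : z != y -> z != r -> (k < xi z)%N -> Q r xi = 0.
  move=> zy zr hz; rewrite /Q (prodR_D1 (j := z)) ?zy // /f leqNgt hz /=.
  by rewrite !Rmult_0_l.
have Q_le r xi : Q r xi <= P al r xi.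
  apply: prodR_le => z _; split => //; rewrite /f.
  by have := invaR_ge0 al (xi z); case: (_ <= _)%N; rewrite /indR; lra.
apply: Rle_trans (_ : \sum_(xi <- enumE L n) (\sum_(r | r \notin A) (/ phi_total al N * (b xi * Q r xi))
    - b xi * tieSum xi) <= _); last first.
  apply: sumR_le_mem => xi; rewrite mem_enumE => hE _.
  rewrite /b; case: eqP => hy; rewrite [indR _]/=; last first.
    rewrite !Rmult_0_l big1 => [|r _]; first lra.
    by rewrite Rmult_0_l !Rmult_0_r.
  rewrite !Rmult_1_l; have w0 := weight_gt0 al xi; have t0 := tieSum_ge0 xi.
  have [ry _] := secondP HL y xi; set r := second y xi in ry.
  have [hr1 hr3] := second_large hE hy; rewrite -/r in hr1 hr3.
  have kr : (k < xi r)%N.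
    suff : (2 * k <= xi r)%N by apply: half_lt; exact: leq_trans hr3.
    by rewrite -(@leq_pmul2l L); [apply: leq_trans hr1; apply: leq_trans kl; lia|lia].
  have Qother q : q != r -> Q q xi = 0.
    by move=> qr; apply: (Q_eq0 q xi r) => //; rewrite eq_sym.
  case: (clearOrTie xi) => [hc|[t [ty tr ht]]].
    rewrite (flux_clear hE hy ry hc).
    apply: Rle_trans (_ : \sum_(q | q \notin A) (/ phi_total al N * (1 * Q q xi)) <= _); first lra.
    case rA: (r \in A); rewrite [indR _]/=.
      rewrite big1; first lra.
      move=> q qA; rewrite Qother; first lra.
      by apply: contraNneq qA => ->; rewrite rA.
    rewrite (sumR_D1 (j := r)) ?rA // big1 => [|q /andP[_ qr]]; last by rewrite Qother //; lra.
    have h1 := weight_phi_ge hE hy ry; have h2 := Q_le r xi.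
    have : / phi_total al N * Q r xi <= / phi_total al N * (weight al xi * phi al N (mass r y xi)).
      by apply: Rmult_le_compat_l; lra.
    lra.
  (* The truncation removes all ties: with light sites of at most [k] particles, a tie would leave
     fewer than [l] particles off [y]. *)
  have Qr : Q r xi = 0.
    have [/forallP h|] := boolP [forall z, (z != y) && (z != r) ==> (xi z <= k)%N]; last first.
      rewrite negb_forall => /existsP[z]; rewrite negb_imply -ltnNge => /andP[/andP[zy zr] hz].
      exact: Q_eq0 hz.
    exfalso; have tk : (xi t <= k)%N by have := h t; rewrite ty tr.
    have := sum_others2 ry hE; rewrite hy.
    have : (\sum_(z < L | (z != y) && (z != r)) xi z <= (L - 2) * k)%N.
      apply: leq_trans (_ : \sum_(z < L | (z != y) && (z != r)) k <= _)%N.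
        by apply: leq_sum => z hz; have := h z; rewrite hz.
      rewrite sum_nat_const leq_mul2r.
      by rewrite -(@card_others L y r) ?leqnn ?orbT // eq_sym.
    have -> : (n - (n - l) = l)%N by rewrite subKn //; lia.
    by move=> hS hl; exact: (tie_arith ht tk hS hl kl HL hl3).
  rewrite big1 => [|q qA]; last first.
    by case: (eqVneq q r) => [->|qr]; rewrite ?Qr ?Qother //; lra.
  have h1 := flux_tie hE hy ty tr ht; have h2 := tie_le xi ry; rewrite -/r in h1.
  have h3 : weight al xi * - D xi <= weight al xi * Rabs (D xi).
    by apply: Rmult_le_compat_l; [lra|rewrite -Rabs_Ropp; exact: Rle_abs].
  lra.
rewrite sumR_sub; apply: Rplus_le_compat; last by apply: Ropp_le_contravar; exact: tie_total.
rewrite exchange_big.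
have -> : (L - #|A| = #|[pred r | r \notin A]|)%N.
  by rewrite -[X in (X - _)%N]card_notin addKn.
rewrite -sumR_const; apply: sumR_le => r rA; have ry := notA_neq rA.
rewrite -sumR_mull; apply: Rmult_le_compat_l; first lra.
have yr : y != r by rewrite eq_sym.
apply: Req_le; symmetry; apply: (@fixed_sum_eq L n y r (n - l) f yr k) => //.
- by move=> z i ki; rewrite /f leqNgt ki /= Rmult_0_l.
- by nia.
move=> z; rewrite /f.
have kn : (k.+1 <= n.+1)%N by nia.
rewrite -(subnKC kn).
have := @big_split_ord R 0 Rplus k.+1 (n.+1 - k.+1) xpredT (fun i => indR (i <= k)%N * / aR al i).
move=> -> /=; rewrite [X in Rplus _ X]big1 => [|i _]; last first.
  by rewrite (_ : (k.+1 + i <= k)%N = false) ?Rmult_0_l //; lia.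
rewrite Rplus_0_r; apply: eq_bigr => i _.
by rewrite (_ : (i <= k)%N = true) /= ?Rmult_1_l //; have := ltn_ord i.
Qed.

End FluxBounds.

(** * Asymptotics of the normalizations *)

Section PartitionFunction.
Variables (L : nat) (x0 : 'I_L) (al ga : R) (N : nat) (Zeta Gam : R).
Hypotheses (HL : (2 <= L)%N) (N0 : (0 < N)%N).
Hypotheses (ga1 : 1 < ga) (ga2 : ga <= 2) (gaal : 2 * ga + 1 <= al).
Hypothesis hZ : is_lim_seq (fun k => \sum_(i < k) / aR ga i) Zeta.
Hypothesis hGam : forall k, \sum_(i < k) / aR al i <= Gam.
Implicit Types (eta xi : conf L) (x y z p r t : 'I_L).

Let al0 : 0 <= al. Proof. lra. Qed.

Let card1 p : #|[pred z : 'I_L | z != p]| = L.-1.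
Proof. by rewrite (cardC1 p) card_ord. Qed.

Let rest_weight_sum s p B : (forall k, \sum_(i < k) / aR s i <= B) ->
  \sum_(eta <- enumE L N) rest_weight s p eta <= B ^ L.-1.
Proof.
move=> hB; have h0 (z : 'I_L) i : 0 <= / aR s i by exact: invaR_ge0.
apply: Rle_trans (@sum_prod_le L N p (fun _ i => / aR s i) h0) _.
rewrite -(card1 p) -prodR_const; apply: prodR_le => z _; split => //.
by apply: sumR_ge0 => i _; exact: invaR_ge0.
Qed.

Let C1 := al * exp (al * INR L) * INR L.

(** Each configuration is charged to its largest site [p], which holds at least [N / L] particles.
    Replacing [a(eta p)] by [a(N)] costs an error proportional to the particles off [p], absorbed by
    their weights at the price of [ga]. *)
Lemma WN_upper :
  aR al N * WN al L N <= INR L * (Gam ^ L.-1 + C1 * (INR L / INR N) * Zeta ^ L.-1).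
Proof.
have Np : 0 < INR N by have := INR_ge1 N0; lra.
have c2 : 0 <= C1 * (INR L / INR N).
  apply: Rmult_le_pos.
    by repeat apply: Rmult_le_pos => //; [apply: Rlt_le; exact: exp_pos|exact: pos_INR].
  by apply: Rmult_le_pos; [exact: pos_INR|apply: Rlt_le; apply: Rinv_0_lt_compat].
set c := C1 * _ in c2 *; have aN := aR_gt0 al N.
rewrite /WN sumE_enumE sumR_mull.
apply: Rle_trans (_ : \sum_(eta <- enumE L N) \sum_(p < L) (rest_weight al p eta + c * rest_weight ga p eta) <= _).
  apply: sumR_le_mem => eta; rewrite mem_enumE => hE _.
  set p := largest x0 eta; have hp := largest_ge x0 hE; rewrite -/p in hp.
  have pN := isE_le p hE.
  have p0 : (0 < eta p)%N by case: (posnP (eta p)) hp => // ->; rewrite muln0; lia.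
  have ap := aR_gt0 al (eta p); have pw0 := rest_weight_gt0 al p eta.
  apply: Rle_trans (_ : rest_weight al p eta + c * rest_weight ga p eta <= _); last first.
    apply: (@sumR_term _ predT (fun p => rest_weight al p eta + c * rest_weight ga p eta)) => // q _.
    have := rest_weight_gt0 al q eta; have := Rmult_le_pos _ _ c2 (Rlt_le _ _ (rest_weight_gt0 ga q eta)); lra.
  have q := @aR_quot_le al (INR L) (eta p) N al0 p0 pN.
  have {}q := q ltac:(rewrite -INR_muln; exact: INR_le); rewrite -/C1 in q.
  have kP : INR (N - eta p) * rest_weight al p eta <= INR L * rest_weight ga p eta.
    rewrite (sum_others p hE) INR_sum sumR_mulr.
    apply: Rle_trans (_ : \sum_(z < L | z != p) rest_weight ga p eta <= _).
      by apply: sumR_le => z hz; exact: (@prod_others_le L al ga ga1 gaal (fun z => z != p)).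
    rewrite sumR_const; apply: Rmult_le_compat_r; first by apply: Rlt_le; exact: rest_weight_gt0.
    by apply: INR_le; rewrite card1 leq_pred.
  rewrite (weight_rest al p).
  have -> : aR al N * (/ aR al (eta p) * rest_weight al p eta) = aR al N / aR al (eta p) * rest_weight al p eta.
    by field; lra.
  apply: Rle_trans (Rmult_le_compat_r _ _ _ (Rlt_le _ _ pw0) q) _.
  rewrite Rmult_plus_distr_r Rmult_1_l; apply: Rplus_le_compat_l.
  have -> : C1 * (INR (N - eta p) / INR N) * rest_weight al p eta =
     C1 / INR N * (INR (N - eta p) * rest_weight al p eta) by field; lra.
  have -> : c * rest_weight ga p eta = C1 / INR N * (INR L * rest_weight ga p eta) by rewrite /c; field; lra.
  apply: Rmult_le_compat_l => //; apply: Rmult_le_pos.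
    by repeat apply: Rmult_le_pos => //; [apply: Rlt_le; exact: exp_pos|exact: pos_INR].
  by apply: Rlt_le; apply: Rinv_0_lt_compat.
rewrite exchange_big -sumR_const_ord; apply: sumR_le => p _.
rewrite sumR_add -sumR_mull; apply: Rplus_le_compat; first exact: rest_weight_sum.
by apply: Rmult_le_compat_l => //; apply: rest_weight_sum; exact: (psum_le_lim (invaR_ge0 ga) hZ).
Qed.

Let k := (N %/ (2 * L))%N.

(** Sites other than [p] are truncated at [N %/ (2 * L)], below the largest occupation number, so a
    configuration counts for at most one [p]. *)
Lemma WN_lower : INR L * (\sum_(i < k.+1) / aR al i) ^ L.-1 <= aR al N * WN al L N.
Proof.
have kl : (k * (2 * L) <= N)%N by exact: leq_trunc_div.
pose f (z : 'I_L) i := indR (i <= k)%N * / aR al i.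
have f0 z i : 0 <= f z i by apply: Rmult_le_pos; [exact: indR_ge0|exact: invaR_ge0].
have aN := aR_gt0 al N.
pose Q p eta := \prod_(z < L | z != p) f z (eta z).
have Q_le p eta : Q p eta <= rest_weight al p eta.
  apply: prodR_le => z _; split => //; rewrite /f.
  by have := invaR_ge0 al (eta z); case: (_ <= _)%N; rewrite /indR; lra.
apply: Rle_trans (_ : \sum_(eta <- enumE L N) \sum_(p < L) Q p eta <= _); last first.
  rewrite /WN sumE_enumE sumR_mull; apply: sumR_le_mem => eta; rewrite mem_enumE => hE _.
  set p := largest x0 eta; have hp := largest_ge x0 hE; rewrite -/p in hp.
  have pN := isE_le p hE.
  have p0 : (0 < eta p)%N by case: (posnP (eta p)) hp => // ->; rewrite muln0; lia.
  have kp : (k < eta p)%N.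
    suff : (2 * k <= eta p)%N by exact: half_lt.
    by rewrite -(@leq_pmul2l L); [apply: leq_trans hp; apply: leq_trans kl; lia|lia].
  rewrite (sumR_D1 (j := p)) // big1 => [|q qp]; last first.
    by rewrite /Q (prodR_D1 (j := p)) 1?eq_sym // /f leqNgt kp /= !Rmult_0_l.
  rewrite Rplus_0_r (weight_rest al p); apply: Rle_trans (Q_le _ _) _.
  have ap := aR_gt0 al (eta p); have pw0 := rest_weight_gt0 al p eta.
  have -> : aR al N * (/ aR al (eta p) * rest_weight al p eta) = aR al N / aR al (eta p) * rest_weight al p eta.
    by field; lra.
  rewrite -[X in X <= _]Rmult_1_l; apply: Rmult_le_compat_r; first lra.
  apply: (Rmult_le_reg_r (aR al (eta p))) => //.
  rewrite /Rdiv Rmult_assoc Rinv_l ?Rmult_1_r ?Rmult_1_l; last lra.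
  exact: aR_mono.
rewrite exchange_big -sumR_const_ord; apply: sumR_le => p _; apply: Req_le.
rewrite (@sum_prod_eq L N p f (fun=> k)); first last.
- by rewrite sum_nat_const card1; apply: leq_trans kl; rewrite mulnC leq_mul2l; lia.
- by move=> z i ki; rewrite /f leqNgt ki /= Rmult_0_l.
rewrite -(card1 p) -prodR_const; apply: eq_bigr => z _; rewrite /f.
have kn : (k.+1 <= N.+1)%N by rewrite ltnS leq_div.
rewrite -(subnKC kn).
have := @big_split_ord R 0 Rplus k.+1 (N.+1 - k.+1) xpredT (fun i => indR (i <= k)%N * / aR al i).
move=> -> /=; rewrite [X in Rplus _ X]big1 => [|i _]; last first.
  by rewrite (_ : (k.+1 + i <= k)%N = false) ?Rmult_0_l //; lia.
rewrite Rplus_0_r; apply: eq_bigr => i _.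
by rewrite (_ : (i <= k)%N = true) /= ?Rmult_1_l //; have := ltn_ord i.
Qed.

End PartitionFunction.

(** * Riemann sums for the integral and the total of [phi] *)

Section RiemannSums.
Variable al : R.
Hypothesis al0 : 0 < al.

Lemma rpow_ge0 u : 0 <= rpow u al.
Proof. by rewrite /rpow; case: (Rle_dec u 0) => ? /=; [lra|apply: Rlt_le; exact: exp_pos]. Qed.

Lemma rpow_mono u v : u <= v -> rpow u al <= rpow v al.
Proof.
move=> uv; rewrite /rpow; case: (Rle_dec u 0) => u0; case: (Rle_dec v 0) => v0 /=; try lra.
  by apply: Rlt_le; exact: exp_pos.
by apply: Rle_Rpower_l; lra.
Qed.

Lemma rpow1 : rpow 1 al = 1.
Proof. by rewrite /rpow; case: (Rle_dec 1 0) => ? /=; [lra|rewrite /Rpower ln_1 Rmult_0_r exp_0]. Qed.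

Lemma rpow_le1 u : u <= 1 -> rpow u al <= 1.
Proof. by move=> /rpow_mono; have := rpow1; lra. Qed.

Lemma rpow0 : rpow 0 al = 0.
Proof. by rewrite /rpow; case: (Rle_dec 0 0) => ? //=; lra. Qed.

Variable (pr : Riemann_integrable (fun u => rpow u al * rpow (1 - u) al) 0 1).
Let f u := rpow u al * rpow (1 - u) al.

Let exI a b : 0 <= a <= b -> b <= 1 -> ex_RInt f a b.
Proof.
move=> hab b1; have e01 : ex_RInt f 0 1 by exact: ex_RInt_Reals_1.
by apply: (@ex_RInt_Chasles_1 _ f a b 1); [lra|apply: (@ex_RInt_Chasles_2 _ f 0 a 1) => //; lra].
Qed.

Lemma RInt_piece a b : 0 <= a <= b -> b <= 1 ->
  (b - a) * (rpow a al * rpow (1 - b) al) <= RInt f a b <=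
  (b - a) * (rpow b al * rpow (1 - a) al).
Proof.
move=> hab b1; have e := exI hab b1.
have c v : RInt (fun=> v) a b = (b - a) * v by rewrite RInt_const.
rewrite -!c; split; apply: RInt_le => //; try lra; try exact: ex_RInt_const.
  move=> u hu; apply: Rmult_le_compat; try exact: rpow_ge0; apply: rpow_mono; lra.
move=> u hu; apply: Rmult_le_compat; try exact: rpow_ge0; apply: rpow_mono; lra.
Qed.

Variable N : nat.
Hypothesis N0 : (0 < N)%N.

Let t (j : nat) := INR j / INR N.
(** Each factor is taken at the end of the cell where it is smaller, since their product is not
    monotone. These end points also match [a(j) a(N-1-j) = N^(2 al) (j/N)^al (1 - (j+1)/N)^al]. *)
Definition lowsum := \sum_(j < N) (rpow (t j) al * rpow (1 - t j.+1) al).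

Let Np : 0 < INR N. Proof. by have := INR_ge1 N0; lra. Qed.
Let Ni : 0 < / INR N. Proof. exact: Rinv_0_lt_compat. Qed.
Let tS j : t j.+1 = t j + / INR N.
Proof. by rewrite /t S_INR; field; lra. Qed.
Let t_ge0 j : 0 <= t j. Proof. by apply: Rmult_le_pos; [exact: pos_INR|lra]. Qed.
Let t_le1 j : (j <= N)%N -> t j <= 1.
Proof.
move=> jN; apply: (Rmult_le_reg_r (INR N)) => //.
by rewrite /t /Rdiv Rmult_assoc Rinv_l ?Rmult_1_r ?Rmult_1_l; [exact: INR_le|lra].
Qed.
Let t0 : t 0 = 0. Proof. by rewrite /t /INR /Rdiv Rmult_0_l. Qed.
Let tN : t N = 1. Proof. by rewrite /t; field; lra. Qed.

Let partial m : (m <= N)%N ->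
  / INR N * \sum_(j < m) (rpow (t j) al * rpow (1 - t j.+1) al) <= RInt f 0 (t m) <=
  / INR N * \sum_(j < m) (rpow (t j.+1) al * rpow (1 - t j) al).
Proof.
elim: m => [|m IH] hm; first by rewrite !big_ord0 t0 RInt_point /zero /=; lra.
have e1 : ex_RInt f 0 (t m).
  by apply: exI; [have := t_ge0 m; lra|apply: t_le1; lia].
have tt : 0 <= t m <= t m.+1 by rewrite tS; have := t_ge0 m; lra.
have e2 : ex_RInt f (t m) (t m.+1) by apply: exI => //; exact: t_le1.
rewrite -(RInt_Chasles f 0 (t m) (t m.+1) e1 e2) /plus /= !big_ord_recr /=.
have := RInt_piece tt (t_le1 hm); have := IH (ltnW hm).
have -> : t m.+1 - t m = / INR N by rewrite tS; ring.
by rewrite !Rmult_plus_distr_l => -[h1 h2] [h3 h4]; split; apply: Rplus_le_compat.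
Qed.

Lemma riemann_bounds :
  / INR N * lowsum <= RiemannInt pr <= / INR N * lowsum + 2 / INR N.
Proof.
have e : RInt f 0 1 = RiemannInt pr by exact: RInt_Reals.
have := partial (leqnn N); rewrite tN e -/lowsum => -[h1 h2]; split=> //.
apply: Rle_trans h2 _.
have -> : / INR N * lowsum + 2 / INR N = / INR N * (lowsum + 2) by field; lra.
apply: Rmult_le_compat_l; first lra.
(* Both factors are monotone, so the gap between the upper and lower sums telescopes. *)
have up m : (m <= N)%N -> \sum_(j < m) (rpow (t j.+1) al * rpow (1 - t j) al) <=
   \sum_(j < m) (rpow (t j) al * rpow (1 - t j.+1) al) +
   (rpow (t m) al + 1 - rpow (1 - t m) al).
  elim: m => [|m IH] hm.
    by rewrite !big_ord0 t0 Rminus_0_r rpow0 rpow1; lra.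
  rewrite !big_ord_recr /=.
  have m1 := t_le1 hm; have m0 := t_ge0 m; have ts := tS m.
  have a1 : rpow (t m) al <= rpow (t m.+1) al by apply: rpow_mono; lra.
  have a2 : rpow (1 - t m.+1) al <= rpow (1 - t m) al by apply: rpow_mono; lra.
  have a3 : rpow (t m) al <= 1 by apply: rpow_le1; lra.
  have a4 : rpow (1 - t m) al <= 1 by apply: rpow_le1; lra.
  have a5 := rpow_ge0 (t m); have a6 := rpow_ge0 (1 - t m.+1).
  move: a1 a2 a3 a4 a5 a6.
  set p := rpow (t m) al; set q := rpow (t m.+1) al.
  set p' := rpow (1 - t m) al; set q' := rpow (1 - t m.+1) al.
  move=> a1 a2 a3 a4 a5 a6.
  have : q * p' - p * q' <= (q - p) + (p' - q').
    have -> : q * p' - p * q' = (q - p) * p' + p * (p' - q') by ring.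
    have : (q - p) * p' <= (q - p) * 1 by apply: Rmult_le_compat_l; lra.
    have : p * (p' - q') <= 1 * (p' - q') by apply: Rmult_le_compat_r; lra.
    lra.
  move: (IH (ltnW hm)); set S1 := \sum_(j < m) _; set S2 := \sum_(j < m) _ => k1 k2; rewrite -/p -/p' in k1.
  change (S1 + q * p' <= S2 + p * q' + (q + 1 - q')); lra.
apply: Rle_trans (up N (leqnn N)) _.
have -> : t N = 1 := tN.
by rewrite Rminus_diag rpow0 rpow1 /lowsum; lra.
Qed.

(** The identity with [lowsum] is exact except for [j = 0] and [j = N - 1], because [aR al 0] is [1]
    while [rpow 0 al] is [0]; the term [3 * aR al N] covers these two. *)
Lemma phi_total_bounds :
  aR (2 * al) N * lowsum <= phi_total al N <= aR (2 * al) N * lowsum + 3 * aR al N.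
Proof.
have aN := aR_gt0 al N.
have e j : aR al j = aR al N * rpow (t j) al + indR (j == 0)%N.
  case: j => [|j]; first by rewrite t0 rpow0 /=; ring.
  have jp : 0 < INR j.+1 by have := @INR_ge1 j.+1 isT; lra.
  have tp : 0 < t j.+1 by apply: Rdiv_lt_0_compat.
  rewrite /rpow; case: (Rle_dec (t j.+1) 0) => ? /=; first lra.
  rewrite Rplus_0_r !aRE // Rpower_mult_distr //.
  by congr Rpower; rewrite /t; field; lra.
have e2 j : (j < N)%N -> t (N.-1 - j) = 1 - t j.+1.
  move=> jN; rewrite /t -[X in X - _](Rinv_r (INR N)); last lra.
  rewrite (_ : (N.-1 - j = N - j.+1)%N); last by lia.
  by rewrite INR_subn //; field; lra.
have eq j : (j < N)%N -> phi al N j = aR (2 * al) N * (rpow (t j) al * rpow (1 - t j.+1) al) +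
   (indR (j == 0)%N * aR al (N.-1 - j) + indR (N.-1 - j == 0)%N * (aR al N * rpow (t j) al)).
  move=> jN; have E := e (N.-1 - j)%N; rewrite e2 // in E.
  rewrite /phi (e j) E (_ : 2 * al = al + al) ?aRD; last ring.
  ring.
rewrite /phi_total (eq_bigr (fun j : 'I_N => aR (2 * al) N * (rpow (t j) al * rpow (1 - t j.+1) al) +
   (indR (j == 0 :> nat)%N * aR al (N.-1 - j) + indR (N.-1 - j == 0)%N * (aR al N * rpow (t j) al))));
  last by move=> j _; exact: eq.
rewrite sumR_add -sumR_mull -/lowsum.
set X := aR (2 * al) N * lowsum.
suff h : 0 <= \sum_(j < N) (indR (j == 0 :> nat)%N * aR al (N.-1 - j) +
   indR (N.-1 - j == 0)%N * (aR al N * rpow (t j) al)) <= 3 * aR al N.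
  case: h => h1 h2; split; last exact: Rplus_le_compat_l.
  by rewrite -[Y in Y <= _]Rplus_0_r; exact: Rplus_le_compat_l.
split.
  apply: sumR_ge0 => j _; apply: Rplus_le_le_0_compat; apply: Rmult_le_pos; try exact: indR_ge0.
    by apply: Rlt_le; exact: aR_gt0.
  by apply: Rmult_le_pos; [lra|exact: rpow_ge0].
rewrite sumR_add.
have -> : 3 * aR al N = aR al N + 2 * aR al N by ring.
have ltN : (N.-1 < N)%N by lia.
apply: Rplus_le_compat.
  rewrite (sumR_D1 (j := Ordinal N0)) // big1 => [|j /eqP j0]; last first.
    case: eqP => [e0|_]; last by rewrite /indR; ring.
    by case: j0; apply: val_inj.
  rewrite Rplus_0_r /= Rmult_1_l; apply: aR_mono; [lra|lia].
rewrite (sumR_D1 (j := Ordinal ltN)) // big1 => [|j /eqP j0]; last first.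
  case: eqP => [e0|_]; last by rewrite /indR; ring.
  by case: j0; apply: val_inj => /=; have := ltn_ord j; lia.
rewrite Rplus_0_r /= subnn /= Rmult_1_l.
have : rpow (t N.-1) al <= 1.
  by apply: rpow_le1; apply: t_le1; lia.
have := rpow_ge0 (t N.-1); nra.
Qed.

End RiemannSums.

(** * The limit *)

Definition tendsto (f : nat -> nat) := forall M, eventually (fun n => (M <= f n)%N).

Lemma is_lim_seq_comp (u : nat -> R) (l : Rbar) f :
  tendsto f -> is_lim_seq u l -> is_lim_seq (fun n => u (f n)) l.
Proof.
move=> hf hu; apply: (filterlim_comp _ _ _ f u eventually eventually) hu.
move=> P [M hM]; have [n0 h0] := hf M; exists n0 => n hn.
by apply: hM; have := h0 n hn; lia.
Qed.

Lemma tendsto_le f g : (forall n, (f n <= g n)%N) -> tendsto f -> tendsto g.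
Proof.
move=> fg hf M; have [n0 h0] := hf M; exists n0 => n hn.
exact: leq_trans (h0 n hn) (fg n).
Qed.

Lemma tendsto_div d f : (0 < d)%N -> tendsto f -> tendsto (fun n => (f n %/ d)%N).
Proof.
move=> d0 hf M; have [n0 h0] := hf (M * d)%N; exists n0 => n hn.
by rewrite leq_divRL //; exact: h0.
Qed.

Lemma tendsto_S f : tendsto f -> tendsto (fun n => f n.+1).
Proof. by move=> hf M; have [n0 h0] := hf M; exists n0 => n hn; apply: h0; lia. Qed.

Lemma tendsto_succ : tendsto S.
Proof. by move=> M; exists M => n hn; lia. Qed.

Lemma is_lim_seq_powR (u : nat -> R) (l : R) m :
  is_lim_seq u l -> is_lim_seq (fun n => u n ^ m) (l ^ m).
Proof.
move=> h; elim: m => [|m IH] /=; first exact: is_lim_seq_const.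
exact: is_lim_seq_mult'.
Qed.

Lemma is_lim_seq_inv_INR : is_lim_seq (fun n => / INR n) 0.
Proof.
have -> : Rbar.Finite 0 = Rbar_inv p_infty by [].
by apply: is_lim_seq_inv => //; exact: is_lim_seq_INR.
Qed.

Section PowerLimits.
Variables (s Z : R).
Hypothesis hZ : is_lim_seq (fun n => \sum_(i < n) / aR s i) Z.

Lemma invaR_lim : is_lim_seq (fun n => / aR s n) 0.
Proof.
have h := is_lim_seq_minus' _ _ _ _ (proj1 (is_lim_seq_incr_1 _ _) hZ) hZ.
rewrite Rminus_diag in h; apply: is_lim_seq_ext h => n.
by rewrite big_ord_recr /=; ring.
Qed.

Lemma series_tail_lim : is_lim_seq (series_tail s Z) 0.
Proof.
have h := is_lim_seq_minus' _ _ _ _ (is_lim_seq_const Z) hZ.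
by rewrite Rminus_diag in h.
Qed.

End PowerLimits.

Lemma phi_total_lim al (pr : Riemann_integrable (fun u => rpow u al * rpow (1 - u) al) 0 1) :
  0 < al ->
  0 < RiemannInt pr /\
  is_lim_seq (fun n => phi_total al n.+1 / aR (2 * al + 1) n.+1) (RiemannInt pr).
Proof.
move=> al0; set I := RiemannInt pr; split.
  (* Positivity of the integral is read off the lower sum with four cells, whose cell of index 1
     contributes [(1/4)^al (1/2)^al]. *)
  have [h _] := riemann_bounds al0 pr (isT : (0 < 4)%N).
  apply: Rlt_le_trans h; apply: Rmult_lt_0_compat.
    by apply: Rinv_0_lt_compat; have := @INR_ge1 4 isT; lra.
  pose v j := rpow (INR j / INR 4) al * rpow (1 - INR j.+1 / INR 4) al.
  have v0 j : 0 <= v j by apply: Rmult_le_pos; exact: rpow_ge0.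
  apply: Rlt_le_trans (_ : v 1%N <= _); last first.
    exact: (@sumR_term _ predT (fun j : 'I_4 => v j) (Ordinal (isT : (1 < 4)%N))).
  have p u : 0 < u -> 0 < rpow u al.
    by rewrite /rpow => u0; case: (Rle_dec u 0) => ? /=; [lra|exact: exp_pos].
  by apply: Rmult_lt_0_compat; apply: p; rewrite /INR; lra.
have N1 := is_lim_seq_comp tendsto_succ is_lim_seq_inv_INR.
apply: (is_lim_seq_le_le (fun n => I - 2 * / INR n.+1) _ (fun n => I + 3 * / INR n.+1)).
- move=> n; set N := n.+1; have N0 : (0 < N)%N by [].
  have [h1 h2] := riemann_bounds al0 pr N0; have [h3 h4] := phi_total_bounds al0 N0.
  rewrite -/I in h1 h2; have a1 := aR_gt0 (2 * al) N; have a2 := aR_gt0 al N.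
  have Np : 0 < INR N by have := INR_ge1 N0; lra.
  have a3 : aR al N <= aR (2 * al) N by apply: aR_exp_mono; lra.
  rewrite (aRD (2 * al) 1) aR1 //.
  have i1 : 0 < / (aR (2 * al) N * INR N).
    by apply: Rinv_0_lt_compat; exact: Rmult_lt_0_compat.
  have i2 : 0 < / INR N by exact: Rinv_0_lt_compat.
  split.
    apply: Rle_trans (_ : / INR N * lowsum al N <= _); first by move: h2; rewrite /Rdiv; lra.
    have -> : / INR N * lowsum al N = aR (2 * al) N * lowsum al N / (aR (2 * al) N * INR N).
      by field; lra.
    by apply: Rmult_le_compat_r; lra.
  apply: Rle_trans (_ : / INR N * lowsum al N + 3 * / INR N <= _); last lra.
  have -> : / INR N * lowsum al N + 3 * / INR N =
    (aR (2 * al) N * lowsum al N + 3 * aR (2 * al) N) / (aR (2 * al) N * INR N).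
    by field; lra.
  by apply: Rmult_le_compat_r; lra.
- have := is_lim_seq_minus' _ _ _ _ (is_lim_seq_const I)
    (is_lim_seq_mult' _ _ _ _ (is_lim_seq_const 2) N1).
  by rewrite Rmult_0_r Rminus_0_r.
- have := is_lim_seq_plus' _ _ _ _ (is_lim_seq_const I)
    (is_lim_seq_mult' _ _ _ _ (is_lim_seq_const 3) N1).
  by rewrite Rmult_0_r Rplus_0_r.
Qed.

Lemma WN_lim L al ga (Zeta Gam : R) (x0 : 'I_L) : (2 <= L)%N ->
  1 < ga -> ga <= 2 -> 2 * ga + 1 <= al ->
  is_lim_seq (fun k => \sum_(i < k) / aR ga i) Zeta ->
  is_lim_seq (fun k => \sum_(i < k) / aR al i) Gam ->
  is_lim_seq (fun n => aR al n.+1 * WN al L n.+1) (INR L * Gam ^ L.-1).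
Proof.
move=> HL ga1 ga2 gaal hZ hGam.
have hG := psum_le_lim (invaR_ge0 al) hGam.
set C1 := al * exp (al * INR L) * INR L.
apply: (is_lim_seq_le_le
   (fun n => INR L * (\sum_(i < (n.+1 %/ (2 * L)).+1) / aR al i) ^ L.-1) _
   (fun n => INR L * (Gam ^ L.-1 + C1 * (INR L / INR n.+1) * Zeta ^ L.-1))).
- by move=> n; split; [apply: (@WN_lower L x0 al ga)|apply: (@WN_upper L x0 al ga n.+1 Zeta Gam)].
- apply: (is_lim_seq_mult' _ _ _ _ (is_lim_seq_const _)); apply: is_lim_seq_powR.
  apply: (is_lim_seq_comp (u := fun k => \sum_(i < k) / aR al i)
     (f := fun n => (n.+1 %/ (2 * L)).+1)) hGam.
  apply: (@tendsto_le (fun n => (n.+1 %/ (2 * L))%N)); first by move=> n; exact: leqnSn.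
  by apply: tendsto_div tendsto_succ; lia.
- apply: (is_lim_seq_mult' _ _ _ _ (is_lim_seq_const _)).
  rewrite -[X in is_lim_seq _ (Rbar.Finite X)]Rplus_0_r.
  apply: (is_lim_seq_plus' _ _ _ _ (is_lim_seq_const _)).
  rewrite -[X in is_lim_seq _ (Rbar.Finite X)](Rmult_0_l (Zeta ^ L.-1)).
  apply: is_lim_seq_mult' (is_lim_seq_const _).
  rewrite -[X in is_lim_seq _ (Rbar.Finite X)](Rmult_0_r C1).
  apply: (is_lim_seq_mult' _ _ _ _ (is_lim_seq_const _)).
  rewrite -[X in is_lim_seq _ (Rbar.Finite X)](Rmult_0_r (INR L)).
  apply: (is_lim_seq_mult' _ _ _ _ (is_lim_seq_const _)).
  exact: (is_lim_seq_comp tendsto_succ is_lim_seq_inv_INR).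
Qed.

(** The error in [cap_approx] contains the capacity itself; for [2 * e < 1] the inequality can be
    solved for it. *)
Lemma approx_bounds (X Y e E lo up : R) : 0 <= X -> 0 <= e -> 2 * e < 1 ->
  Rabs (Y - X) <= 2 * e * X + E -> lo <= Y <= up ->
  (lo - E) / (1 + 2 * e) <= X <= (up + E) / (1 - 2 * e).
Proof.
move=> X0 e0 e1 /Rabs_le_between h hY; split.
  apply: (Rmult_le_reg_r (1 + 2 * e)); first lra.
  by rewrite /Rdiv Rmult_assoc Rinv_l; lra.
apply: (Rmult_le_reg_r (1 - 2 * e)); first lra.
by rewrite /Rdiv Rmult_assoc Rinv_l; lra.
Qed.

(** * Two-sided bounds for the rescaled capacity at fixed [N] *)

Section Assembly.
Variables (L : nat) (x0 : 'I_L) (al ga : R) (A : {set 'I_L}) (n l : nat) (Cs Zeta Gam : R).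
Notation N := n.+1.
Hypothesis HL : (2 <= L)%N.
Hypotheses (ga1 : 1 < ga) (ga2 : ga <= 2) (gaal : 2 * ga + 1 <= al).
Hypothesis hCs : / phi_total al N <= Cs / aR (2 * al + 1) N.
Hypothesis hZ : is_lim_seq (fun k => \sum_(i < k) / aR ga i) Zeta.
Hypothesis hGam : is_lim_seq (fun k => \sum_(i < k) / aR al i) Gam.
Hypotheses (hl3 : (3 * L <= l)%N) (hln : (l + l + 3 <= n)%N).

Let X := aR (al + 1) N * capN al N (EN N l A) (EN N l (~: A)).
Let e := dev_const al Cs * (aR (al + 1) l / aR (al + 1) N).
Let E := err_const L al ga Cs * (INR L * (INR L * (Zeta ^ L * series_tail ga Zeta (l %/ L)))).
Let W := aR al N * WN al L N.
Let q := aR (2 * al + 1) N / phi_total al N.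
Let s := aR al N / aR al (n - l).
Let T := s / W * (2 * dev_const al Cs * aR (al + 1) L * aR (1 + ga) 3 * aR ga L) * / aR ga l
   * (INR L * Zeta ^ (L - 2)).
Let g := \sum_(i < (l %/ (2 * L)).+1) / aR al i.
Let C1 := al * exp (al * INR L) * INR L.
Let lo := INR #|A| * (INR (L - #|A|) * (q / W * g ^ (L - 2)) - T).
Let up := INR #|A| *
  (INR (L - #|A|) * (q / W * (s * (Gam ^ (L - 2) + C1 * (INR L / INR l) * Zeta ^ (L - 2)))) + T).

(** [cap_approx] multiplied by [N^(al+1)]: [e] is the deviation of the test function on the wells,
    [E] the error off the wells after [W_N >= N^(-al)], and [T] the share of the ties in the
    flux. *)
Lemma cap_bounds : 2 * e < 1 -> (lo - E) / (1 + 2 * e) <= X <= (up + E) / (1 - 2 * e).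
Proof.
have N0 : (0 < N)%N by []. have al0 : 0 <= al by lra.
have hG := psum_le_lim (invaR_ge0 al) hGam.
have a1 := aR_gt0 (al + 1) N; have a2 := aR_gt0 al N; have a3 := aR_gt0 al (n - l).
have a4 := aR_gt0 (2 * al + 1) N; have cb0 := dev_const_gt0 N0 hCs.
have nn := phi_total_gt0 al N0; have W0 := WN_gt0 al N x0.
have a5 := aR_gt0 ga l.
have e0 : 0 <= e.
  by apply: Rmult_le_pos; [lra|apply: Rlt_le; apply: Rdiv_lt_0_compat => //; exact: aR_gt0].
pose F := testF x0 al A N.
have hb p eta : isE N eta -> (N - l <= eta p)%N -> Rabs (F eta - indR (p \in A)) <= e.
  move=> hE hp; apply: Rle_trans (testF_bound x0 A HL al0 N0 hCs p hE) _.
  apply: Rmult_le_compat_l; first lra.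
  apply: div_mono; first lra.
  by apply: aR_mono; [lra|lia].
have hF1 eta : isE N eta -> EN N l A eta -> Rabs (F eta - 1) <= e.
  by move=> hE /exists_inP[x xA hx]; have := hb x eta hE hx; rewrite xA.
have hF0 eta : isE N eta -> EN N l (~: A) eta -> Rabs (F eta) <= e.
  move=> hE /exists_inP[x]; rewrite inE => xA hx; have := hb x eta hE hx.
  by rewrite (negbTE xA) Rminus_0_r.
have hl : (l + l < N)%N by lia.
have [cap0 hcap] := cap_approx x0 al hl hF1 hF0.
move=> e1; apply: (approx_bounds (Y := aR (al + 1) N *
   - (/ WN al L N * \sum_(eta <- enumE L N) (weight al eta * (F eta * gen al (well_indicator A n l) eta)))))
   => //.
- by apply: Rmult_le_pos; lra.
- rewrite /X -Rmult_minus_distr_l Rabs_mult Rabs_pos_eq; last lra.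
  have -> : forall c, 2 * e * (aR (al + 1) N * c) + E = aR (al + 1) N * (2 * e * c + E / aR (al + 1) N).
    by move=> c; field; lra.
  apply: Rmult_le_compat_l; first lra.
  apply: Rle_trans hcap _; apply: Rplus_le_compat_l.
  have off := off_wells_sum x0 A HL N0 ga1 ga2 gaal hCs hZ hl3.
  apply: Rle_trans (Rmult_le_compat_l _ _ _ (Rlt_le _ _ (Rinv_0_lt_compat _ W0)) off) _.
  have t0 : 0 <= series_tail ga Zeta (l %/ L).
    by have := psum_le_lim (invaR_ge0 ga) hZ (l %/ L); rewrite /series_tail; lra.
  have z1 := Zeta_ge1 hZ; have K0 := err_const_gt0 HL N0 ga1 gaal hCs.
  have E0 : 0 <= E.
    apply: Rmult_le_pos; first lra.
    apply: Rmult_le_pos; first exact: pos_INR.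
    apply: Rmult_le_pos; first exact: pos_INR.
    by apply: Rmult_le_pos => //; apply: pow_le; lra.
  have -> : err_const L al ga Cs / (aR (al + 1) N * aR al N) *
     (INR L * (INR L * (Zeta ^ L * series_tail ga Zeta (l %/ L)))) = E / (aR (al + 1) N * aR al N).
    by rewrite /E; field; lra.
  have -> : E / aR (al + 1) N = aR al N * (E / (aR (al + 1) N * aR al N)) by field; lra.
  apply: Rmult_le_compat_r.
    apply: Rmult_le_pos => //; apply: Rlt_le; apply: Rinv_0_lt_compat.
    exact: Rmult_lt_0_compat.
  have wg := WN_ge al N x0.
  rewrite -[X in _ <= X]Rinv_inv; apply: Rinv_le_contravar => //.
  exact: Rinv_0_lt_compat.
have -> : aR (al + 1) N * - (/ WN al L N * \sum_(eta <- enumE L N) (weight al eta *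
     (F eta * gen al (well_indicator A n l) eta))) =
   aR (al + 1) N * / WN al L N * \sum_(y in A) flux x0 al A n l y.
  rewrite Ropp_mult_distr_r well_indicator_flux; last by lia.
  by rewrite Rmult_assoc.
have c0 : 0 < aR (al + 1) N * / WN al L N.
  by apply: Rmult_lt_0_compat => //; exact: Rinv_0_lt_compat.
set c := aR (al + 1) N * / WN al L N in c0 *.
(* Here the power of the theorem is accounted for: [N^(1+al)] is [N^(2 al + 1)], which normalizes
   [phi_total], divided by [N^al], which normalizes [W_N]. *)
have cq : c * / phi_total al N = q / W.
  rewrite /c /q /W (_ : 2 * al + 1 = al + (al + 1)) ?(aRD al (al + 1)); last ring.
  by field; lra.
have cT : c * (/ aR al (n - l) * (2 * dev_const al Cs) * aR (al + 1) L / aR (al + 1) N *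
   aR (1 + ga) 3 * aR ga L / aR ga l * (INR L * Zeta ^ (L - 2))) = T.
  by rewrite /c /T /s /W; field; lra.
rewrite sumR_mull; split.
  rewrite /lo -sumR_const; apply: sumR_le => y yA.
  have := flux_lower x0 HL ga1 gaal hCs hZ hl3 hln (yA : y \in A); rewrite -/g => h.
  have := Rmult_le_compat_l _ _ _ (Rlt_le _ _ c0) h.
  rewrite Rmult_minus_distr_l cT -cq => h2; apply: Rle_trans h2; lra.
rewrite /up -sumR_const; apply: sumR_le => y yA.
have := flux_upper x0 HL ga1 gaal hCs hZ hG hl3 hln (yA : y \in A); rewrite -/C1 => h.
have := Rmult_le_compat_l _ _ _ (Rlt_le _ _ c0) h.
rewrite Rmult_plus_distr_l cT -cq => h2; apply: Rle_trans h2 _.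
apply: Rplus_le_compat_r.
set B := Gam ^ _ + _.
have z1 := Zeta_ge1 hZ.
have lp : 0 < INR l by have := @INR_ge1 l ltac:(lia); lra.
have B0 : 0 <= B.
  have Gam0 : 0 <= Gam by have := hG 0%N; rewrite big_ord0.
  apply: Rplus_le_le_0_compat; first exact: pow_le.
  apply: Rmult_le_pos; last by apply: pow_le; lra.
  apply: Rmult_le_pos.
    by repeat apply: Rmult_le_pos => //; [apply: Rlt_le; exact: exp_pos|exact: pos_INR].
  by apply: Rmult_le_pos; [exact: pos_INR|apply: Rlt_le; apply: Rinv_0_lt_compat].
have i0 : 0 < / phi_total al N by exact: Rinv_0_lt_compat.
have -> : c * (INR (L - #|A|) * (/ phi_total al N * (aR al n / aR al (n - l) * B))) =
   INR (L - #|A|) * (c * / phi_total al N * (aR al n / aR al (n - l) * B)) by ring.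
apply: Rmult_le_compat_l; first exact: pos_INR.
apply: Rmult_le_compat_l; first by apply: Rmult_le_pos; lra.
apply: Rmult_le_compat_r => //; apply: div_mono; first lra.
by apply: aR_mono.
Qed.

End Assembly.

Lemma is_lim_seq_add0 (u v : nat -> R) (a : R) :
  is_lim_seq u a -> is_lim_seq v 0 -> is_lim_seq (fun n => u n + v n) a.
Proof. by move=> h1 h2; have := is_lim_seq_plus' _ _ _ _ h1 h2; rewrite Rplus_0_r. Qed.

Lemma is_lim_seq_mul0 (u v : nat -> R) (a : R) :
  is_lim_seq u 0 -> is_lim_seq v a -> is_lim_seq (fun n => u n * v n) 0.
Proof. by move=> h1 h2; have := is_lim_seq_mult' _ _ _ _ h1 h2; rewrite Rmult_0_l. Qed.

Lemma is_lim_seq_scal0 (v : nat -> R) (a : R) :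
  is_lim_seq v 0 -> is_lim_seq (fun n => a * v n) 0.
Proof.
move=> h; have := is_lim_seq_mult' _ _ _ _ (is_lim_seq_const a) h.
by rewrite Rmult_0_r.
Qed.

Lemma is_lim_seq_eventually (u : nat -> R) (a b : R) : is_lim_seq u a -> a < b ->
  eventually (fun n => u n < b).
Proof.
move=> /is_lim_seq_spec h ab; have e0 : 0 < b - a by lra.
have [n0 h0] := h (mkposreal _ e0); exists n0 => n hn.
by have /Rabs_lt_between := h0 n hn; rewrite /=; lra.
Qed.

(** * Consequences of the growth conditions on the well sizes *)

Section ShiftedLengths.
Variable l : nat -> nat.
Hypothesis lpos : forall n, (0 < l n)%N.
Hypothesis llim : cv_infty (fun n => INR (l n)).
Hypothesis lo : Un_cv (fun n => INR (l n) / INR n) 0.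

Lemma tendsto_l : tendsto l.
Proof.
move=> M; have [n0 h] := llim (INR M); exists n0 => n hn.
by have /INR_lt/ltP := h n hn; lia.
Qed.

Lemma l_ratio : is_lim_seq (fun n => INR (l n.+1) / INR n.+1) 0.
Proof. exact: (proj1 (is_lim_seq_incr_1 _ _) (proj2 (is_lim_seq_Reals _ _) lo)). Qed.

Lemma l_small (C : nat) : eventually (fun n => (C * l n.+1 <= n)%N).
Proof.
have q : is_lim_seq (fun n => INR C.+1 * (INR (l n.+1) / INR n.+1)) 0.
  by apply: is_lim_seq_scal0; exact: l_ratio.
have [n0 h0] := is_lim_seq_eventually q Rlt_0_1.
exists n0 => n hn; have := h0 n hn.
have np : 0 < INR n.+1 by have := @INR_ge1 n.+1 isT; lra.
move=> h; have h2 : INR C.+1 * INR (l n.+1) < INR n.+1.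
  have -> : INR C.+1 * INR (l n.+1) = INR C.+1 * (INR (l n.+1) / INR n.+1) * INR n.+1.
    by field; lra.
  by rewrite -[X in _ < X]Rmult_1_l; apply: Rmult_lt_compat_r.
move: h2; rewrite -INR_muln => /INR_lt/ltP h2; have := lpos n.+1.
by rewrite mulSn in h2; lia.
Qed.

(** [aR_quot_le] with [K = 2]; the arguments differ by [l n.+1 + 1], at most twice [l n.+1]. *)
Lemma aR_shift_lim al : 0 <= al ->
  is_lim_seq (fun n => aR al n.+1 / aR al (n - l n.+1)) 1.
Proof.
move=> al0.
apply: (is_lim_seq_le_le_loc (fun=> 1) _
  (fun n => 1 + al * exp (al * 2) * 2 * 2 * (INR (l n.+1) / INR n.+1))).
- have [n0 h0] := l_small 4; exists n0 => n hn; have h := h0 n hn; have lp := lpos n.+1.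
  set m := l n.+1 in h lp *.
  have m0 : (0 < n - m)%N by lia.
  have mN : (n - m <= n.+1)%N by lia.
  have a1 := aR_gt0 al (n - m).
  split.
    apply: (Rmult_le_reg_r (aR al (n - m))) => //.
    rewrite /Rdiv Rmult_assoc Rinv_l ?Rmult_1_r ?Rmult_1_l; last lra.
    exact: aR_mono.
  have := @aR_quot_le al 2 (n - m) n.+1 al0 m0 mN.
  have k2 : INR n.+1 <= 2 * INR (n - m).
    have -> : 2 = INR 2 by [].
    by rewrite -INR_muln; apply: INR_le; lia.
  move=> /(_ k2) h2; apply: Rle_trans h2 _; apply: Rplus_le_compat_l.
  have -> : forall x, al * exp (al * 2) * 2 * 2 * x = al * exp (al * 2) * 2 * (2 * x) by move=> x; ring.
  apply: Rmult_le_compat_l.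
    by have := exp_pos (al * 2); nra.
  have np : 0 < INR n.+1 by have := @INR_ge1 n.+1 isT; lra.
  rewrite /Rdiv -Rmult_assoc; apply: Rmult_le_compat_r.
    by apply: Rlt_le; exact: Rinv_0_lt_compat.
  have -> : 2 = INR 2 by [].
  by rewrite -INR_muln; apply: INR_le; lia.
- exact: is_lim_seq_const.
apply: is_lim_seq_add0; first exact: is_lim_seq_const.
by apply: is_lim_seq_scal0; exact: l_ratio.
Qed.

Lemma aR_ratio_lim al : 0 <= al ->
  is_lim_seq (fun n => aR (al + 1) (l n.+1) / aR (al + 1) n.+1) 0.
Proof.
move=> al0; apply: (is_lim_seq_le_le_loc (fun=> 0) _ (fun n => INR (l n.+1) / INR n.+1)).
- have [n0 h0] := l_small 1; exists n0 => n hn; have h := h0 n hn; have lp := lpos n.+1.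
  have a1 := aR_gt0 (al + 1) n.+1; have a2 := aR_gt0 (al + 1) (l n.+1).
  have a3 := aR_gt0 al n.+1.
  have np : 0 < INR n.+1 by have := @INR_ge1 n.+1 isT; lra.
  split; first by apply: Rlt_le; exact: Rdiv_lt_0_compat.
  rewrite !aRD !aR1 //.
  have -> : aR al (l n.+1) * INR (l n.+1) / (aR al n.+1 * INR n.+1) =
     aR al (l n.+1) / aR al n.+1 * (INR (l n.+1) / INR n.+1) by field; lra.
  rewrite -[X in _ <= X]Rmult_1_l; apply: Rmult_le_compat_r.
    apply: Rmult_le_pos; [exact: pos_INR|apply: Rlt_le; exact: Rinv_0_lt_compat].
  apply: (Rmult_le_reg_r (aR al n.+1)) => //.
  rewrite /Rdiv Rmult_assoc Rinv_l ?Rmult_1_r ?Rmult_1_l; last lra.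
  by apply: aR_mono => //; lia.
- exact: is_lim_seq_const.
exact: l_ratio.
Qed.

End ShiftedLengths.

Theorem theorem2p1 (L : nat) (HL : (2 <= L)%N) (al : R) (Hal : 3 < al)
  (l : nat -> nat) (Hlpos : forall N, (0 < l N)%N)
  (Hlinf : cv_infty (fun N => INR (l N)))
  (Hlo : Un_cv (fun N => INR (l N) / INR N) 0)
  (Gam : R) (HGam : infinite_sum (fun j => / aR al j) Gam)
  (pr : Riemann_integrable (fun u => rpow u al * rpow (1 - u) al) 0 1)
  (A : {set 'I_L}) (HA0 : A != set0) (HAT : A != setT) :
  Un_cv (fun N => Rpower (INR N) (1 + al) *
                  capN al N (EN N (l N) A) (EN N (l N) (~: A)))
        (/ (Gam * RiemannInt pr) *
           (INR #|A| * INR (L - #|A|) / INR L)).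
Proof.
have [x0 _] := set0Pn _ HA0.
(* [Rmin 2 ((al - 1) / 2)] exceeds 1 exactly when [3 < al]. *)
have [ga [ga1 ga2 gaal]] : exists ga, [/\ 1 < ga, ga <= 2 & 2 * ga + 1 <= al].
  have h1 := Rmin_l 2 ((al - 1) / 2); have h2 := Rmin_r 2 ((al - 1) / 2).
  exists (Rmin 2 ((al - 1) / 2)); split; [apply: Rmin_glb_lt; lra|exact: h1|lra].
have al0 : 0 <= al by lra.
have [Zeta hZ] := pseries_cv ga1.
have hGam : is_lim_seq (fun k => \sum_(i < k) / aR al i) Gam.
  apply/is_lim_seq_incr_1.
  apply: (is_lim_seq_ext (fun n => sum_f_R0 (fun j => / aR al j) n)).
    by move=> n; exact: esym (sumR_ord_nat n (fun j => / aR al j)).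
  by apply/is_lim_seq_Reals.
have Gam1 : 1 <= Gam.
  have := psum_le_lim (invaR_ge0 al) hGam 1; rewrite big_ord_recr big_ord0 /= Rinv_1; lra.
have al1 : 0 < al by lra.
have [I0 hI] := phi_total_lim pr al1; set I := RiemannInt pr in I0 hI *.
have hW := WN_lim x0 HL ga1 ga2 gaal hZ hGam.
have L0 : 0 < INR L by have := @INR_ge1 L ltac:(lia); lra.
have hq : is_lim_seq (fun n => aR (2 * al + 1) n.+1 / phi_total al n.+1) (/ I).
  have hi := is_lim_seq_inv _ _ hI; have I0' : Rbar.Finite I <> 0 by case; lra.
  apply: is_lim_seq_ext (hi I0') => n; rewrite /Rdiv Rinv_mult Rinv_inv Rmult_comm //.
(* Any constant above the limit [/ I] of the normalized inverse of [phi_total] would do. *)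
pose Cs := 2 / I.
have hCs : eventually (fun n => / phi_total al n.+1 <= Cs / aR (2 * al + 1) n.+1).
  have lt : / I < Cs by rewrite /Cs /Rdiv; have := Rinv_0_lt_compat _ I0; lra.
  have [n0 h0] := is_lim_seq_eventually hq lt; exists n0 => n hn; have := h0 n hn.
  have a1 := aR_gt0 (2 * al + 1) n.+1 => h; apply: (Rmult_le_reg_l (aR (2 * al + 1) n.+1)) => //.
  have -> : aR (2 * al + 1) n.+1 * (Cs / aR (2 * al + 1) n.+1) = Cs by field; lra.
  by move: h; rewrite /Rdiv; lra.
pose e n := dev_const al Cs * (aR (al + 1) (l n.+1) / aR (al + 1) n.+1).
have he : is_lim_seq e 0 by apply: is_lim_seq_scal0; exact: aR_ratio_lim.
have tl : tendsto (fun n => l n.+1) by apply: tendsto_S; exact: tendsto_l.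
pose E n := err_const L al ga Cs * (INR L * (INR L * (Zeta ^ L * series_tail ga Zeta (l n.+1 %/ L)))).
have hE : is_lim_seq E 0.
  do 4 apply: is_lim_seq_scal0.
  apply: (is_lim_seq_comp (u := series_tail ga Zeta) (f := fun n => (l n.+1 %/ L)%N)) (series_tail_lim hZ).
  by apply: tendsto_div => //; lia.
pose W n := aR al n.+1 * WN al L n.+1.
pose q n := aR (2 * al + 1) n.+1 / phi_total al n.+1.
pose s n := aR al n.+1 / aR al (n - l n.+1).
have hs : is_lim_seq s 1 by exact: aR_shift_lim.
pose T n := s n / W n * (2 * dev_const al Cs * aR (al + 1) L * aR (1 + ga) 3 * aR ga L) *
  / aR ga (l n.+1) * (INR L * Zeta ^ (L - 2)).
pose w := INR L * Gam ^ L.-1.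
have w0 : 0 < w by apply: Rmult_lt_0_compat => //; apply: pow_lt; lra.
have hWi : is_lim_seq (fun n => / W n) (/ w).
  by apply: (is_lim_seq_inv _ _ hW); case; rewrite -/w; lra.
have hT : is_lim_seq T 0.
  pose K2 := 2 * dev_const al Cs * aR (al + 1) L * aR (1 + ga) 3 * aR ga L.
  have h1 : is_lim_seq (fun n => s n * / W n * K2) (1 * / w * K2).
    apply: is_lim_seq_mult' (is_lim_seq_const _); exact: is_lim_seq_mult'.
  have h2 : is_lim_seq (fun n => / aR ga (l n.+1)) 0.
    exact: (is_lim_seq_comp (u := fun k => / aR ga k) tl (invaR_lim hZ)).
  have h3 := is_lim_seq_mul0 (is_lim_seq_mul0 h2 h1) (is_lim_seq_const (INR L * Zeta ^ (L - 2))).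
  by apply: is_lim_seq_ext h3 => n; rewrite /T -/K2 [/ aR ga _ * _]Rmult_comm.
pose g n := \sum_(i < (l n.+1 %/ (2 * L)).+1) / aR al i.
have hg : is_lim_seq g Gam.
  apply: (is_lim_seq_comp (u := fun k => \sum_(i < k) / aR al i)
     (f := fun n => (l n.+1 %/ (2 * L)).+1)) hGam.
  apply: (@tendsto_le (fun n => (l n.+1 %/ (2 * L))%N)); first by move=> n; exact: leqnSn.
  by apply: tendsto_div => //; lia.
pose C1 := al * exp (al * INR L) * INR L.
pose G n := Gam ^ (L - 2) + C1 * (INR L / INR (l n.+1)) * Zeta ^ (L - 2).
have hG : is_lim_seq G (Gam ^ (L - 2)).
  apply: is_lim_seq_add0; first exact: is_lim_seq_const.
  apply: is_lim_seq_mul0 (is_lim_seq_const _).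
  do 2 apply: is_lim_seq_scal0.
  exact: (is_lim_seq_comp (u := fun k => / INR k) tl is_lim_seq_inv_INR).
pose lw n := INR #|A| * (INR (L - #|A|) * (q n / W n * g n ^ (L - 2)) - T n).
pose up n := INR #|A| * (INR (L - #|A|) * (q n / W n * (s n * G n)) + T n).
(* The limits of [lw] and [up] agree: [Gam ^ (L - 2)] from the flux against [Gam ^ L.-1] in [w]
   leaves one factor [/ Gam], and [w] also supplies [/ INR L]. *)
pose lim := INR #|A| * (INR (L - #|A|) * (/ I * / w * Gam ^ (L - 2))).
have hqW : is_lim_seq (fun n => q n / W n) (/ I * / w) by exact: is_lim_seq_mult'.
have hlw : is_lim_seq lw lim.
  apply: (is_lim_seq_mult' _ _ _ _ (is_lim_seq_const _)).
  rewrite -[X in is_lim_seq _ (Rbar.Finite X)]Rminus_0_r.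
  apply: (is_lim_seq_minus' _ _ _ _ _ hT).
  apply: (is_lim_seq_mult' _ _ _ _ (is_lim_seq_const _)).
  by apply: (is_lim_seq_mult' _ _ _ _ hqW); exact: is_lim_seq_powR.
have hup : is_lim_seq up lim.
  apply: (is_lim_seq_mult' _ _ _ _ (is_lim_seq_const _)).
  apply: is_lim_seq_add0 hT.
  apply: (is_lim_seq_mult' _ _ _ _ (is_lim_seq_const _)).
  apply: (is_lim_seq_mult' _ _ _ _ hqW).
  by rewrite -[Gam ^ _]Rmult_1_l; exact: is_lim_seq_mult'.
have -> : / (Gam * I) * (INR #|A| * INR (L - #|A|) / INR L) = lim.
  rewrite /lim /w (_ : L.-1 = (L - 2).+1) /=; last by lia.
  have gp : 0 < Gam ^ (L - 2) by apply: pow_lt; lra.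
  by field; lra.
apply/is_lim_seq_Reals/is_lim_seq_incr_1.
have h2e : is_lim_seq (fun n => 2 * e n) 0 by exact: is_lim_seq_scal0.
apply: (is_lim_seq_le_le_loc (fun n => (lw n - E n) / (1 + 2 * e n)) _
   (fun n => (up n + E n) / (1 - 2 * e n))).
- have ev := is_lim_seq_eventually h2e Rlt_0_1.
  (* Since [l] is positive, [5 * l <= n] yields [2 * l + 3 <= n], the separation that [cap_bounds]
     requires. *)
  have ev2 := l_small Hlpos Hlo 5.
  have ev3 := tl (3 * L)%N.
  have [n0 h0] := filter_and _ _ ev (filter_and _ _ ev2 (filter_and _ _ ev3 hCs)).
  exists n0 => n hn; have [k1 [k2 [k3 k4]]] := h0 n hn.
  have k5 : (l n.+1 + l n.+1 + 3 <= n)%N by have := Hlpos n.+1; lia.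
  have := @cap_bounds L x0 al ga A n (l n.+1) Cs Zeta Gam HL ga1 ga2 gaal k4 hZ hGam k3 k5 k1.
  have -> : Rpower (INR n.+1) (1 + al) = aR (al + 1) n.+1 by rewrite Rplus_comm.
  exact.
- have -> : lim = (lim - 0) / 1 by field.
  apply: is_lim_seq_div'; [|exact: is_lim_seq_add0 (is_lim_seq_const _) h2e|lra].
  exact: is_lim_seq_minus'.
- have -> : lim = (lim + 0) / (1 - 0) by field.
  apply: is_lim_seq_div'; [|exact: is_lim_seq_minus' (is_lim_seq_const _) h2e|lra].
  exact: is_lim_seq_plus'.
Qed.
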